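(* Let $U\subset\mathbb{C}$ be a rectangle with sides parallel to the coordinate axes. Then, as $p\to\infty$ through the primes, $$\lim_{p\to\infty}\mathrm{m}\left(t\in[0,1]:\frac{F_p(e(t))}{F_p(\zeta_p)}\in U\right)=\mathbb{P}\big(G_{\mathbb{X}}(\theta)\in U\big),$$ where $\zeta_p:=e(1/p)$ and $\theta$ is a random variable uniformly distributed on $[0,1]$, independent of $\{\mathbb{X}(m)\}_{m\in\mathbb{Z}}$.
   Context: Write $e(t):=e^{2\pi i t}$, and let $\mathrm{m}$ be Lebesgue measure on $[0,1]$. For an odd prime $p$, the Fekete polynomial is $F_p(z):=\sum_{n=1}^{p-1}\left(\frac{n}{p}\right)z^n$, where $\left(\frac{\cdot}{p}\right)$ is the Legendre symbol modulo $p$. (The number $F_p(\zeta_p)$ is the Gauss sum, equal to $\sqrt p$ if $p\equiv1\pmod 4$ and to $i\sqrt p$ if $p\equiv3\pmod4$.) Let $\{\mathbb{X}(m)\}_{m\in\mathbb{Z}}$ be independent identically distributed random variables taking the values $\pm1$ with probability $1/2$ each. The random process $G_{\mathbb{X}}$ on $C[0,1]$ is $$G_{\mathbb{X}}(t):=\sum_{m\in\mathbb{Z}}\frac{e(t)-1}{2\pi i(m-t)}\,\mathbb{X}(m),\qquad t\in[0,1],$$ where the series is the (almost surely existing) limit of the sums over $|m|\le M$ as $M\to\infty$, and the coefficients at $(m,t)=(0,0)$ and $(1,1)$ are interpreted by continuity (their value is $-1$). *)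

(* Defs.v *)
From HB Require Import structures.
From mathcomp Require Import all_boot all_order all_algebra.
From mathcomp Require Import all_classical all_reals all_analysis.
From mathcomp Require Import complex.
Import Order.TTheory GRing.Theory Num.Theory.
Import numFieldNormedType.Exports.

Set Implicit Arguments.
Unset Strict Implicit.
Unset Printing Implicit Defensive.

Local Open Scope classical_set_scope.
Local Open Scope ring_scope.
Local Open Scope complex_scope.

Section Fekete.
Variable R : realType.

(* e(t) = exp(2 i pi t) *)
Definition e (t : R) : R[i] := cos (2 * pi * t) +i* sin (2 * pi * t).

Definition legendre (p n : nat) : int :=
  if (p %| n)%N then 0
  else if [exists x : 'I_p, (x ^ 2 == n %[mod p])%N] then 1 else -1.

Definition fekete (p : nat) : {poly R[i]} :=
  \sum_(1 <= n < p) (legendre p n)%:~R *: 'X^n.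

Definition zeta (p : nat) : R[i] := e p%:R^-1.

(* At t = m the quotient is replaced by its limit, -1. *)
Definition Gcoef (m : int) (t : R) : R[i] :=
  if t == m%:~R then -1
  else (e t - 1) / (2 * 'i%C * pi%:C * (m%:~R - t%:C)).

(* The index m = k - M runs over the integers with |m| <= M. *)
Definition Gpartial (x : int -> R) (t : R) (M : nat) : R[i]^o :=
  \sum_(k < (2 * M).+1) let m := k%:Z - M%:Z in Gcoef m t * (x m)%:C.

(* [lim] is total: its value is arbitrary where the partial sums diverge. *)
Definition G (x : int -> R) (t : R) : R[i] := lim (Gpartial x t @ \oo).

(* A bounded nondegenerate rectangle; each of the four sides may or may not
   belong to it, according to the Booleans. *)
Definition is_rectangle (U : set R[i]) : Prop :=
  exists (a b c d : R) (la lb lc ld : bool),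
    [/\ a < b, c < d &
        U = [set z | (complex.Re z \in Interval (BSide la a) (BSide lb b)) /\
                     (complex.Im z \in Interval (BSide lc c) (BSide ld d))]].

End Fekete.

Section Probability.
Context (R : realType) (d : measure_display) (T : measurableType d).
Variable P : probability T R.

Definition mutually_independent (I : choiceType) (X : I -> {RV P >-> R}) :=
  forall (s : seq I) (B : I -> set R), uniq s -> (forall i, measurable (B i)) ->
    P (\bigcap_(i in [set` s]) X i @^-1` B i) =
    (\prod_(i <- s) P (X i @^-1` B i))%E.

Definition sigma_family (I : Type) (X : I -> {RV P >-> R}) : set (set T) :=
  <<s \bigcup_i preimage_set_system setT (X i) measurable >>.

Definition independent_of_family (I : Type) (Y : {RV P >-> R})
    (X : I -> {RV P >-> R}) :=
  forall (A : set T) (B : set R), sigma_family X A -> measurable B ->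
    P (A `&` Y @^-1` B) = (P A * P (Y @^-1` B))%E.

Definition rademacher (X : {RV P >-> R}) :=
  P (X @^-1` [set 1]) = 2^-1%:E /\ P (X @^-1` [set -1]) = 2^-1%:E.

Definition uniform01 (Y : {RV P >-> R}) :=
  forall B : set R, measurable B -> distribution P Y B = uniform_prob (@ltr01 R) B.

End Probability.

(* Main.v *)
Require Import Defs.
From mathcomp Require Import all_boot all_order all_algebra cyclic finfield.
From mathcomp Require Import all_classical all_reals all_analysis.
From mathcomp Require Import measurable_realfun complex.
From mathcomp Require Import zify ring lra.
Import Order.TTheory GRing.Theory Num.Theory.
Import numFieldNormedType.Exports.

(** Fix an odd prime [p], put [h = (p - 1) / 2] and let [chi] be the quadratic
    character of ['F_p].  Since [chi] is, up to the Gauss sum, its own Fourier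
    transform, evaluating [F_p] at the point [e ((k + s) / p)] of the unit circle
    and dividing by [F_p (zeta_p)] gives ([feketeratio_window])

      [\sum_(|m| <= h) chi (k + m) * c_p m s],
      [c_p m s = p^-1 * \sum_(l < p) e (l * (s - m) / p)].

    Each [c_p m s] is a geometric sum, it is bounded by a multiple of [1 / |m|],
    and it tends to [- Gcoef m s] as [p] grows ([rotcoef_cvg]).  A uniform [t] in
    [[0, 1]] corresponds to a uniform [k] modulo [p] and an independent uniform
    [s] ([unif_scaling]).  The quotient thus looks like the random series [G], the
    signs being the values of [- chi] around [k].  Four facts turn this into a
    proof.

    Patterns.  For a fixed window [|m| <= M], the values of [chi (k + m)] take each
    of the [2 ^ (2 M + 1)] sign patterns with asymptotically the same frequency
    ([pattern_equidistribution]).  Expanding the indicator function of a pattern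
    reduces this to showing that [\sum_k chi (f k)] is [o(p)] for every product [f]
    of distinct linear factors; this weak form of Weil's bound follows from
    Stepanov's method ([stepanov]).

    Tails.  The translates of [chi] are almost orthogonal functions of [k]
    ([quadchar_quasi_orthogonal]), exactly as independent signs are
    ([sign_orthogonal]).  As the squares [1 / m ^ 2] are summable, Chebyshev's
    inequality ([pr_chebyshev]) makes the terms with [|m| > M] negligible, both for
    the Fekete polynomial and for [G].

    Convergence.  Along [N = k ^ 6] the same inequality and a union bound control
    the partial sums of [G]; between two consecutive sixth powers the partial sums
    move by at most the sum of the coefficients involved, which is [O(1 / k)].  So
    [G] converges almost surely, with an explicit rate outside an event of small
    probability ([GX_approx]).  As [theta] is independent of the signs, the law of a
    partial sum is the average over all sign patterns of its law under a uniform
    [theta] ([pr_joint_le], [pr_joint_ge]), the same average as the one that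
    describes the Fekete polynomial.

    Boundary.  Neither the real nor the imaginary part of [G] has an atom
    ([GX_anticoncentration]): changing a single sign moves the sum by twice a
    coefficient, and the coefficients have distinct absolute values for almost all
    values of [theta], so that among the [K] sums obtained by changing one of [K]
    given signs at most one can lie in a given short interval.

    The first three facts show that for every 1-Lipschitz function [rho] on the
    plane the probability of [rho <= 0] for the Fekete quotient is at most the
    probability of [rho <= eps] for [G], plus [eps], when [p] is large
    ([pr_fekete_le]).  Applied to the signed distance to the rectangle, and to its
    opposite, this bounds the limit from above and from below by probabilities
    which differ by the mass that [G] puts near the boundary; the fourth fact makes
    that mass arbitrarily small. *)

Set Implicit Arguments.
Unset Strict Implicit.
Unset Printing Implicit Defensive.

Local Open Scope ring_scope.

(** * Derivations and multiplicity of roots *)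

Lemma dvdp_prod_XsubC_exp (F : fieldType) (P : {poly F}) (l : nat) (s : seq F) :
  uniq s -> (forall x, x \in s -> ('X - x%:P) ^+ l %| P) ->
  \prod_(x <- s) ('X - x%:P) ^+ l %| P.
Proof.
elim: s => [|x s IHs] /=; first by rewrite big_nil dvd1p.
move=> /andP[xs us] sP; rewrite big_cons Gauss_dvdp.
  by rewrite sP ?mem_head//= IHs// => y ys; apply: sP; rewrite in_cons ys orbT.
rewrite coprimep_expl// coprimep_sym coprimep_XsubC /root horner_prod.
rewrite prodf_seq_neq0; apply/allP => y ys /=.
by rewrite horner_exp !hornerE expf_neq0// subr_eq0; apply: contraNneq xs => ->.
Qed.

Section FDeriv.
Variables (F : finFieldType) (p : nat).
Hypothesis pcharF : p \in [pchar F].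
Variable f : {poly F}.

(** The derivation [f * d/dX] replaces [d/dX] because it preserves polynomials of
    the form [(r + s * f ^+ g) * 'X^(p * j)], see [fderiv_twisted]; it detects
    multiplicities equally well at the points where [f] does not vanish. *)
Definition fderiv (P : {poly F}) : {poly F} := f * P^`().

(** At a point where [f] does not vanish, the derivation lowers the multiplicity of
    a root by exactly one as long as this multiplicity is nonzero modulo [p]. *)
Lemma mup_fderiv (x : F) (l k : nat) (P Q : {poly F}) :
  ~~ root f x -> (l <= p)%N -> (k < l)%N ->
  P = Q * ('X - x%:P) ^+ k -> ~~ root Q x ->
  exists2 i, (i < l)%N & ~~ root (iter i fderiv P) x.
Proof.
move=> fx; elim: k l P Q => [|k IHk] l P Q lp kl PE Qx.
  by exists 0%N => //=; rewrite PE mulr1.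
case: l lp kl => // l lp kl.
have [||i il rt] := IHk l (fderiv P)
    (f * (Q^`() * ('X - x%:P) + Q *+ k.+1)) (ltnW lp) kl.
- rewrite /fderiv PE derivM deriv_exp derivXsubC mul1r /=.
  by rewrite exprS; ring.
- rewrite rootM negb_or fx /= /root !hornerE subrr mulr0 add0r.
  rewrite hornerMn -mulr_natr mulf_neq0//.
  by rewrite -(dvdn_pcharf pcharF) gtnNdvd// (leq_trans kl lp).
by exists i.+1; rewrite ?iterSr.
Qed.

Lemma dvdp_iter_fderiv (x : F) (l : nat) (P : {poly F}) :
  P != 0 -> ~~ root f x -> (l <= p)%N ->
  (forall i, (i < l)%N -> root (iter i fderiv P) x) ->
  ('X - x%:P) ^+ l %| P.
Proof.
move=> P0 fx lp Hi; have [k [Q]] := multiplicity_XsubC P x.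
rewrite P0 /= => Qx PE; case: (ltnP k l) => [kl|lk].
  by have [i il] := mup_fderiv fx lp kl PE Qx; rewrite Hi.
by rewrite PE dvdp_mull// dvdp_exp2l.
Qed.

End FDeriv.

Section StepanovNonvanishing.
Variables (F : finFieldType) (p g : nat).
Hypotheses (pcharF : p \in [pchar F]) (cardF : #|F| = p) (pg : p = (2 * g).+1).

(** The Frobenius map kills everything but the constant term modulo ['X^p]. *)
Lemma dvdp_Xn_exp_sub (f : {poly F}) : 'X^p %| f ^+ p - f.[0]%:P.
Proof.
have [h fE] : exists h, f = h * 'X + f.[0]%:P.
  have /factor_theorem[h hE] : root (f - f.[0]%:P) 0 by rewrite /root !hornerE subrr.
  by exists h; rewrite -[LHS](subrK f.[0]%:P) hE subr0.
rewrite {1}fE exprDn_pchar; last first.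
  by rewrite pnatE ?(pcharf_prime pcharF)// pchar_poly.
by rewrite -polyC_exp -cardF expf_card addrK exprMn dvdp_mull.
Qed.

(** The multiplicity of the root [al] is odd on the left and even on the right. *)
Lemma simple_root_not_square (f r s : {poly F}) (al c : F) (f1 : {poly F}) :
  f = ('X - al%:P) * f1 -> ~~ root f1 al -> c != 0 ->
  f * r ^+ 2 = c%:P * s ^+ 2 -> r = 0 /\ s = 0.
Proof.
move=> fE f1al c0 E.
have f0 : f != 0.
  by rewrite fE mulf_neq0 ?polyXsubC_eq0//; apply: contraNneq f1al => ->; rewrite root0.
have [r0|r0] := eqVneq r 0.
  split=> //; move/eqP: E; rewrite r0 expr0n mulr0 eq_sym mulf_eq0 polyC_eq0.
  by rewrite (negbTE c0) sqrf_eq0 => /eqP.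
have s0 : s != 0.
  apply: contra_neq r0 => s0; move/eqP: E; rewrite s0 expr0n mulr0 mulf_eq0.
  by rewrite (negbTE f0) sqrf_eq0 => /eqP.
move/(congr1 (mup al)): E; rewrite fE -mulrA.
rewrite (mupMr _ (q1 := c%:P)); last by rewrite rootC.
rewrite mupM ?polyXsubC_eq0//; last first.
  rewrite mulf_neq0 ?sqrf_eq0//; by apply: contraNneq f1al => ->; rewrite root0.
rewrite mupMr// -[X in mup _ X]expr1 mup_XsubCX eqxx !expr2 !mupM//.
lia.
Qed.

(** Linear independence of the building blocks of the auxiliary polynomial.  Let
    [k] be the first index with a nonzero term.  Modulo ['X^p], only this term
    remains: [r k + s k * f ^+ g] is divisible by ['X^p].  Squaring and multiplying
    by [f] gives [f * r k ^+ 2 = s k ^+ 2 * f ^+ p = f.[0] * s k ^+ 2] modulo ['X^p],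
    which is an equality for reasons of degree, and a simple root of [f] forbids
    it. *)
Lemma stepanov_nonvanishing (f f1 : {poly F}) (al : F) (J D : nat)
    (r s : nat -> {poly F}) :
  f = ('X - al%:P) * f1 -> ~~ root f1 al -> f.[0] != 0 ->
  (forall j, size (r j) <= D)%N -> (forall j, size (s j) <= D)%N ->
  (2 * D + size f <= p)%N ->
  \sum_(j < J) (r j + s j * f ^+ g) * 'X^(p * j) = 0 ->
  forall j, (j < J)%N -> r j = 0 /\ s j = 0.
Proof.
move=> fE f1al f0 rD sD Dp sum0 j; elim/ltn_ind: j => k IHk kJ.
pose tl (u : nat -> {poly F}) := \sum_(j < J - k.+1) u (k.+1 + j)%N * 'X^(p * j).
have split_sum (u : nat -> {poly F}) : (forall j, (j < k)%N -> u j = 0) ->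
    \sum_(j < J) u j * 'X^(p * j) = (u k + 'X^p * tl u) * 'X^(p * k).
  move=> u0; rewrite -(big_mkord xpredT (fun j => u j * 'X^(p * j))).
  rewrite (big_cat_nat (n := k)) ?(ltnW kJ)//= big_nat big1 ?add0r; last first.
    by move=> j /andP[_ jk]; rewrite u0// mul0r.
  rewrite big_ltn// mulrDl; congr (_ + _).
  rewrite -{1}(add0n k.+1) big_addn big_mkord /tl big_distrr big_distrl /=.
  apply: eq_bigr => j _; rewrite addnC mulrCA -!mulrA -!exprD; congr (_ * 'X^_).
  by lia.
have r0 j : (j < k)%N -> r j = 0 by move=> jk; case: (IHk j jk (ltn_trans jk kJ)).
have s0 j : (j < k)%N -> s j = 0 by move=> jk; case: (IHk j jk (ltn_trans jk kJ)).
have E : (r k + 'X^p * tl r) + (s k + 'X^p * tl s) * f ^+ g = 0.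
  apply: (mulIf (x := 'X^(p * k))); first by rewrite monic_neq0// monicXn.
  rewrite mul0r -[RHS]sum0 mulrDl mulrAC -!split_sum// mulr_suml -big_split/=.
  by apply: eq_bigr => j _; rewrite mulrDl; congr (_ + _); rewrite mulrAC.
have /dvdpP[h hE] := dvdp_Xn_exp_sub f.
have dv : 'X^p %| f * r k ^+ 2 - f.[0]%:P * s k ^+ 2.
  have E2 : f * (r k + 'X^p * tl r) ^+ 2 = (s k + 'X^p * tl s) ^+ 2 * f ^+ p.
    move/eqP: E; rewrite addr_eq0 => /eqP ->.
    rewrite sqrrN exprMn mulrCA -exprM; congr (_ * _).
    by rewrite pg mulnC exprS.
  move/eqP: hE; rewrite subr_eq => /eqP hE; rewrite hE in E2.
  apply/dvdpP; exists ((s k + 'X^p * tl s) ^+ 2 * h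
     + f.[0]%:P * (s k *+ 2 * tl s + 'X^p * tl s ^+ 2)
     - f * (r k *+ 2 * tl r + 'X^p * tl r ^+ 2)).
  have : f * (r k + 'X^p * tl r) ^+ 2 - (s k + 'X^p * tl s) ^+ 2 * (h * 'X^p + (f.[0])%:P) = 0.
    by rewrite E2 subrr.
  move=> E3; rewrite -[LHS]subr0 -[X in _ - X]E3; ring.
have szm' b c : (c <= D)%N -> (b <= (c + c).-1)%N -> (b <= p)%N by lia.
have szm b c : (c <= D)%N -> (b <= (c + c).-1)%N -> ((size f + b).-1 <= p)%N.
  by lia.
have : f * r k ^+ 2 = f.[0]%:P * s k ^+ 2.
  apply/eqP; rewrite -subr_eq0; apply: contraLR dv => nz.
  rewrite gtNdvdp// size_polyXn ltnS.
  apply: leq_trans (size_polyD _ _) _; rewrite size_polyN geq_max; apply/andP; split.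
    apply: leq_trans (size_polyMleq _ _) _; rewrite expr2.
    exact: szm (rD k) (size_polyMleq _ _).
  rewrite mul_polyC; apply: leq_trans (size_scale_leq _ _) _; rewrite expr2.
  exact: szm' (sD k) (size_polyMleq _ _).
exact: simple_root_not_square fE f1al f0.
Qed.

End StepanovNonvanishing.

(** * Stepanov's auxiliary polynomial *)

Section Stepanov.
Variables (F : finFieldType) (p g : nat).
Hypotheses (pcharF : p \in [pchar F]) (cardF : #|F| = p) (pg : p = (2 * g).+1).
Variables (f f1 : {poly F}) (al : F) (m : nat).
Hypotheses (fE : f = ('X - al%:P) * f1) (f1al : ~~ root f1 al)
  (f0 : f.[0] != 0) (size_f : size f = m.+1).

(** The action of [fderiv f] on the coefficients [r] and [s] of [r + s * f ^+ g]. *)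
Definition diff_plain (r : {poly F}) : {poly F} := f * r^`().
Definition diff_twisted (s : {poly F}) : {poly F} := f * s^`() + g%:R *: (f^`() * s).

Lemma fderiv_twisted (J : nat) (r s : nat -> {poly F}) :
  fderiv f (\sum_(j < J) (r j + s j * f ^+ g) * 'X^(p * j)) =
  \sum_(j < J) (diff_plain (r j) + diff_twisted (s j) * f ^+ g) * 'X^(p * j).
Proof.
rewrite /fderiv raddf_sum big_distrr/=; apply: eq_bigr => j _.
have pcharP : p \in [pchar {poly F}] by rewrite pchar_poly.
rewrite derivM derivXn mulrnA (mulrn_pchar pcharP) mul0rn mulr0 addr0 mulrA.
congr (_ * _).
rewrite derivD derivM deriv_exp /diff_plain /diff_twisted.
have fg : f * f ^+ g.-1 *+ g = f ^+ g *+ g.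
  by case: (g) => [|g']; rewrite ?mulr0n// exprS.
rewrite -mul_polyC polyC_natr.
transitivity (f * (r j)^`() + f * (s j)^`() * f ^+ g + s j * f^`() * (f * f ^+ g.-1 *+ g)).
  by ring.
by rewrite fg; ring.
Qed.

Lemma iter_fderiv_twisted (J i : nat) (r s : nat -> {poly F}) :
  iter i (fderiv f) (\sum_(j < J) (r j + s j * f ^+ g) * 'X^(p * j)) =
  \sum_(j < J) (iter i diff_plain (r j) + iter i diff_twisted (s j) * f ^+ g) * 'X^(p * j).
Proof.
elim: i => //= i ->.
exact: fderiv_twisted (fun j => iter i diff_plain (r j)) (fun j => iter i diff_twisted (s j)).
Qed.

Lemma leq_size_deriv (r : {poly F}) : (size r^`() <= size r)%N.
Proof.
have [->|r0] := eqVneq r 0; first by rewrite deriv0.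
exact/ltnW/lt_size_deriv.
Qed.

Lemma size_diff_plain (r : {poly F}) D : (size r <= D -> size (diff_plain r) <= D + m)%N.
Proof.
move=> rD; apply: leq_trans (size_polyMleq _ _) _.
have szm a b : (a <= m.+1)%N -> (b <= D)%N -> ((a + b).-1 <= D + m)%N by lia.
by rewrite szm ?size_f// (leq_trans (leq_size_deriv r)).
Qed.

Lemma size_diff_twisted (s : {poly F}) D : (size s <= D -> size (diff_twisted s) <= D + m)%N.
Proof.
move=> sD; apply: leq_trans (size_polyD _ _) _; rewrite geq_max.
rewrite size_diff_plain//=; apply: leq_trans (size_scale_leq _ _) _.
apply: leq_trans (size_polyMleq _ _) _.
have szm a b : (a <= m.+1)%N -> (b <= D)%N -> ((a + b).-1 <= D + m)%N by lia.
by apply: szm sD; rewrite -size_f leq_size_deriv.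
Qed.

Lemma size_iter_diff (dd : {poly F} -> {poly F}) :
  (forall (r : {poly F}) D, size r <= D -> size (dd r) <= D + m)%N ->
  forall i (r : {poly F}) D, (size r <= D -> size (iter i dd r) <= D + i * m)%N.
Proof.
move=> ddP; elim=> [|i IHi] r D rD; first by rewrite addn0.
by rewrite iterS mulSn (addnC m) addnA ddP// IHi.
Qed.

Lemma iter_diff_plainB i : {morph iter i diff_plain : x y / x - y}.
Proof.
elim: i => [|i IHi] x y //=; rewrite IHi /diff_plain derivB; ring.
Qed.

Lemma iter_diff_twistedB i : {morph iter i diff_twisted : x y / x - y}.
Proof.
elim: i => [|i IHi] x y //=; rewrite IHi /diff_twisted derivB -!mul_polyC; ring.
Qed.

Variables (L : nat) (a : F).
Hypothesis a0 : a != 0.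
Let l := (2 * L)%N.
Let J := L.+1.
(** With [l] the order of vanishing and [D] the bound on the sizes of the [2 * J]
    unknown polynomials, each of the [l] vanishing conditions concerns a polynomial
    of size at most [E]; [L_small] says that [l * E < 2 * J * D], so that there are
    more unknowns than equations. *)
Hypothesis L_small : (m + L * (l * m + J) < g)%N.
Hypothesis L_p : (l <= p)%N.
Let D := (g - m)%N.
Let E := (D + l * m + J)%N.

Let rr (w : 'M[F]_(J + J, D)) (j : nat) : {poly F} :=
  if insub j is Some j' then rVpoly (row (lshift J j') w) else 0.
Let ss (w : 'M[F]_(J + J, D)) (j : nat) : {poly F} :=
  if insub j is Some j' then rVpoly (row (rshift J j') w) else 0.

(** At a point [x] of the prime field with [f.[x] ^+ g = a], where also
    [x ^+ p = x], the [i]-th derivative of the auxiliary polynomial takes the same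
    value as this polynomial of much smaller degree. *)
Let aux_value (w : 'M[F]_(J + J, D)) (i : nat) : {poly F} :=
  \sum_(j < J) (iter i diff_plain (rr w j) + a *: iter i diff_twisted (ss w j)) * 'X^j.

Let size_rr w j : (size (rr w j) <= D)%N.
Proof. by rewrite /rr; case: insub => [j'|]; rewrite ?size_poly// size_poly0. Qed.

Let size_ss w j : (size (ss w j) <= D)%N.
Proof. by rewrite /ss; case: insub => [j'|]; rewrite ?size_poly// size_poly0. Qed.

Let rrB u v j : rr (u - v) j = rr u j - rr v j.
Proof. by rewrite /rr; case: insub => [j'|]; rewrite ?subr0// raddfB/= raddfB. Qed.

Let ssB u v j : ss (u - v) j = ss u j - ss v j.
Proof. by rewrite /ss; case: insub => [j'|]; rewrite ?subr0// raddfB/= raddfB. Qed.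

Let aux_valueB u v i : aux_value (u - v) i = aux_value u i - aux_value v i.
Proof.
rewrite /aux_value -sumrB; apply: eq_bigr => j _.
by rewrite -mulrBl rrB ssB iter_diff_plainB iter_diff_twistedB scalerBr opprD addrACA.
Qed.

Let size_aux_value w i : (i < l)%N -> (size (aux_value w i) <= E)%N.
Proof.
move=> il; apply: leq_trans (size_sum _ _ _) _; apply/bigmax_leqP => j _.
apply: leq_trans (size_polyMleq _ _) _; rewrite size_polyXn addnS/=.
rewrite leq_add ?(ltnW (ltn_ord j))//.
have iD : (D + i * m <= D + l * m)%N by rewrite leq_add2l leq_mul2r (ltnW il) orbT.
apply: leq_trans (size_polyD _ _) _; rewrite geq_max; apply/andP; split.
  by apply: leq_trans iD; apply: (size_iter_diff size_diff_plain).
apply: leq_trans (size_scale_leq _ _) _.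
by apply: leq_trans iD; apply: (size_iter_diff size_diff_twisted).
Qed.

Let exists_auxiliary : exists2 w : 'M[F]_(J + J, D),
  w != 0 & forall i, (i < l)%N -> aux_value w i = 0.
Proof.
pose phi (w : 'M[F]_(J + J, D)) : 'M[F]_(l, E) := \matrix_(i < l) poly_rV (aux_value w i).
have : ~~ injectiveb phi.
  apply/negP => /injectiveP/leq_card; rewrite !card_mx leq_exp2l ?cardF.
    rewrite leqNgt => /negP; apply; rewrite /E -addnA.
    have : (L * (l * m + J) < D)%N by rewrite /D ltn_subRL.
    move: (l * m + J)%N D => K D'; rewrite /l /J.
    by rewrite mulnDr -!(mulnA 2) mulnDl !mulSn; lia.
  by rewrite (prime_gt1 (pcharf_prime pcharF)).
move=> /injectivePn[u [v uv phiuv]]; exists (u - v); first by rewrite subr_eq0.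
move=> i il; rewrite aux_valueB; apply/eqP; rewrite subr_eq0; apply/eqP.
have /(congr1 rVpoly) : row (Ordinal il) (phi u) = row (Ordinal il) (phi v).
  by rewrite phiuv.
by rewrite !rowK !poly_rV_K ?size_aux_value.
Qed.

(** The auxiliary polynomial vanishes to order [2 * L] at each point counted, and
    its degree is at most about [p * L + m * g].  As [p] is about [2 * g], at most
    half of the field, up to a fraction of order [m / L], is counted. *)
Lemma stepanov : (2 * L * #|[set x : F | f.[x] ^+ g == a]| <= m.+1 * g + p * L)%N.
Proof.
have [w w0 wP] := exists_auxiliary.
pose P := \sum_(j < J) (rr w j + ss w j * f ^+ g) * 'X^(p * j).
have P0 : P != 0.
  apply: contra_neq w0 => P0.
  have rs0 := stepanov_nonvanishing pcharF cardF pg fE f1al f0 (size_rr w) (size_ss w) _ P0.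
  apply/row_matrixP => i; rewrite row0; apply: (can_inj (@rVpolyK _ _)).
  rewrite raddf0 -(splitK i); case: (fintype.split i) => j /=.
    have [|+ _] := rs0 _ j (ltn_ord j); first by rewrite size_f /D; move: L_small; lia.
    by rewrite /rr valK.
  have [|_ +] := rs0 _ j (ltn_ord j); first by rewrite size_f /D; move: L_small; lia.
  by rewrite /ss valK.
set S := [set x | _].
have dvP : \prod_(x <- enum S) ('X - x%:P) ^+ l %| P.
  apply: dvdp_prod_XsubC_exp (enum_uniq _) _ => x; rewrite mem_enum inE => /eqP fxa.
  apply: (dvdp_iter_fderiv pcharF P0 (f := f)) => //.
    rewrite /root; apply: contra_neq a0 => fx0; rewrite -fxa fx0 expr0n.
    by move: L_small; case: (g).
  move=> i il; rewrite iter_fderiv_twisted /root horner_sum.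
  have := congr1 (fun q => q.[x]) (wP i il); rewrite horner0 /aux_value horner_sum => {2}<-.
  apply/eqP/eq_bigr => j _; rewrite !hornerE fxa.
  by rewrite exprM -cardF expf_card [a * _]mulrC.
have sizeP : (size P <= D + m * g + p * L)%N.
  apply: leq_trans (size_sum _ _ _) _; apply/bigmax_leqP => j _.
  apply: leq_trans (size_polyMleq _ _) _; rewrite size_polyXn addnS/=.
  apply: leq_add; last by rewrite leq_mul2l -(ltnS j) ltn_ord orbT.
  apply: leq_trans (size_polyD _ _) _; rewrite geq_max.
  rewrite (leq_trans (size_rr w j)) ?leq_addr//=.
  apply: leq_trans (size_polyMleq _ _) _.
  have szm a' b : (a' <= D)%N -> (b <= (m * g).+1)%N -> ((a' + b).-1 <= D + m * g)%N.
    by lia.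
  by apply: szm => //; apply: leq_trans (size_poly_exp_leq _ _) _; rewrite size_f.
have : (size (\prod_(x <- enum S) ('X - x%:P) ^+ l)).-1 = (l * #|S|)%N.
  by rewrite prodrXl size_exp size_prod_XsubC/= -cardE mulnC.
have := dvdp_leq P0 dvP; rewrite /D in sizeP; move: (size _) => sz szP.
move: (#|S|) => cS szE.
have : (l * cS <= size P)%N by rewrite -szE (leq_trans (leq_pred _)).
rewrite /l => h; apply: leq_trans h _; apply: leq_trans sizeP _.
by rewrite leq_add2r mulSn leq_add2r leq_subr.
Qed.
End Stepanov.

(** * The quadratic character modulo a prime *)

Lemma odd_prime_half (p : nat) : prime p -> (2 < p)%N -> p = (2 * p./2).+1.
Proof.
move=> pp p2; have [pE|podd] := even_prime pp; first by rewrite pE in p2.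
by rewrite mul2n -{1}(odd_double_half p) podd.
Qed.

Section QuadraticCharacter.
Variables (p g : nat).
Hypotheses (p_pr : prime p) (pg : p = (2 * g).+1).

Definition quadchar (a : 'F_p) : int := legendre p a.

Lemma half_gt0 : (0 < g)%N.
Proof. by move: (prime_gt1 p_pr); rewrite pg; case: g. Qed.

Lemma legendre_quadchar n : legendre p n = quadchar n%:R.
Proof.
by rewrite /quadchar /legendre val_Fp_nat// /dvdn modn_mod.
Qed.

Lemma ltn_Fp (a : 'F_p) : (a < p)%N.
Proof. by rewrite -[X in (_ < X)%N](Fp_cast p_pr) ltn_ord. Qed.

Lemma dvdn_Fp (a : 'F_p) : (p %| a)%N = (a == 0).
Proof. by rewrite -val_eqE/= /dvdn modn_small// ltn_Fp. Qed.

Lemma is_square_Fp (a : 'F_p) :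
  [exists x : 'I_p, (x ^ 2 == a %[mod p])%N] = [exists x : 'F_p, x ^+ 2 == a].
Proof.
have aE : (a : nat) = (a %% p)%N by rewrite modn_small// ltn_Fp.
apply/existsP/existsP => -[x xa].
  exists x%:R; apply/eqP/val_inj; rewrite -natrX [LHS]val_Fp_nat// [RHS]aE.
  exact/eqP.
exists (Ordinal (ltn_Fp x)) => /=; rewrite -(eqP xa) -[in X in _ == X](natr_Zp x).
by rewrite -natrX val_Fp_nat// modn_mod.
Qed.

Lemma expf_pred (x : 'F_p) : x != 0 -> x ^+ (2 * g) = 1.
Proof.
move=> x0; apply: (mulIf x0); rewrite -exprSr -pg mul1r.
by rewrite -[X in _ ^+ X](card_Fp p_pr) expf_card.
Qed.

Lemma size_units_Fp : size [seq x <- enum 'F_p | x != 0] = (2 * g)%N.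
Proof.
have := count_predC (pred1 (0 : 'F_p)) (enum 'F_p).
rewrite (count_uniq_mem _ (enum_uniq _)) mem_enum inE -cardE card_Fp//.
rewrite add1n size_filter => h; apply: succn_inj; rewrite -pg; apply: etrans h.
by congr _.+1; apply: eq_count => x.
Qed.

Lemma euler_criterion (a : 'F_p) : a != 0 ->
  a ^+ g = if [exists x : 'F_p, x ^+ 2 == a] then 1 else -1.
Proof.
move=> a0; case: existsP => [[x /eqP xa]|nsq].
  rewrite -xa -exprM expf_pred//; apply: contra_neq a0 => x0.
  by rewrite -xa x0 expr0n.
have : (a ^+ g) ^+ 2 == 1 by rewrite -exprM mulnC expf_pred.
rewrite sqrf_eq1 => /orP[/eqP ag|/eqP//]; exfalso; apply: nsq.
have g2 : (0 < 2 * g)%N by rewrite muln_gt0 half_gt0.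
have : has (2 * g).-primitive_root [seq x <- enum 'F_p | x != 0].
  apply: has_prim_root => //.
  - apply/allP => x; rewrite mem_filter => /andP[x0 _].
    by rewrite unity_rootE expf_pred.
  - by rewrite filter_uniq// enum_uniq.
  by rewrite size_units_Fp.
case/hasP => z _ zprim.
have [i ai] := prim_rootP zprim (expf_pred a0).
exists (z ^+ i./2); rewrite -exprM ai; apply/eqP; congr (_ ^+ _).
have : (2 * g %| i * g)%N by rewrite (prim_order_dvd zprim) exprM -ai ag.
by rewrite dvdn_pmul2r ?half_gt0// dvdn2 => iE; rewrite muln2 even_halfK.
Qed.

Lemma quadcharE (a : 'F_p) : (quadchar a)%:~R = a ^+ g :> 'F_p.
Proof.
rewrite /quadchar /legendre is_square_Fp.
rewrite dvdn_Fp.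
have [->|a0] := eqVneq a 0; first by rewrite expr0n gtn_eqF ?half_gt0.
by rewrite euler_criterion//; case: ifP.
Qed.

Lemma quadchar_val (a : 'F_p) : a != 0 -> (quadchar a == 1) || (quadchar a == -1).
Proof.
move=> a0; rewrite /quadchar /legendre.
by rewrite dvdn_Fp (negbTE a0); case: ifP; rewrite eqxx ?orbT.
Qed.

Lemma quadchar0 : quadchar 0 = 0.
Proof. by rewrite /quadchar /legendre dvdn0. Qed.

Lemma two_Fp_neq0 : (2 : 'F_p) != 0.
Proof.
rewrite -(dvdn_pcharf (pchar_Fp p_pr)) gtnNdvd//.
by move: half_gt0; rewrite pg; lia.
Qed.

Lemma quadchar_sign (a : 'F_p) (e : int) : a != 0 -> (e == 1) || (e == -1) ->
  (quadchar a == e) = (a ^+ g == e%:~R).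
Proof.
have n11 : (-1 == 1 :> 'F_p) = false.
  by apply: contraNF two_Fp_neq0 => /eqP h; rewrite mulr2n -{1}h addNr.
move=> a0 eP; rewrite -quadcharE.
case/orP: (quadchar_val a0) => /eqP->; case/orP: eP => /eqP->.
- by rewrite !eqxx.
- by rewrite mulrN1z mulr1z [RHS]eq_sym n11.
- by rewrite mulrN1z mulr1z n11.
- by rewrite !eqxx.
Qed.

Lemma quadcharM : {morph quadchar : a b / a * b}.
Proof.
move=> a b; have [->|a0] := eqVneq a 0; first by rewrite mul0r quadchar0 mul0r.
have [->|b0] := eqVneq b 0; first by rewrite mulr0 quadchar0 mulr0.
apply/eqP; rewrite quadchar_sign ?mulf_neq0//; last first.
  case/orP: (quadchar_val a0) => /eqP->; case/orP: (quadchar_val b0) => /eqP-> //.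
by rewrite rmorphM/= !quadcharE exprMn.
Qed.

Lemma quadchar1 : quadchar 1 = 1.
Proof. by apply/eqP; rewrite quadchar_sign ?oner_neq0// expr1n. Qed.

Lemma quadchar_sqr (a : 'F_p) : a != 0 -> quadchar a ^+ 2 = 1.
Proof. by move=> /quadchar_val/orP[]/eqP->. Qed.

Lemma quadchar_neq0 (a : 'F_p) : a != 0 -> quadchar a != 0.
Proof. by move=> /quadchar_val/orP[]/eqP->. Qed.

Lemma norm_quadchar (a : 'F_p) : `|quadchar a| <= 1.
Proof.
have [->|/quadchar_val/orP[]/eqP->//] := eqVneq a 0.
by rewrite quadchar0.
Qed.

Lemma quadchar_prod (I : Type) (r : seq I) (P : pred I) (F : I -> 'F_p) :
  quadchar (\prod_(i <- r | P i) F i) = \prod_(i <- r | P i) quadchar (F i).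
Proof. exact: (big_morph _ quadcharM quadchar1). Qed.

Lemma quadchar_nonresidue : exists a : 'F_p, quadchar a = -1.
Proof.
case: (boolP [exists a : 'F_p, quadchar a == -1]) => [/existsP[a /eqP aE]|].
  by exists a.
rewrite negb_exists => /forallP H; exfalso.
have : all (root ('X^g - 1 : {poly 'F_p})) [seq x <- enum 'F_p | x != 0].
  apply/allP => x; rewrite mem_filter => /andP[x0 _].
  rewrite /root !hornerE subr_eq0 -(quadchar_sign (e := 1))//.
  by case/orP: (quadchar_val x0) => // h; have := H x; rewrite h.
move=> h; have := max_poly_roots _ h _.
rewrite size_XnsubC ?half_gt0// -size_poly_eq0 size_XnsubC ?half_gt0//.
rewrite filter_uniq ?enum_uniq// => /(_ isT isT).
by rewrite size_units_Fp; move: half_gt0; lia.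
Qed.

Lemma sum_quadchar : \sum_(a : 'F_p) quadchar a = 0.
Proof.
have [b bE] := quadchar_nonresidue.
have b0 : b != 0 by apply: contra_eq_neq bE => ->; rewrite quadchar0.
have : \sum_(a : 'F_p) quadchar a = - \sum_(a : 'F_p) quadchar a.
  rewrite {1}(reindex_onto (fun a => b * a) (fun a => b^-1 * a)) /=; last first.
    by move=> a _; rewrite mulVKf.
  rewrite -sumrN; apply: eq_big => [a|a _]; first by rewrite mulKf// eqxx.
  by rewrite quadcharM bE mulN1r.
by lia.
Qed.

(** For distinct shifts the sum depends only on the difference [d], and by scaling
    not even on [d]; summing over all [d] determines the common value. *)
Lemma quadchar_correlation (b c : 'F_p) :
  \sum_(k : 'F_p) quadchar (k + b) * quadchar (k + c) = if b == c then p%:Z - 1 else -1.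
Proof.
pose S (d : 'F_p) := \sum_(k : 'F_p) quadchar k * quadchar (k + d).
have -> : \sum_(k : 'F_p) quadchar (k + b) * quadchar (k + c) = S (c - b).
  rewrite (reindex_onto (fun k => k - b) (fun k => k + b)) /=; last first.
    by move=> k _; rewrite addrK.
  by apply: eq_big => [a|a _]; rewrite ?subrK ?eqxx// addrAC -addrA.
have S0 : S 0 = p%:Z - 1.
  have card1 : \sum_(k : 'F_p) (1 : int) = p by rewrite sumr_const card_Fp// natz.
  rewrite /S (bigD1 0)//= quadchar0 mul0r add0r -card1 [in RHS](bigD1 0)//= [RHS]addrAC subrr add0r.
  by apply: eq_bigr => k k0; rewrite addr0 -expr2 quadchar_sqr.
have Sd d : d != 0 -> S d = S 1.
  move=> d0; rewrite /S (reindex_onto (fun k => d * k) (fun k => d^-1 * k)) /=; last first.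
    by move=> k _; rewrite mulVKf.
  apply: eq_big => [k|k _]; first by rewrite mulKf// eqxx.
  rewrite -[X in _ + X](mulr1 d) -mulrDr !quadcharM mulrACA -expr2 quadchar_sqr//.
  by rewrite mul1r.
have S1 : (p%:Z - 1) * (1 + S 1) = 0.
  have : \sum_(d : 'F_p) S d = 0.
    rewrite /S exchange_big/= big1// => k _; rewrite -mulr_sumr.
    rewrite (reindex_onto (fun d => d - k) (fun d => d + k)) /=; last first.
      by move=> d _; rewrite addrK.
    under eq_bigr do rewrite addrC subrK.
    under eq_bigl do rewrite subrK eqxx.
    by rewrite sum_quadchar mulr0.
  rewrite (bigD1 0)//= S0 (eq_bigr (fun=> S 1)) => [|d d0]; last by rewrite Sd.
  have card1 : \sum_(k : 'F_p) (1 : int) = p by rewrite sumr_const card_Fp// natz.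
  have card2 : \sum_(k : 'F_p | k != 0) (1 : int) = p%:Z - 1.
    by rewrite -card1 [in RHS](bigD1 0)//= [RHS]addrAC subrr add0r.
  rewrite (eq_bigr (fun=> 1 * S 1)) => [|d d0]; last by rewrite mul1r.
  by rewrite -mulr_suml card2 mulrDr mulr1.
rewrite [b == c]eq_sym -subr_eq0; case: eqVneq => [->//|d0]; rewrite Sd//.
have p1 : p%:Z - 1 != 0 by move: half_gt0; rewrite pg; lia.
by move/eqP: S1; rewrite mulf_eq0 (negbTE p1)/= addrC addr_eq0 => /eqP.
Qed.
End QuadraticCharacter.

(** * Equidistribution of patterns of the quadratic character *)

(** The shifts start from [1] since [stepanov] needs polynomials that do not vanish
    at [0]; a translation of the variable yields any other starting point. *)
Definition shift_Fp (p i : nat) : 'F_p := 1 + i%:R.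

Section Patterns.
Variables (p g N L : nat).
Hypotheses (p_pr : prime p) (pg : p = (2 * g).+1) (L0 : (0 < L)%N).
Hypotheses (Lg : (N + L * (2 * L * N + L.+1) < g)%N).

Let Np : (N < p)%N. Proof. by rewrite pg; move: Lg; lia. Qed.
Let Lp : (2 * L <= p)%N. Proof. by rewrite pg; move: Lg L0; nia. Qed.

Local Notation sh i := (shift_Fp p i).

Let sh_neq0 (i : 'I_N) : sh i != 0.
Proof.
rewrite /shift_Fp addrC natr1 -(dvdn_pcharf (pchar_Fp p_pr)) gtnNdvd//.
exact: leq_ltn_trans (ltn_ord i) Np.
Qed.

Let sh_inj : injective (fun i : 'I_N => sh i).
Proof.
move=> i j /addrI/(congr1 val)/=; rewrite !val_Fp_nat// !modn_small => [||].
- exact: val_inj.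
- exact: ltn_trans (ltn_ord _) Np.
- exact: ltn_trans (ltn_ord _) Np.
Qed.

(** Applying [stepanov] to [a = 1] and to [a = -1] bounds from above the numbers of
    values [1] and [-1] of the character.  These numbers add up to nearly [p], hence
    both are close to [p / 2] and their difference is small. *)
Lemma quadchar_sum_small (A : {set 'I_N}) : A != finset.set0 ->
  L%:Z * `|\sum_(k : 'F_p) \prod_(i in A) quadchar (k + sh i)| <=
    (N.+1 * g + N * L)%N%:Z.
Proof.
move=> A0; have [i0 i0A] := finset.set0Pn _ A0.
pose f : {poly 'F_p} := \prod_(i in A) ('X - (- sh i)%:P).
pose f1 : {poly 'F_p} := \prod_(i in A | i != i0) ('X - (- sh i)%:P).
have fE : f = ('X - (- sh i0)%:P) * f1 by rewrite /f (bigD1 i0).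
have f1r : ~~ root f1 (- sh i0).
  rewrite /root horner_prod; apply/prodf_neq0 => i /andP[_ ii0].
  rewrite !hornerE addrC subr_eq0; apply: contra_neq ii0; by rewrite opprK; exact: sh_inj.
have fx k : f.[k] = \prod_(i in A) (k + sh i).
  by rewrite horner_prod; apply: eq_bigr => i _; rewrite hornerXsubC opprK.
have f0 : f.[0] != 0.
  by rewrite fx; apply/prodf_neq0 => i _; rewrite add0r sh_neq0.
have size_f : size f = #|A|.+1 by rewrite /f -big_enum size_prod_XsubC -cardE.
have AN : (#|A| <= N)%N by rewrite -[X in (_ <= X)%N]card_ord max_card.
have Lsm : (#|A| + L * (2 * L * #|A| + L.+1) < g)%N.
  apply: leq_ltn_trans Lg; rewrite leq_add// leq_mul// leq_add// leq_mul//.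
have S a a0 := @stepanov _ p g (pchar_Fp p_pr) (card_Fp p_pr) pg f f1 _ #|A| fE f1r f0 size_f L a a0 Lsm Lp.
pose c (a : int) := #|[set k : 'F_p | quadchar f.[k] == a]|.
have cE a : (a == 1) || (a == -1) -> c a = #|[set k : 'F_p | f.[k] ^+ g == a%:~R]|.
  move=> aP; apply: eq_card => k; rewrite !inE.
  have [fk0|fk0] := eqVneq f.[k] 0; last by rewrite (quadchar_sign p_pr pg).
  rewrite fk0 quadchar0 expr0n gtn_eqF ?(half_gt0 p_pr pg)//.
  case/orP: aP => /eqP->; first by rewrite mulr1z [RHS]eq_sym oner_eq0.
  by rewrite mulrN1z [RHS]eq_sym oppr_eq0 oner_eq0.
have c1 : (2 * L * c 1%R <= N.+1 * g + p * L)%N.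
  rewrite cE//; apply: leq_trans (S _ (oner_neq0 _)) _.
  by rewrite leq_add2r leq_mul2r ltnS AN orbT.
have c2 : (2 * L * c (-1)%R <= N.+1 * g + p * L)%N.
  rewrite cE//; apply: leq_trans (S _ _) _; first by rewrite mulrN1z oppr_eq0 oner_neq0.
  by rewrite leq_add2r leq_mul2r ltnS AN orbT.
have c0 : (c 0%R <= N)%N.
  have fN0 : f != 0 by rewrite -size_poly_eq0 size_f.
  have := @max_poly_roots _ f (enum [set k : 'F_p | quadchar f.[k] == 0]) fN0.
  rewrite enum_uniq size_f -cardE ltnS => h; apply: leq_trans AN; apply: h => //.
  apply/allP => k; rewrite mem_enum inE => h; apply: contraTT h => h.
  exact: (quadchar_neq0 p_pr).
have cT : \sum_(k : 'F_p) (1 : int) = (c 1)%:Z + (c (-1))%:Z + (c 0)%:Z /\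
    \sum_(k : 'F_p) quadchar f.[k] = (c 1)%:Z - (c (-1))%:Z.
  have cs a : (c a)%:Z = \sum_(k : 'F_p) (quadchar f.[k] == a)%:Z.
    by rewrite /c -sum1dep_card big_mkcond/= -natz natr_sum; apply: eq_bigr => k _; case: ifP.
  rewrite !cs -sumrB -!big_split/=; split; apply: eq_bigr => k _.
    have [->|/(quadchar_val p_pr)/orP[]/eqP->//] := eqVneq f.[k] 0; by rewrite quadchar0.
  have [->|/(quadchar_val p_pr)/orP[]/eqP->//] := eqVneq f.[k] 0; by rewrite quadchar0.
have -> : \sum_(k : 'F_p) \prod_(i in A) quadchar (k + sh i) = (c 1)%:Z - (c (-1))%:Z.
  by rewrite -cT.2; apply: eq_bigr => k _; rewrite fx (quadchar_prod p_pr pg).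
have : (p : int) = (c 1)%:Z + (c (-1))%:Z + (c 0)%:Z by rewrite -cT.1 sumr_const card_Fp// natz.
move: c0 c1 c2; clear; move: (c 1) (c (-1)) (c 0) => x y z zN xN yN pE.
have E1 : L%:Z * x%:Z + L%:Z * y%:Z + L%:Z * z%:Z = p%:Z * L%:Z by rewrite pE; ring.
have E2 : (L * z <= N * L)%N by rewrite mulnC leq_mul.
rewrite -[X in X * _]ger0_norm// -normrM mulrBr ler_norml.
have : (2 * L * x = 2 * (L * x))%N by rewrite mulnA.
have : (2 * L * y = 2 * (L * y))%N by rewrite mulnA.
lia.
Qed.

(** The product of the factors [1 + (-1) ^+ x i * quadchar (k + sh i)] is
    nonnegative, and equal to [2 ^ N] when [k] has the pattern [x].  Its expansion
    over subsets [A] has the main term [p], from the empty set, and the character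
    sums of [quadchar_sum_small]. *)
Lemma pattern_count_le (x : 'I_N -> bool) :
  (L * (2 ^ N * #|[set k : 'F_p | [forall i : 'I_N, (quadchar (k + sh i) == (-1) ^+ x i)%R]]|)
    <= L * p + 2 ^ N * (N.+1 * g + N * L))%N.
Proof.
set S := [set k | _].
have -> : (L * (2 ^ N * #|S|) = L * \sum_(k : 'F_p) (k \in S) * 2 ^ N)%N.
  by rewrite -big_distrl/= mulnC [in RHS]mulnC; congr (_ * _)%N; rewrite mulnC -sum1_card big_mkcond.
rewrite -lez_nat !PoszM PoszD !PoszM.
apply: (@le_trans _ _ (L%:Z * \sum_(k : 'F_p) \prod_(i < N) (1 + (-1) ^+ x i * quadchar (k + sh i)))).
  apply: ler_wpM2l => //; rewrite -natz natr_sum; apply: ler_sum => k _.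
  case: (boolP (k \in S)) => [|kS].
    rewrite inE => /forallP h; rewrite mul1n (eq_bigr (fun=> 2)) => [|i _].
      by rewrite prodr_const card_ord natz -natz natrX.
    by rewrite (eqP (h i)) -expr2 sqrr_sign.
  rewrite mul0n; apply: prodr_ge0 => i _.
  by have := norm_quadchar p_pr (k + sh i); case: (x i); rewrite ?expr0 ?expr1; lia.
have E : \sum_(k : 'F_p) \prod_(i < N) (1 + (-1) ^+ x i * quadchar (k + sh i)) =
    \sum_(A : {set 'I_N}) (\prod_(i in A) (-1) ^+ x i) *
        \sum_(k : 'F_p) \prod_(i in A) quadchar (k + sh i).
  under eq_bigr => k _.
    under eq_bigr do rewrite addrC.
    rewrite bigA_distr; over.
  rewrite exchange_big/=; apply: eq_bigr => A _; rewrite mulr_sumr.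
  apply: eq_bigr => k _; rewrite -big_split/= [in RHS]big_mkcond/=.
  by apply: eq_bigr.
rewrite E (bigD1 finset.set0)//= !finset.big_set0 mul1r.
under [X in _ * (X + _)]eq_bigr do rewrite finset.big_set0.
rewrite sumr_const card_Fp// natz mulrDr lerD// mulr_sumr.
apply: le_trans (ler_norm _) _; apply: le_trans (ler_norm_sum _ _ _) _.
apply: (@le_trans _ _ (\sum_(A : {set 'I_N} | A != finset.set0) (N.+1 * g + N * L)%N%:Z)).
  apply: ler_sum => A A0; rewrite !normrM normr_prod.
  rewrite [X in _ * (X * _)]big1 => [|i _]; last by rewrite normrX normrN1 expr1n.
  by rewrite mul1r ger0_norm// quadchar_sum_small.
apply: le_trans (_ : \sum_(A : {set 'I_N}) (N.+1 * g + N * L)%N%:Z <= _).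
  rewrite [leRHS](bigD1 finset.set0)//= lerDr//.
have cS : #|{: {set 'I_N}}| = (2 ^ N)%N.
  by rewrite -finset.cardsT -finset.powersetT finset.card_powerset finset.cardsT card_ord.
rewrite sumr_const cS.
by rewrite -mulr_natl natz PoszD !PoszM.
Qed.

End Patterns.

(** By [pattern_count_le] the frequency of a pattern exceeds [2 ^- N] by at most
    [(N + 1) * g / (L * p) + N / p]: first [L] is chosen large, then [p]. *)
Lemma pattern_equidistribution (R : archiRealFieldType) (N : nat) (eps : R) : 0 < eps ->
  exists p0, forall p, prime p -> (p0 <= p)%N -> forall (c : 'F_p) (x : 'I_N -> bool),
    #|[set k : 'F_p | [forall i : 'I_N, quadchar (k + c + (i : nat)%:R) == (-1) ^+ x i]]|%:R
      <= (2 ^- N + eps) * p%:R.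
Proof.
move=> e0; pose L := (Num.bound ((N.+1)%:R * 2 / eps)).+1.
pose M := Num.bound (N%:R * 2 / eps).
exists (M + (2 * (N + L * (2 * L * N + L.+1)) + 4))%N => p p_pr pL c x.
have pg := odd_prime_half p_pr (_ : 2 < p)%N; set g := p./2 in pg.
have {}pg : p = (2 * g).+1 by apply: pg; move: pL; lia.
have Lg : (N + L * (2 * L * N + L.+1) < g)%N.
  by move: pL; rewrite pg; move: (N + _)%N => K; lia.
have := pattern_count_le p_pr pg (isT : 0 < L)%N Lg x.
set S1 := #|_|; have -> : #|[set k : 'F_p | [forall i : 'I_N,
    quadchar (k + c + (i : nat)%:R) == (-1) ^+ x i]]| = S1.
  rewrite -(finset.card_imset _ (addIr (c - 1))) /S1; apply: eq_card => k; rewrite !inE.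
  apply/finset.imsetP/idP => [[k' + ->]|/forallP h]; rewrite ?inE.
    move=> /forallP h; apply/forallP => i; rewrite (_ : _ + _ = k' + c + i%:R) ?h//.
    by rewrite /shift_Fp; ring.
  exists (k - (c - 1)); rewrite ?subrK// inE; apply/forallP => i.
  rewrite (_ : _ + _ = k + shift_Fp p i) ?h//.
  by rewrite /shift_Fp; ring.
rewrite -(ler_nat R) !natrM natrD !natrM natrX natrD !natrM.
have L0 : (0 : R) < L%:R by rewrite ltr0n.
have P0 : (0 : R) < 2 ^+ N by rewrite exprn_gt0.
move=> h.
have h1 : (N.+1)%:R <= eps / 2 * L%:R.
  have /archi_boundP : 0 <= (N.+1)%:R * 2 / eps by apply: divr_ge0; [exact: mulr_ge0 | exact: ltW].
  rewrite ltr_pdivrMr// => h1.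
  have : (Num.bound ((N.+1)%:R * 2 / eps))%:R * eps <= L%:R * eps.
    by rewrite ler_pM2r// ler_nat.
  by lra.
have h2 : N%:R <= eps / 2 * p%:R.
  have /archi_boundP : 0 <= N%:R * 2 / eps by apply: divr_ge0; [exact: mulr_ge0 | exact: ltW].
  rewrite ltr_pdivrMr// => h2.
  have : M%:R * eps <= p%:R * eps.
    by rewrite ler_pM2r// ler_nat; move: pL; lia.
  by rewrite /M; lra.
rewrite -(ler_pM2l P0) -(ler_pM2l L0); apply: le_trans h _.
have -> : L%:R * (2 ^+ N * ((2 ^- N + eps) * p%:R)) =
    L%:R * p%:R + 2 ^+ N * (L%:R * (eps * p%:R)) :> R by field; lra.
rewrite lerD2l ler_pM2l//.
have gp : (g%:R : R) <= p%:R by rewrite ler_nat pg; lia.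
have -> : L%:R * (eps * p%:R) = (eps / 2 * L%:R) * p%:R + (eps / 2 * p%:R) * L%:R :> R by field.
by apply: lerD; [apply: ler_pM | rewrite ler_pM2r].
Qed.

(** * Quasi-orthogonality and Gauss sums *)

(** The Gram matrix of the translates is [p] times the identity minus the all-one
    matrix, and the latter is positive semidefinite. *)
Lemma quadchar_quasi_orthogonal (R : realDomainType) (p : nat) (p_pr : prime p)
    (p2 : (2 < p)%N) (I : finType) (m : I -> 'F_p) (b : I -> R) : injective m ->
  \sum_(k : 'F_p) (\sum_i b i * (quadchar (k + m i))%:~R) ^+ 2 <=
    p%:R * \sum_i b i ^+ 2.
Proof.
move=> m_inj; have pg := odd_prime_half p_pr p2.
have -> : \sum_(k : 'F_p) (\sum_i b i * (quadchar (k + m i))%:~R) ^+ 2 =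
    \sum_i \sum_j b i * b j * (if i == j then p%:R - 1 else -1).
  under eq_bigr do rewrite expr2 big_distrl/=.
  rewrite exchange_big/=; apply: eq_bigr => i _.
  under eq_bigr do rewrite big_distrr/=.
  rewrite exchange_big/=; apply: eq_bigr => j _.
  under eq_bigr do rewrite mulrACA -rmorphM/=.
  rewrite -mulr_sumr -rmorph_sum/= (quadchar_correlation p_pr pg) (inj_eq m_inj).
  by case: ifP => _; rewrite ?rmorphB ?rmorph1 ?rmorphN.
have -> : \sum_i \sum_j b i * b j * (if i == j then p%:R - 1 else -1) =
    p%:R * (\sum_i b i ^+ 2) - (\sum_i b i) ^+ 2.
  rewrite expr2 big_distrl mulr_sumr -sumrB/=; apply: eq_bigr => i _.
  rewrite (bigD1 i)//= eqxx (eq_bigr (fun j => - (b i * b j))) => [|j ji]; last first.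
    by rewrite eq_sym (negbTE ji) mulrN1.
  rewrite sumrN -mulr_sumr [in RHS](bigD1 i)//=; ring.
by rewrite lerBlDr lerDl sqr_ge0.
Qed.

Section GaussSum.
Variables (K : numFieldType) (p : nat) (w : K).
Hypotheses (p_pr : prime p) (p2 : (2 < p)%N) (w_prim : p.-primitive_root w).
Let pg := odd_prime_half p_pr p2.

Definition addchar (a : 'F_p) : K := w ^+ a.

Lemma addchar_nat n : addchar n%:R = w ^+ n.
Proof. by rewrite /addchar val_Fp_nat// (prim_expr_mod w_prim). Qed.

Lemma addcharD a b : addchar (a + b) = addchar a * addchar b.
Proof.
by rewrite -[a in LHS]natr_Zp -[b in LHS]natr_Zp -natrD addchar_nat exprD.
Qed.

Lemma addchar0 : addchar 0 = 1. Proof. by rewrite /addchar expr0. Qed.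

Lemma addchar_natM a n : addchar (a * n%:R) = addchar a ^+ n.
Proof. by rewrite -[a in LHS]natr_Zp -natrM addchar_nat exprM. Qed.

Lemma addchar_eq1 a : (addchar a == 1) = (a == 0).
Proof. by rewrite /addchar -(prim_order_dvd w_prim) dvdn_Fp. Qed.

Lemma sum_addchar c : \sum_(a : 'F_p) addchar (a * c) = if c == 0 then p%:R else 0.
Proof.
case: eqVneq => [->|c0].
  by under eq_bigr do rewrite mulr0 addchar0; rewrite sumr_const card_Fp.
set S := LHS; have : S = addchar c * S.
  rewrite {1}/S (reindex_onto (fun a => 1 + a) (fun a => a - 1))/=; last first.
    by move=> a _; rewrite addrC subrK.
  rewrite /S mulr_sumr; apply: eq_big => [a|a _]; first by rewrite addrC addKr eqxx.
  by rewrite mulrDl mul1r addcharD.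
move/eqP; rewrite -subr_eq0 -{1}(mul1r S) -mulrBl mulf_eq0 subr_eq0 eq_sym.
by rewrite addchar_eq1 (negbTE c0) => /eqP.
Qed.

Lemma sum_nat_Fp (V : nmodType) (f : nat -> V) : \sum_(i < p) f i = \sum_(a : 'F_p) f a.
Proof.
rewrite -(big_mkord xpredT f) -[in X in X = _](Fp_cast p_pr) big_mkord.
by [].
Qed.

Definition gauss_sum (b : 'F_p) : K := \sum_(a : 'F_p) (quadchar a)%:~R * addchar (b * a).

Lemma gauss_sumM b : gauss_sum b = (quadchar b)%:~R * gauss_sum 1.
Proof.
have [->|b0] := eqVneq b 0.
  rewrite /gauss_sum quadchar0 mul0r.
  under eq_bigr do rewrite mul0r addchar0 mulr1.
  by rewrite -rmorph_sum/= (sum_quadchar p_pr pg).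
rewrite /gauss_sum mulr_sumr (reindex_onto (fun a => b^-1 * a) (fun a => b * a))/=; last first.
  by move=> a _; rewrite mulKf.
apply: eq_big => [a|a _]; first by rewrite mulVKf// eqxx.
rewrite mulVKf// mul1r mulrA -rmorphM/= -[X in X%:~R * _]mul1r; congr (_%:~R * _).
rewrite mul1r (quadcharM p_pr pg); congr (_ * _).
have : quadchar b^-1 * quadchar b = 1 by rewrite -(quadcharM p_pr pg) mulVf// (quadchar1 p_pr pg).
by case/orP: (quadchar_val p_pr b0) => /eqP->; lia.
Qed.

(** Fourier inversion on the additive group of ['F_p]. *)
Lemma gauss_inversion l : \sum_(b : 'F_p) gauss_sum b * addchar (- (b * l)) =
  p%:R * (quadchar l)%:~R.
Proof.
under eq_bigr do rewrite /gauss_sum big_distrl/=.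
rewrite exchange_big/= (bigD1 l)//= [X in _ + X]big1 => [|a al].
  under eq_bigr do rewrite -mulrA -addcharD subrr addchar0 mulr1.
  by rewrite sumr_const card_Fp// addr0 mulr_natl.
under eq_bigr do rewrite -mulrA -addcharD -mulrBr.
by rewrite -mulr_sumr sum_addchar subr_eq0 (negbTE al) mulr0.
Qed.

Lemma gauss_sum_neq0 : gauss_sum 1 != 0.
Proof.
apply/eqP => t0; have := gauss_inversion 1.
rewrite big1 => [|b _]; last by rewrite gauss_sumM t0 mulr0 mul0r.
rewrite (quadchar1 p_pr pg) mulr1 => /esym/eqP; rewrite pnatr_eq0.
by rewrite gtn_eqF// (ltn_trans _ p2).
Qed.

(** Writing each Legendre symbol by Fourier inversion, and [gauss_sum b] as
    [quadchar b * gauss_sum 1], turns the polynomial into a combination of geometric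
    sums, one for each root of unity of order dividing [p]. *)
Lemma gauss_interpolation z :
  (\sum_(l < p) (legendre p l)%:~R * z ^+ l) / gauss_sum 1 =
  \sum_(a : 'F_p) (quadchar a)%:~R * (p%:R^-1 * \sum_(l < p) (z * addchar (- a)) ^+ l).
Proof.
have p0 : p%:R != 0 :> K by rewrite pnatr_eq0 gtn_eqF// (ltn_trans _ p2).
apply: (mulIf gauss_sum_neq0); rewrite mulfVK ?gauss_sum_neq0//.
apply: (mulfI p0); rewrite mulr_suml [LHS]mulr_sumr [RHS]mulr_sumr.
under eq_bigr => l _ do
  rewrite mulrA -[X in legendre p X]/(nat_of_ord l) legendre_quadchar// -gauss_inversion mulr_suml.
rewrite exchange_big/=; apply: eq_bigr => a _.
rewrite mulrAC mulrA -gauss_sumM mulrCA -!mulrA.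
rewrite mulKf// mulr_sumr; apply: eq_bigr => l _.
by rewrite exprMn -addchar_natM mulNr -!mulrA [X in _ = _ * X]mulrC.
Qed.

End GaussSum.

Local Open Scope complex_scope.

(** * Trigonometry and the circle exponential *)

Section Trigo.
Variable R : realType.
Implicit Types (x s t v : R) (m : int).

(** Mean value theorem on [[0, x]], where the cosine decreases. *)
Lemma sin_bounds x : 0 <= x <= pi -> x * cos x <= sin x <= x.
Proof.
move=> /andP[x0 xpi].
have [c /[!in_itv]/= /andP[c0 cx] E] := MVT_segment x0
  (fun y _ => is_derive_sin y) (continuous_subspaceT (@continuous_sin R)).
rewrite subr0 sin0 subr0 in E.
have cp : cos x <= cos c.
  move: cx; rewrite le_eqVlt => /predU1P[->//|cx].
  by rewrite ltW// ltr_cos// in_itv/= ?x0 ?c0 ?xpi// (le_trans (ltW cx)).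
have := cos_le1 c; have := cos_geN1 c.
rewrite E => h1 h2; apply/andP; split; nra.
Qed.

Lemma normr_sin_le x : `|sin x| <= `|x|.
Proof.
wlog x0 : x / 0 <= x.
  move=> H; have [|x0] := leP 0 x; first exact: H.
  by rewrite -(normrN (sin x)) -sinN -(normrN x); apply: H; rewrite oppr_ge0 ltW.
rewrite (ger0_norm x0); have [xpi|pix] := leP x pi.
  rewrite ger0_norm; first by have /andP[] := sin_bounds (introT andP (conj x0 xpi)).
  by apply: sin_ge0_pi; rewrite x0.
apply: le_trans (sin_max x) _; apply: le_trans _ (ltW pix).
by apply: le_trans (pi_ge2 R); rewrite ler1n.
Qed.

(** A lower bound for [sin x / x] on [|x| <= 3 pi / 4], from
    [sin x = 2 sin (x/2) cos (x/2) >= x cos (x/2) ^ 2]. *)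
Definition sinc_lower : R := cos (3 * pi / 8) ^+ 2.

Lemma sinc_lower_gt0 : 0 < sinc_lower.
Proof.
rewrite exprn_gt0// cos_gt0_pihalf//; have := pi_gt0 R => h; lra.
Qed.

Lemma sin_lower_bound x : `|x| <= 3 * pi / 4 -> sinc_lower * `|x| <= `|sin x|.
Proof.
wlog x0 : x / 0 <= x.
  move=> H; have [|x0] := leP 0 x; first exact: H.
  by rewrite -(normrN (sin x)) -sinN -(normrN x); apply: H; rewrite oppr_ge0 ltW.
have p0 := pi_gt0 R.
rewrite (ger0_norm x0) => x34.
have c0 : 0 < cos (3 * pi / 8 : R) by rewrite cos_gt0_pihalf//; lra.
have yb : 0 <= x / 2 <= 3 * pi / 8 by lra.
have cy : cos (3 * pi / 8) <= cos (x / 2).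
  case/andP: yb => y0; rewrite le_eqVlt => /predU1P[->//|yb].
  by rewrite ltW// ltr_cos// in_itv/=; lra.
have /andP[sy _] : x / 2 * cos (x / 2) <= sin (x / 2) <= x / 2 by apply: sin_bounds; lra.
apply: le_trans (ler_norm _).
have -> : sin x = 2 * (cos (x / 2) * sin (x / 2)).
  have {1}-> : x = (x / 2) *+ 2 by rewrite -mulr_natr; field.
  by rewrite sin_mulr2n mulr_natl.
rewrite /sinc_lower; set c := cos (3 * _ / _) in c0 cy *; set d := cos (x / 2) in cy sy *.
have : c * c <= d * d by nra.
rewrite expr2; nra.
Qed.

Lemma cos_ge_quadratic x : 1 - x ^+ 2 / 2 <= cos x.
Proof.
have -> : cos x = 1 - 2 * sin (x / 2) ^+ 2.
  have {1}-> : x = (x / 2) *+ 2 by rewrite -mulr_natr; field.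
  rewrite cos_mulr2n.
  by rewrite cos2sin2 -mulr_natl; ring.
have := normr_sin_le (x / 2); rewrite -[_ <= _]ler_sqr ?nnegrE// !real_normK ?num_real//.
by rewrite exprMn; lra.
Qed.

End Trigo.

Section CircleExponential.
Variable R : realType.
Implicit Types (x s t v : R) (m : int).
Notation normc := (@Normc.normc R).

Lemma eD s t : e (s + t) = e s * e t.
Proof. by rewrite /e mulrDr cosD sinD; simpc; rewrite [X in _ +i* X]addrC. Qed.

Lemma e0 : e (0 : R) = 1.
Proof. by rewrite /e mulr0 cos0 sin0. Qed.

Lemma e1 : e (1 : R) = 1.
Proof. by rewrite /e mulr1 -mulr_natl mulr1 mulr_natl cos2pi sin2pi. Qed.

Lemma eX t n : e t ^+ n = e (n%:R * t).
Proof.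
elim: n => [|n IHn]; first by rewrite mul0r e0.
by rewrite exprS IHn -eD -[in RHS]natr1 mulrDl mul1r addrC.
Qed.

Lemma e_nat n : e (n%:R : R) = 1.
Proof. by rewrite -[n%:R]mulr1 -eX e1 expr1n. Qed.

Lemma eDint t m : e (t + m%:~R) = e t.
Proof.
case: m => n; first by rewrite eD e_nat mulr1.
by rewrite NegzE rmorphN/= -[in RHS](subrK (n.+1%:R) t) [RHS]eD e_nat mulr1.
Qed.

Lemma e_sub1 v : e v - 1 = (2 * sin (pi * v))%:C * 'i%C * e (v / 2).
Proof.
have -> : e v = e (v / 2) * e (v / 2) by rewrite -eD -splitr.
rewrite /e; have -> : 2 * pi * (v / 2) = pi * v by field.
apply/eqP; simpc; rewrite eq_complex/=; have := cos2Dsin2 (pi * v) => h.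
by apply/andP; split; apply/eqP; nra.
Qed.
End CircleExponential.

(** * The coefficients of the process and of the Fekete polynomial *)

Section Coefficients.
Variable R : realType.
Implicit Types (x s t v : R) (m : int).
Local Notation normc := (@Normc.normc R).

Lemma normc_ge_Re (z : R[i]) : `|complex.Re z| <= normc z.
Proof.
by case: z => a b /=; rewrite -sqrtr_sqr ler_sqrt ?addr_ge0 ?sqr_ge0// lerDl sqr_ge0.
Qed.

Lemma normc_ge_Im (z : R[i]) : `|complex.Im z| <= normc z.
Proof.
by case: z => a b /=; rewrite -sqrtr_sqr ler_sqrt ?addr_ge0 ?sqr_ge0// lerDr sqr_ge0.
Qed.

Lemma normc_e t : normc (e t) = 1.
Proof. by rewrite /= cos2Dsin2 sqrtr1. Qed.

Lemma normc_real x : normc x%:C = `|x|.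
Proof. by rewrite /= expr0n addr0 sqrtr_sqr. Qed.

Lemma normci : normc 'i%C = 1.
Proof. by rewrite /= expr0n add0r expr1n sqrtr1. Qed.

Lemma e_neq0 t : e t != 0.
Proof.
by apply: contra_eq_neq (normc_e t) => ->; rewrite Normc.normc0 eq_sym oner_neq0.
Qed.

Lemma eN t : e (- t) = (e t)^-1.
Proof. by apply: (mulIf (e_neq0 t)); rewrite -eD addNr e0 mulVf// e_neq0. Qed.

Lemma normc_e_sub1 v : normc (e v - 1) = 2 * `|sin (pi * v)|.
Proof.
by rewrite e_sub1 !Normc.normcM normc_e normci !mulr1 normc_real normrM ger0_norm.
Qed.

Lemma sin_pi_neq0 v : v != 0 -> `|v| < 1 -> sin (pi * v) != 0.
Proof.
move=> v0; have p0 := pi_gt0 R; wlog v1 : v v0 / 0 < v.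
  move=> H; case/orP: (lt_total v0) => [vn|vp]; last exact: H.
  rewrite -normrN => /H; rewrite oppr_eq0 oppr_gt0 mulrN sinN oppr_eq0; exact.
rewrite gtr0_norm// => v2; rewrite gt_eqF// sin_gt0_pi//; nra.
Qed.

Lemma e_neq1 v : v != 0 -> `|v| < 1 -> e v != 1.
Proof.
move=> v0 v1; rewrite -subr_eq0 -normr_eq0; apply/eqP => h.
have := normc_e_sub1 v; rewrite (_ : normc _ = 0); last first.
  by move/eqP: h; rewrite normr_eq0 => /eqP ->; rewrite Normc.normc0.
by move/esym/eqP; rewrite mulf_eq0 pnatr_eq0 normr_eq0 (negbTE (sin_pi_neq0 v0 v1)).
Qed.

Lemma GcoefE m t : t != m%:~R ->
  Gcoef m t = (sin (2 * pi * t) / (2 * pi * (m%:~R - t))) +i*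
              ((1 - cos (2 * pi * t)) / (2 * pi * (m%:~R - t))).
Proof.
move=> tm; rewrite /Gcoef (negbTE tm).
have w0 : 2 * pi * (m%:~R - t) != 0.
  apply: mulf_neq0; last by rewrite subr_eq0 eq_sym.
  by rewrite mulf_neq0 ?pnatr_eq0// gt_eqF// pi_gt0.
have -> : 2 * 'i%C * pi%:C * (m%:~R - t%:C) = (2 * pi * (m%:~R - t))%:C * 'i%C :> R[i].
  by rewrite !rmorphM rmorphB /= rmorph_int rmorph_nat; ring.
move: (2 * pi * _) w0 => w w0.
have wi0 : w%:C * 'i%C != 0 :> R[i].
  by rewrite mulf_neq0//; [rewrite eq_complex/= negb_and w0 | rewrite eq_complex/= oner_eq0 andbF].
apply: (mulIf wi0); rewrite divfK// /e; simpc.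
by apply/eqP; rewrite eq_complex/=; apply/andP; split; apply/eqP; field.
Qed.

Lemma normc_GcoefM m t : t != m%:~R ->
  normc (Gcoef m t) * (pi * `|m%:~R - t|) = `|sin (pi * t)|.
Proof.
move=> tm; rewrite /Gcoef (negbTE tm) Normc.normcM Normc.normcV normc_e_sub1.
have -> : 2 * 'i%C * pi%:C * (m%:~R - t%:C) = (2 * pi * (m%:~R - t))%:C * 'i%C :> R[i].
  by rewrite !rmorphM rmorphB /= rmorph_int rmorph_nat; ring.
rewrite Normc.normcM normci mulr1 normc_real !normrM normr_nat (ger0_norm (pi_ge0 R)).
have d0 : `|m%:~R - t| != 0 by rewrite normr_eq0 subr_eq0 eq_sym.
have P0 : (pi : R) != 0 by rewrite gt_eqF ?pi_gt0.
move: (pi : R) (`|m%:~R - t|) P0 d0 => P D P0 D0; field.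
by rewrite D0 P0.
Qed.

Lemma normc_Gcoef_le1 m t : normc (Gcoef m t) <= 1.
Proof.
have [tm|tm] := eqVneq t m%:~R.
  by rewrite /Gcoef tm eqxx normcN Normc.normc1.
have d0 : 0 < pi * `|m%:~R - t| :> R.
  by rewrite mulr_gt0 ?pi_gt0// normr_gt0 subr_eq0 eq_sym.
rewrite -(ler_pM2r d0) mul1r normc_GcoefM//.
have <- : `|sin (pi * (t - m%:~R))| = `|sin (pi * t)|.
  by apply: (mulfI (x := 2)); rewrite ?pnatr_eq0// -!normc_e_sub1 -rmorphN eDint.
by apply: le_trans (normr_sin_le _) _; rewrite normrM ger0_norm ?pi_ge0// distrC.
Qed.

Lemma dist_int_ge m t : 0 <= t <= 1 -> (2 <= `|m|)%N -> (`|m|%N%:R / 2 : R) <= `|m%:~R - t|.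
Proof.
move=> /andP[t0 t1] m2.
have m2' : (2 : R) <= `|m|%N%:R by rewrite ler_nat.
case: m m2 m2' => n /=.
  by move=> _ n2; rewrite (_ : n%:~R = n%:R)// ger0_norm; lra.
move=> _ n2; rewrite NegzE rmorphN /= (_ : n.+1%:~R = n.+1%:R)//.
by rewrite -opprD normrN ger0_norm; lra.
Qed.

Lemma normc_Gcoef_le m t : 0 <= t <= 1 -> (2 <= `|m|)%N ->
  normc (Gcoef m t) <= `|m|%N%:R^-1.
Proof.
move=> t01 m2; have d := dist_int_ge t01 m2.
have m2' : (2 : R) <= `|m|%N%:R by rewrite ler_nat.
have tm : t != m%:~R by apply: contraTneq d => ->; rewrite subrr normr0 -ltNge; lra.
have := normc_GcoefM tm; have := sin_max (pi * t); have := pi_ge2 R.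
rewrite -[_^-1]mul1r ler_pdivlMr; last by lra.
have : 0 <= normc (Gcoef m t) by case: (Gcoef m t) => a b /=; rewrite sqrtr_ge0.
move: (normc _) (pi : R) `|sin _| `|_ - t| d => G P S D d G0 P2 S1 E.
apply: le_trans S1; rewrite -E ler_wpM2l//.
by apply: le_trans (_ : 2 * D <= _); [lra | rewrite ler_wpM2r//; lra].
Qed.

(** Up to sign, the ratio between the coefficients of the Fekete polynomial and those
    of the limit process ([rotcoefE]). *)
Definition phase v : R[i] :=
  if v == 0 then 1 else (pi * v / sin (pi * v))%:C * e (- (v / 2)).

(** The coefficient of [quadchar (k + m)] in the Fekete quotient at the point
    [(k + s) / p]. *)
Definition rotcoef (p : nat) m s : R[i] :=
  p%:R^-1 * \sum_(l < p) e ((s - m%:~R) / p%:R) ^+ l.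

Lemma rotcoefE p m s : (0 < p)%N -> `|(s - m%:~R) / p%:R| < 1 ->
  rotcoef p m s = - Gcoef m s * phase ((s - m%:~R) / p%:R).
Proof.
move=> p_gt0 v1; have p0 : (p%:R : R) != 0 by rewrite pnatr_eq0 -lt0n.
have pC0 : (p%:R : R[i]) != 0 by rewrite pnatr_eq0 -lt0n.
rewrite /rotcoef /phase; set v := _ / _ in v1 *.
have sm : s = p%:R * v + m%:~R by rewrite /v mulrC divfK// subrK.
have [v0|v0] := eqVneq v 0.
  have sm' : s = m%:~R by rewrite sm v0 mulr0 add0r.
  rewrite /Gcoef sm' eqxx opprK mulr1 v0.
  under eq_bigr do rewrite e0 expr1n.
  by rewrite sumr_const card_ord mulVf.
have sm0 : s != m%:~R.
  by rewrite sm -subr_eq0 addrK mulf_neq0.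
rewrite /Gcoef (negbTE sm0).
have ev := e_neq1 v0 v1.
have ev0 : e v - 1 != 0 by rewrite subr_eq0.
have -> : \sum_(l < p) e v ^+ l = (e s - 1) / (e v - 1).
  apply: (mulfI ev0); rewrite -subrX1 eX [RHS]mulrC divfK//.
  by rewrite [in RHS]sm eDint.
have -> : m%:~R - s%:C = - (p%:R * v%:C) :> R[i].
  by rewrite [in LHS]sm rmorphD rmorphM/= rmorph_int rmorph_nat; ring.
have -> : (pi * v / sin (pi * v))%:C = pi%:C * v%:C / (sin (pi * v))%:C :> R[i].
  by rewrite rmorphM fmorphV rmorphM.
have s0 := sin_pi_neq0 v0 v1; rewrite [X in _ / X]e_sub1 rmorphM /= eN.
have i0 : 'i%C != 0 :> R[i] by rewrite eq_complex/= oner_eq0 andbF.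
have pi0 : pi%:C != 0 :> R[i] by rewrite eq_complex/= gt_eqF ?pi_gt0.
have vC0 : v%:C != 0 :> R[i] by rewrite eq_complex/= negb_and v0.
have sC0 : (sin (pi * v))%:C != 0 :> R[i] by rewrite eq_complex/= negb_and s0.
have two : (2%:C : R[i]) = 2 by rewrite rmorph_nat.
rewrite two; have eh := e_neq0 (v / 2).
move: (e s - 1) (e (v / 2)) eh sC0 => A B B0; move: (sin _)%:C v%:C pi%:C 'i%C vC0 pi0 i0.
move=> S V P I V0 P0 I0 S0; field.
by rewrite pC0 P0 I0 S0 V0 B0.
Qed.

End Coefficients.

(** * Comparison of the two families of coefficients *)

Section Phase.
Variable R : realType.
Implicit Types (x s t v : R) (m : int).
Local Notation normc := (@Normc.normc R).

Lemma normc_ge0 (z : R[i]) : 0 <= normc z.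
Proof. by case: z => a b /=; rewrite sqrtr_ge0. Qed.

Lemma normc_phase_le v : `|v| <= 3 / 4 -> normc (phase v) <= (sinc_lower R)^-1.
Proof.
move=> v34; have k0 := sinc_lower_gt0 R; rewrite /phase.
have [v0|v0] := eqVneq v 0.
  rewrite Normc.normc1 -[leLHS]invr1 lef_pV2 ?posrE//.
  by rewrite /sinc_lower expr_le1// ?cos_le1// cos_ge0_pihalf//; have := pi_gt0 R; lra.
rewrite Normc.normcM normc_e mulr1 normc_real normrM normfV.
have s0 : 0 < `|sin (pi * v)|.
  by rewrite normr_gt0 sin_pi_neq0//; apply: le_lt_trans v34 _; lra.
rewrite ler_pdivrMr// ler_pdivlMl// sin_lower_bound// normrM (ger0_norm (pi_ge0 R)).
have := pi_gt0 R; nra.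
Qed.

Lemma normc_phase_sub1 v : pi * `|v| <= 1 -> normc (phase v - 1) <= 2 * pi * `|v|.
Proof.
move=> v1; have p0 := pi_gt0 R; have p2 := pi_ge2 R; rewrite /phase.
have [v0|v0] := eqVneq v 0.
  by rewrite subrr Normc.normc0 v0 normr0 mulr0.
set x := pi * v; set E := e _.
have -> : (x / sin x)%:C * E - 1 = (x / sin x - 1)%:C * E + (E - 1) by rewrite rmorphB/=; ring.
apply: le_trans (le_normcD _ _) _; rewrite Normc.normcM normc_e mulr1 normc_real.
have -> : 2 * pi * `|v| = `|x| + `|x|.
  by rewrite /x normrM (ger0_norm (ltW p0)); ring.
have nx : `|x| = pi * `|v| by rewrite /x normrM (ger0_norm (ltW p0)).
rewrite lerD//; last first.
  rewrite normc_e_sub1; apply: le_trans (_ : 2 * `|pi * (- (v / 2))| <= _).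
    by rewrite ler_pM2l// normr_sin_le.
  by rewrite nx mulrN normrN !normrM normfV (ger0_norm (ltW p0)) normr_nat; lra.
have qE : x / sin x = `|x| / sin `|x|.
  by case: (ger0P x) => // _; rewrite sinN invrN mulrNN.
have x0 : 0 < `|x| by rewrite nx mulr_gt0// normr_gt0.
rewrite qE; move: `|x| x0 nx => y y0 yE; have {yE}y1 : y <= 1 by rewrite yE.
have /andP[s1 s2] : y * cos y <= sin y <= y by apply: sin_bounds; lra.
have c1 := cos_ge_quadratic y; have c2 := cos_le1 y.
have s0 : 0 < sin y by nra.
rewrite ger0_norm; last by rewrite subr_ge0 ler_pdivlMr// mul1r.
rewrite lerBlDr ler_pdivrMr//.
have : y * (1 - y ^+ 2 / 2) <= sin y by nra.
nra.
Qed.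

Lemma dist_int_le m t : 0 <= t <= 1 -> `|t - m%:~R| <= `|m|%N%:R + 1.
Proof.
move=> /andP[t0 t1]; apply: le_trans (ler_normB _ _) _; rewrite addrC lerD//.
  by rewrite -intr_norm -abszE.
by rewrite ger0_norm.
Qed.

(** The bound [3 / 4] keeps the argument [pi * v] away from the nonzero zeros of the
    sine; [|s - m| <= (p + 1) / 2] leaves room for it. *)
Lemma rotation_small p m s : 0 <= s <= 1 -> (2 < p)%N -> (2 * `|m| < p)%N ->
  `|(s - m%:~R) / p%:R| <= 3 / 4.
Proof.
move=> s01 p2 mp; rewrite normrM normfV normr_nat ler_pdivrMr ?ltr0n ?(ltn_trans _ p2)//.
apply: le_trans (dist_int_le m s01) _.
have : (4 * `|m| + 4)%N%:R <= (3 * p)%N%:R :> R by rewrite ler_nat; lia.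
by rewrite natrD !natrM; lra.
Qed.

Lemma normc_rotcoef_le p m s : 0 <= s <= 1 -> (2 < p)%N -> (2 * `|m| < p)%N ->
  (2 <= `|m|)%N -> normc (rotcoef p m s) <= (sinc_lower R)^-1 * `|m|%N%:R^-1.
Proof.
move=> s01 p2 mp m2; have v34 := rotation_small s01 p2 mp.
rewrite rotcoefE ?(ltn_trans _ p2)//; last by apply: le_lt_trans v34 _; lra.
rewrite Normc.normcM normcN mulrC ler_pM ?normc_ge0 ?normc_phase_le//.
exact: normc_Gcoef_le.
Qed.

(** Uniformly in [s], because the argument of [phase] is [O(M / p)] and [phase] is
    Lipschitz at [0]. *)
Lemma rotcoef_cvg M (d : R) : 0 < d -> exists p0, forall p m s, (p0 <= p)%N ->
  (`|m| <= M)%N -> 0 <= s <= 1 -> normc (rotcoef p m s + Gcoef m s) <= d.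
Proof.
move=> d0; have P0 := pi_gt0 R; have P2 := pi_ge2 R.
pose B : R := 2 * pi * (M%:R + 1) / Num.min 1 d.
have md0 : 0 < Num.min 1 d by rewrite lt_min ltr01.
have M0 : (0 : R) <= M%:R by [].
have B0 : 0 <= B.
  by rewrite /B mulr_ge0// ?invr_ge0 ?(ltW md0)// mulr_ge0 ?addr_ge0// mulr_ge0// ltW.
exists (Num.bound B) => p m s pB mM s01.
have p1 : B < p%:R by apply: lt_le_trans (archi_boundP B0) _; rewrite ler_nat.
have p0 : (0 : R) < p%:R by apply: le_lt_trans B0 p1.
have v1 : 2 * pi * `|(s - m%:~R) / p%:R| <= Num.min 1 d.
  rewrite normrM normfV normr_nat mulrA ler_pdivrMr//.
  have : B * Num.min 1 d <= Num.min 1 d * p%:R by rewrite mulrC ler_pM2l// ltW.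
  rewrite /B divfK ?gt_eqF//; apply: le_trans.
  rewrite ler_pM2l; last by rewrite mulr_gt0.
  by apply: le_trans (dist_int_le m s01) _; rewrite lerD2r ler_nat.
have v1' : pi * `|(s - m%:~R) / p%:R| <= 1.
  have : Num.min 1 d <= 1 by rewrite ge_min lexx.
  have : 0 <= `|(s - m%:~R) / p%:R| by [].
  by move: `|_ / _| v1 => V V1; nra.
have pn : (0 < p)%N by rewrite -(ltr0n R).
have vlt : `|(s - m%:~R) / p%:R| < 1.
  by move: (normr_ge0 ((s - m%:~R) / p%:R)) v1'; move: `|_ / _| => V V0 V1; nra.
rewrite rotcoefE//.
have -> : - Gcoef m s * phase ((s - m%:~R) / p%:R) + Gcoef m s =
    - (Gcoef m s * (phase ((s - m%:~R) / p%:R) - 1)) by ring.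
rewrite normcN Normc.normcM -[leRHS]mul1r ler_pM ?normc_ge0 ?normc_Gcoef_le1//.
by apply: le_trans (normc_phase_sub1 v1') _; apply: le_trans v1 _; rewrite ge_min lexx orbT.
Qed.

End Phase.

(** * Interpolation of the Fekete polynomial near a root of unity *)

Section SymmetricSums.
Variable V : zmodType.
Implicit Types F : int -> V.

(** Sum over the integers [m] with [|m| <= N], indexed as in the partial sums of the
    process. *)
Definition symsum (N : nat) F : V := \sum_(i < (2 * N).+1) F (i%:Z - N%:Z).

Lemma symsum0 F : symsum 0 F = F 0.
Proof. by rewrite /symsum big_ord1 subr0. Qed.

Lemma symsumS N F : symsum N.+1 F = F (- N.+1%:Z) + symsum N F + F N.+1%:Z.
Proof.
rewrite /symsum mulnS !addSn add0n big_ord_recr big_ord_recl/=.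
congr (F _ + _ + F _); first by rewrite sub0r.
  by apply: eq_bigr => i _; congr F; rewrite /bump/=; lia.
by lia.
Qed.

Lemma eq_symsum N F1 F2 : (forall m : int, (`|m| <= N)%N -> F1 m = F2 m) ->
  symsum N F1 = symsum N F2.
Proof.
move=> h; apply: eq_bigr => i _; apply: h; have := ltn_ord i; lia.
Qed.

Lemma symsum_trunc M N F : (M <= N)%N ->
  symsum N (fun m => if (`|m| <= M)%N then F m else 0) = symsum M F.
Proof.
elim: N => [|N IHN]; first by rewrite leqn0 => /eqP->; rewrite !symsum0.
rewrite leq_eqVlt ltnS => /predU1P[->|MN].
  by apply: eq_symsum => m ->.
by rewrite symsumS IHN// abszN absz_nat ltn_geF ?addr0 ?add0r// ltnS.
Qed.

Lemma symsumD N F1 F2 : symsum N (fun m => F1 m + F2 m) = symsum N F1 + symsum N F2.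
Proof. exact: big_split. Qed.

Lemma symsum_split M N F : (M <= N)%N ->
  symsum N F = symsum M F + symsum N (fun m => if (M < `|m|)%N then F m else 0).
Proof.
move=> MN; rewrite -(symsum_trunc F MN) -symsumD; apply: eq_symsum => m _.
by rewrite ltnNge; case: ifP => _; rewrite ?addr0 ?add0r.
Qed.

End SymmetricSums.

Section Rotation.
Variable R : realType.
Implicit Types (x s t v : R) (m : int) (z : R[i]).
Variable p : nat.
Hypotheses (p_pr : prime p) (p2 : (2 < p)%N).

Let p0 : (p%:R : R) != 0.
Proof. by rewrite pnatr_eq0 gtn_eqF// (ltn_trans _ p2). Qed.

Lemma zeta_prim : p.-primitive_root (zeta R p).
Proof.
have z1 : zeta R p ^+ p = 1 by rewrite /zeta eX mulfV// e1.
have [m mz mp] := prim_order_exists (prime_gt0 p_pr) z1.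
have [m1|m1] := eqVneq m 1%N.
  have := e_neq1 (v := p%:R^-1) (invr_neq0 p0); rewrite normfV normr_nat invf_lt1 ?ltr0n ?prime_gt0//.
  rewrite ltr1n prime_gt1// => /(_ isT)/negP; case; apply/eqP.
  by rewrite -/(zeta R p); move: (prim_expr_order mz); rewrite m1 expr1.
by rewrite -{1}(prime_nt_dvdP p_pr m1 mp).
Qed.

Lemma horner_fekete z : (fekete R p).[z] = \sum_(l < p) (legendre p l)%:~R * z ^+ l.
Proof.
rewrite /fekete horner_sum -(big_mkord xpredT (fun l => (legendre p l)%:~R * z ^+ l)).
rewrite [RHS]big_ltn ?prime_gt0// /legendre dvdn0 mul0r add0r.
by apply: eq_bigr => l _; rewrite hornerZ hornerXn.
Qed.

Lemma fekete_zeta : (fekete R p).[zeta R p] = gauss_sum (zeta R p) (1 : 'F_p).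
Proof.
rewrite horner_fekete (sum_nat_Fp p_pr (fun l => (legendre p l)%:~R * zeta R p ^+ l)).
by apply: eq_bigr => a _; rewrite mul1r.
Qed.

Lemma addchar_zeta_int m : addchar (zeta R p) (m%:~R : 'F_p) = e (m%:~R / p%:R).
Proof.
case: m => n; first by rewrite (addchar_nat p_pr zeta_prim) /zeta eX.
rewrite NegzE rmorphN/= rmorphN/= mulNr eN.
have a0 n' : addchar (zeta R p) (n'%:R : 'F_p) != 0.
  by rewrite (addchar_nat p_pr zeta_prim) expf_neq0// e_neq0.
apply: (mulIf (a0 n.+1)); rewrite -(addcharD p_pr zeta_prim) addNr addchar0.
by rewrite (addchar_nat p_pr zeta_prim) /zeta eX mulVf// e_neq0.
Qed.

Definition feketeratio t : R[i] := (fekete R p).[e t] / (fekete R p).[zeta R p].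

(** [gauss_interpolation] with the residues listed as [k + m], [|m| <= (p - 1) / 2];
    this choice of representatives makes the coefficient of index [m] decay like
    [1 / |m|]. *)
Lemma feketeratio_window (k : nat) s :
  feketeratio ((k%:R + s) / p%:R) =
  symsum p./2 (fun m => (quadchar (k%:R + m%:~R : 'F_p))%:~R * rotcoef p m s).
Proof.
have pE := odd_prime_half p_pr p2.
rewrite /feketeratio fekete_zeta horner_fekete (gauss_interpolation p_pr p2 zeta_prim).
pose c : 'F_p := k%:R - (p./2)%:R.
rewrite (reindex_onto (fun a => a + c) (fun a => a - c))/=; last first.
  by move=> a _; rewrite subrK.
under eq_bigl do rewrite addrK eqxx.
pose G (l : nat) : R[i] := (quadchar (l%:R + c : 'F_p))%:~R *
  (p%:R^-1 * \sum_(l0 < p) (e ((k%:R + s) / p%:R) * addchar (zeta R p) (- (l%:R + c : 'F_p))) ^+ l0).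
transitivity (\sum_(a : 'F_p) G a).
  by apply: eq_bigr => a _; rewrite /G natr_Zp.
rewrite -(sum_nat_Fp p_pr) /symsum -pE; apply: eq_bigr => i _; rewrite /G.
have cE : (i : nat)%:R + c = k%:R + (i%:Z - p./2%:Z)%:~R :> 'F_p.
  by rewrite /c rmorphB/=; ring.
congr (_ * _); first by rewrite cE.
rewrite /rotcoef; congr (_ * _); apply: eq_bigr => l _; congr (_ ^+ _).
have -> : - ((i : nat)%:R + c) = (p./2%:Z - k%:Z - i%:Z)%:~R :> 'F_p.
  by rewrite /c !rmorphB/=; ring.
rewrite addchar_zeta_int -eD; congr e; rewrite -mulrDl; congr (_ / _).
by rewrite !rmorphB/=; ring.
Qed.

End Rotation.

Local Open Scope classical_set_scope.
Local Open Scope ring_scope.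

(** * Real-valued probabilities *)

Section RealProbability.
Context (R : realType) (d : measure_display) (T : measurableType d).
Variable Q : probability T R.
Implicit Types A B : set T.

Definition pr A : R := fine (Q A).

Lemma EFin_pr A : measurable A -> (pr A)%:E = Q A.
Proof. by move=> mA; rewrite /pr fineK// fin_num_measure. Qed.

Lemma pr_ge0 A : 0 <= pr A.
Proof. by rewrite /pr fine_ge0. Qed.

Lemma pr_le A B : measurable A -> measurable B -> A `<=` B -> pr A <= pr B.
Proof.
by move=> mA mB AB; rewrite -lee_fin !EFin_pr// le_measure ?inE.
Qed.

Lemma pr_setT : pr setT = 1.
Proof. by rewrite /pr probability_setT. Qed.

Lemma pr_le1 A : measurable A -> pr A <= 1.
Proof. by move=> mA; rewrite -pr_setT pr_le. Qed.

Lemma pr_setC A : measurable A -> pr (~` A) = 1 - pr A.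
Proof.
move=> mA; apply: EFin_inj; rewrite EFinB !EFin_pr ?probability_setC//.
exact: measurableC.
Qed.

Lemma pr_setU A B : measurable A -> measurable B -> pr (A `|` B) <= pr A + pr B.
Proof.
move=> mA mB; rewrite -lee_fin EFinD !EFin_pr//; last exact: measurableU.
exact: measureU2.
Qed.

Lemma pr_le_setU A B C : measurable A -> measurable B -> measurable C ->
  A `<=` B `|` C -> pr A <= pr B + pr C.
Proof.
move=> mA mB mC ABC; apply: le_trans (pr_setU mB mC).
by apply: pr_le => //; exact: measurableU.
Qed.

Lemma pr_bigcup (F : nat -> set T) (c : R) : (forall n, measurable (F n)) ->
  (forall n, \sum_(k < n) pr (F k) <= c) -> pr (\bigcup_n F n) <= c.
Proof.
move=> mF Fc; have mU := bigcup_measurable (P := setT) (fun k _ => mF k).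
rewrite -lee_fin EFin_pr//.
apply: le_trans (measure_sigma_subadditive Q mF mU (@subset_refl _ _)) _.
apply: lime_le; first exact: is_cvg_nneseries.
apply: nearW => n; rewrite (eq_bigr (fun k => (pr (F k))%:E)) => [|k _]; last by rewrite EFin_pr.
by rewrite sumEFin lee_fin big_mkord.
Qed.

Lemma pr_double_counting (I : finType) (F : I -> set T) (c : R) :
  (forall i, measurable (F i)) -> (forall t, \sum_i \1_(F i) t <= c) ->
  \sum_i pr (F i) <= c.
Proof.
move=> mF Fc; rewrite -lee_fin -sumEFin.
have -> : (\sum_i (pr (F i))%:E = \int[Q]_t \sum_i (\1_(F i) t)%:E)%E.
  rewrite ge0_integral_sum//=; last first.
    by move=> i; apply/measurable_EFinP; exact: measurable_indic.
  by apply: eq_bigr => i _; rewrite integral_indic// setIT EFin_pr.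
have -> : c%:E = (\int[Q]_t (cst c%:E) t)%E.
  by rewrite integral_cst//= probability_setT mule1.
apply: ge0_le_integral => //=.
- by move=> t _; rewrite sumEFin lee_fin sumr_ge0.
- by apply: emeasurable_sum => i; apply/measurable_EFinP; exact: measurable_indic.
- by move=> t _; rewrite sumEFin lee_fin.
Qed.

(** Chebyshev's inequality on a product space, one factor of which is a finite set
    [W] with counting measure: for each fixed [t], the system [xi] is quasi-orthogonal
    in [w], which bounds the number of [w] where the sum is large; integrating over
    [t] gives the claim.  The system is either the signs or the translates of the
    quadratic character. *)
Lemma pr_chebyshev (W I : finType) (xi : I -> W -> R) (n : R) (D : set T)
    (b : I -> T -> R) (V del : R) :
  (forall beta : I -> R,
     \sum_w (\sum_i beta i * xi i w) ^+ 2 <= n * \sum_i beta i ^+ 2) -> 0 <= n ->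
  measurable D -> (forall i, measurable_fun setT (b i)) -> 0 <= V -> 0 < del ->
  (forall t, D t -> \sum_i b i t ^+ 2 <= V) ->
  \sum_w pr (D `&` [set t | del < `|\sum_i b i t * xi i w|]) <= n * V / del ^+ 2.
Proof.
move=> orth n0 mD mb V0 del0 bV; apply: pr_double_counting => [w|t].
  apply: measurableI => //.
  rewrite [X in measurable X](_ : _ =
    [set: T] `&` (fun t => `|\sum_i b i t * xi i w|) @^-1` `]del, +oo[%classic); last first.
    by rewrite setTI; apply/seteqP; split => t /=; rewrite in_itv/= andbT.
  have mS : measurable_fun setT (fun t => `|\sum_i b i t * xi i w|).
    apply: measurableT_comp => //; apply: measurable_sum => i.
    by apply: measurable_funM => //; exact: measurable_cst.
  by apply: mS => //; exact: measurable_itv.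
case: (pselect (D t)) => [Dt|nDt]; last first.
  rewrite big1 => [|w _]; first exact: divr_ge0 (mulr_ge0 _ _) (sqr_ge0 _).
  by rewrite indicE memNset// => -[].
rewrite ler_pdivlMr ?exprn_gt0// mulr_suml.
apply: le_trans (_ : \sum_w (\sum_i b i t * xi i w) ^+ 2 <= _).
  apply: ler_sum => w _; rewrite indicE.
  case: (boolP (t \in _)) => [|_]; last by rewrite mul0r sqr_ge0.
  rewrite inE => -[_ /= h]; rewrite mul1r -[leRHS]real_normK ?num_real//.
  by rewrite ler_pXn2r ?nnegrE ?(ltW del0) ?(ltW h).
by apply: le_trans (orth (b ^~ t)) _; rewrite ler_wpM2l// bV.
Qed.

End RealProbability.

(** * The uniform law *)

Section Uniform.
Variable R : realType.
Local Notation lambda := (@lebesgue_measure R).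

Definition unif : probability (measurableTypeR R) R := uniform_prob (@ltr01 R).

Lemma measurable_affine (c b : R) : measurable_fun setT (fun s : R => c * s + b).
Proof.
apply: continuous_measurable_fun => x.
by apply: continuousD; [apply: continuousM; [exact: cvg_cst|exact: cvg_id]|exact: cvg_cst].
Qed.

(** Both sides are measures in [A], and they agree on intervals. *)
Lemma lebesgue_affine (c b : R) (A : set R) : 0 < c -> measurable A ->
  lambda A = (c%:E * lambda ((fun s : R => (c * s + b)%R) @^-1` A))%E.
Proof.
move=> c0 mA.
have mf : measurable_fun setT (fun s : measurableTypeR R => c * s + b : measurableTypeR R).
  exact: measurable_affine.
pose push : {measure set (measurableTypeR R) -> \bar R} :=
  measure_function_pushforward__canonical__measure_function_Measure lambda mf.
pose nu : {measure set (measurableTypeR R) -> \bar R} := mscale (NngNum (ltW c0)) push.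
rewrite (@lebesgue_measure_unique R nu) // => _ [[x y] /= xy <-].
rewrite -[RHS]/(c%:E * lambda ((fun s : R => (c * s + b)%R) @^-1` `]x, y]%classic))%E.
have -> : (fun s => c * s + b) @^-1` `]x, y] = `](x - b) / c, (y - b) / c]%classic.
  apply/seteqP; split => s /=; rewrite !in_itv/= ltr_pdivrMr// ler_pdivlMr//.
    by rewrite ltrBlDr lerBrDr mulrC.
  by rewrite ltrBlDr lerBrDr mulrC.
rewrite !lebesgue_measure_itv/= !lte_fin ltr_pM2r ?invr_gt0// ltrD2r.
case: ifPn => _; last by rewrite mule0.
by rewrite -!EFinB -EFinM; congr _%:E; field; rewrite gt_eqF.
Qed.

Lemma unifE (A : set R) : measurable A -> unif A = lambda (A `&` `[0, 1]).
Proof.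
move=> mA; rewrite /unif/= /uniform_prob integral_uniform_pdf.
rewrite (eq_integral (fun=> 1%:E)); last first.
  by move=> x; rewrite inE/= in_itv/= => -[_ x01]; rewrite /uniform_pdf x01 subr0 invr1.
by rewrite integral_cst ?mul1e//; exact: measurableI.
Qed.

Lemma unif_le (A B : set R) : measurable A -> measurable B ->
  (forall s, 0 <= s <= 1 -> A s -> B s) -> pr unif A <= pr unif B.
Proof.
move=> mA mB AB; rewrite -lee_fin !EFin_pr// !unifE// le_measure ?inE//.
- exact: measurableI.
- exact: measurableI.
- by move=> s /= [As s01]; split => //; apply: AB => //; rewrite in_itv in s01.
Qed.

(** The interval is cut into [n] equal closed pieces, which overlap at their end
    points; this gives an inequality. *)
Lemma unif_scaling (A : set R) (n : nat) : (0 < n)%N -> measurable A ->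
  pr unif A <= n%:R^-1 * \sum_(k < n) pr unif [set s | A ((k%:R + s) / n%:R)].
Proof.
move=> n0 mA; have n0' : (0 : R) < n%:R by rewrite ltr0n.
have c0 : (0 : R) < n%:R^-1 by rewrite invr_gt0.
have mAk (k : nat) : measurable [set s : R | A ((k%:R + s) / n%:R)].
  rewrite (_ : [set s | _] = setT `&` (fun s => n%:R^-1 * s + k%:R / n%:R) @^-1` A).
    by apply: measurable_affine => //; exact: measurableT.
  rewrite setTI; apply/seteqP; split => s /=; by rewrite mulrDl [_^-1 * _]mulrC addrC.
pose Ak (k : nat) := A `&` `[k%:R / n%:R, k.+1%:R / n%:R].
have mAk' k : measurable (Ak k) by exact: measurableI.
have Aki k : lambda (Ak k) = (n%:R^-1%:E * unif [set s : R | A ((k%:R + s) / n%:R)%R])%E.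
  rewrite (@lebesgue_affine n%:R^-1 (k%:R / n%:R))// unifE//; congr (_ * lambda _)%E.
  have E s : n%:R^-1 * s + k%:R / n%:R = (k%:R + s) / n%:R :> R.
    by rewrite mulrDl [_^-1 * _]mulrC addrC.
  apply/seteqP; split => s /=; rewrite E /Ak/= !in_itv/= !ler_pM2r//.
    by rewrite lerDl -natr1 lerD2l.
  by rewrite lerDl -natr1 lerD2l.
rewrite -lee_fin EFin_pr// unifE// EFinM -sumEFin.
rewrite ge0_sume_distrr; last by move=> k _; rewrite lee_fin pr_ge0.
rewrite (eq_bigr (fun k : 'I_n => lambda (Ak k))) => [|k _]; last first.
  by rewrite Aki -(EFin_pr unif (mAk k)).
apply: content_subadditive; [by move=> k _; exact: mAk' | exact: measurableI | ].
move=> s /= [As]; rewrite in_itv/= => /andP[s0 s1].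
rewrite -bigcup_mkord.
have ns0 : 0 <= n%:R * s by rewrite mulr_ge0.
have [s1'|s1'] := eqVneq s 1.
  exists n.-1 => /=; first by rewrite ltn_predL.
  split => //=; rewrite in_itv/= s1' prednK// divff ?gt_eqF// lexx andbT.
  by rewrite ler_pdivrMr// mul1r ler_nat leq_pred.
exists (Num.truncn (n%:R * s)) => /=.
  have : (Num.truncn (n%:R * s))%:R < n%:R :> R.
    apply: le_lt_trans (_ : n%:R * s < _); first by rewrite truncn_le.
    by rewrite -[ltRHS]mulr1 ltr_pM2l// lt_neqAle s1'.
  by rewrite ltr_nat.
split => //=; rewrite in_itv/= ler_pdivrMr// ler_pdivlMr// [s * _]mulrC truncn_le//=.
rewrite ns0; exact: ltW (truncnS_gt _).
Qed.

End Uniform.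

(** * Signed sums *)

Section Signs.
Variables (R : realFieldType) (I : finType).
Implicit Types (x : {ffun I -> bool}) (b : I -> R).

Definition flip (i : I) x : {ffun I -> bool} :=
  [ffun j => if j == i then ~~ x j else x j].

Lemma flipK i : involutive (flip i).
Proof.
by move=> x; apply/ffunP => j; rewrite !ffunE; case: eqP; rewrite ?negbK.
Qed.

Definition signed_sum b x : R := \sum_i b i * (-1) ^+ x i.

Lemma signed_sum_flip b i x :
  signed_sum b (flip i x) = signed_sum b x - 2 * (b i * (-1) ^+ x i).
Proof.
rewrite /signed_sum (bigD1 i)//= [in RHS](bigD1 i)//= ffunE eqxx.
rewrite (eq_bigr (fun j => b j * (-1) ^+ x j)) => [|j ji]; last first.
  by rewrite ffunE (negbTE ji).
by rewrite signrN; ring.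
Qed.

Lemma sum_flip i (f : {ffun I -> bool} -> R) : \sum_x f (flip i x) = \sum_x f x.
Proof.
rewrite [RHS](reindex_onto (flip i) (flip i))/=; last by move=> x _; rewrite flipK.
by apply: eq_bigl => x; rewrite flipK eqxx.
Qed.

(** Flipping the sign of index [j] shows that each mixed term is its own opposite. *)
Lemma sign_orthogonal b :
  \sum_x signed_sum b x ^+ 2 = #|{ffun I -> bool}|%:R * \sum_i b i ^+ 2.
Proof.
under eq_bigr do rewrite expr2 /signed_sum big_distrl/=.
rewrite exchange_big/= mulr_sumr; apply: eq_bigr => i _.
under eq_bigr do rewrite big_distrr/=.
rewrite exchange_big/= (bigD1 i)//= [X in _ + X]big1 => [|j ji].
  rewrite addr0 (eq_bigr (fun=> b i ^+ 2)) => [|x _].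
    by rewrite sumr_const mulr_natl.
  by rewrite mulrACA -!expr2 sqrr_sign mulr1.
set S := LHS; have : S = - S.
  rewrite {1}/S -(sum_flip j) -sumrN; apply: eq_bigr => x _.
  by rewrite !ffunE eqxx eq_sym (negbTE ji) signrN; ring.
by move=> h; lra.
Qed.

(** Flipping the sign of index [i] moves the signed sum by [2 * |b i|].  If two such
    flips both landed within [eta] of [y], then [|b i|] and [|b j|] would differ by at
    most [eta].  So each [x] has at most one neighbour, among the flips in [J], that
    counts in the sum; exchanging the two summations gives the factor [#|J|]. *)
Lemma sign_anticoncentration b (J : {set I}) (y eta : R) :
  (forall i j, i \in J -> j \in J -> i != j -> eta < `| `|b i| - `|b j| |) ->
  #|J|%:R * \sum_x (`|signed_sum b x - y| <= eta)%R%:R <= #|{ffun I -> bool}|%:R :> R.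
Proof.
move=> sep; pose f x : R := (`|signed_sum b x - y| <= eta)%R%:R.
have -> : #|J|%:R * \sum_x f x = \sum_x \sum_(i in J) f (flip i x).
  rewrite exchange_big/= [RHS](eq_bigr (fun=> \sum_x f x)) => [|i _]; last exact: sum_flip.
  by rewrite sumr_const mulr_natl.
rewrite -sum1_card natr_sum; apply: ler_sum => x _; rewrite -[1%:R]/1.
have [[i iJ fi]|nof] := pselect (exists2 i, i \in J & `|signed_sum b (flip i x) - y| <= eta).
  rewrite (bigD1 i)//= big1 ?addr0 => [|j /andP[jJ ji]]; first by rewrite /f fi.
  rewrite /f; case: (boolP (`|signed_sum b (flip j x) - y| <= eta)) => // fj; exfalso.
  have := sep i j iJ jJ; rewrite eq_sym => /(_ ji); apply/negP; rewrite -leNgt.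
  rewrite -(mulr1 `|b i|) -(mulr1 `|b j|) -[X in _ * X - _](normr_sign R (x i)).
  rewrite -[X in _ - _ * X](normr_sign R (x j)) -!normrM.
  apply: le_trans (ler_dist_dist _ _) _.
  have := ler_normB (signed_sum b (flip i x) - y) (signed_sum b (flip j x) - y).
  rewrite !signed_sum_flip in fi fj *; move: fi fj.
  set u := b i * _; set v := b j * _; set S := signed_sum b x => fi fj h.
  have : `|2 * (u - v)| <= eta + eta.
    rewrite -normrN; have -> : - (2 * (u - v)) = S - 2 * u - y - (S - 2 * v - y) by ring.
    by apply: le_trans h _; rewrite lerD.
  by rewrite normrM normr_nat; lra.
by rewrite big1 // => i iJ; rewrite /f; case: (boolP (`|signed_sum b (flip i x) - y| <= eta)) => // h; case: nof; exists i.
Qed.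

End Signs.

Section SymsumBounds.
Variable R : realFieldType.
Implicit Types (F : int -> R).

(** By induction on [N], telescoping with [2 / M - 2 / N]. *)
Lemma symsum_tail (M N : nat) : (0 < M)%N ->
  symsum N (fun m => if (M < `|m|)%N then (`|m|%N%:R : R) ^- 2 else 0) <= 2 / M%:R.
Proof.
move=> M0; have M0' : (0 : R) < M%:R by rewrite ltr0n.
suff H : symsum N (fun m => if (M < `|m|)%N then (`|m|%N%:R : R) ^- 2 else 0) <=
    (if (M <= N)%N then 2 / M%:R - 2 / N%:R else 0).
  apply: le_trans H _; case: ifP => _; last by rewrite divr_ge0.
  by rewrite lerBlDr lerDl divr_ge0.
elim: N => [|N IHN].
  by rewrite symsum0 absz0 ltn0; case: ifP => //; rewrite leqn0 => /eqP M00; rewrite M00 in M0.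
rewrite symsumS abszN !absz_nat; have [MN|NM] := leqP M N.
  have [E1 E2] : (M < N.+1)%N /\ (M <= N.+1)%N by rewrite ltnS MN leqW.
  rewrite E1 E2; rewrite MN in IHN.
  have N0 : (0 : R) < N%:R by rewrite ltr0n (leq_trans M0).
  rewrite -addrA [X in _ + X <= _]addrC addrA.
  have h : 2 * N.+1%:R ^- 2 <= 2 / N%:R - 2 / N.+1%:R :> R.
    rewrite -(natr1 N); have h1 : N%:R + 1 != 0 :> R by rewrite gt_eqF// addr_gt0.
    have -> : 2 / N%:R - 2 / (N%:R + 1) = 2 * (N%:R * (N%:R + 1))^-1 :> R.
      by field; rewrite h1 gt_eqF.
    rewrite ler_pM2l// lef_pV2 ?posrE ?exprn_gt0 ?mulr_gt0 ?addr_gt0// expr2.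
    by rewrite ler_pM2r ?addr_gt0// lerDl.
  apply: le_trans (lerD (_ : _ <= 2 / N%:R - 2 / N.+1%:R) IHN) _.
    by move: h; rewrite mulr_natl mulr2n.
  by rewrite addrC addrA subrK.
rewrite ltnS leqNgt NM/= add0r addr0.
move: IHN; rewrite leqNgt NM/= => /le_trans; apply; case: ifP => // MN.
have -> : M = N.+1 by lia.
by rewrite subrr.
Qed.

Lemma symsum_block (M N : nat) F (c : R) : (M <= N)%N ->
  (forall m : int, (M < `|m|)%N -> `|F m| <= c) ->
  `|symsum N F - symsum M F| <= 2 * (N%:R - M%:R) * c.
Proof.
move=> MN Fc; elim: N MN => [|N IHN].
  by rewrite leqn0 => /eqP->; rewrite !subrr normr0 mulr0 mul0r.
rewrite leq_eqVlt ltnS => /predU1P[->|MN]; first by rewrite !subrr normr0 mulr0 mul0r.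
have c1 := Fc N.+1%:Z; have c2 := Fc (- N.+1%:Z).
rewrite abszN in c2; rewrite symsumS.
have -> : F (- N.+1%:Z) + symsum N F + F N.+1%:Z - symsum M F =
  (symsum N F - symsum M F) + (F (- N.+1%:Z) + F N.+1%:Z) by ring.
apply: le_trans (ler_normD _ _) _; rewrite -(natr1 N).
have := ler_normD (F (- N.+1%:Z)) (F N.+1%:Z); have := IHN MN.
have := c1 MN; have := c2 MN.
by lra.
Qed.

End SymsumBounds.

(** * The joint law of the signs and of the uniform variable *)

Definition pattern (N : nat) := {ffun 'I_(2 * N).+1 -> bool}.

Definition pattern_sign (R : realType) (N : nat) (x : pattern N) (m : int) : R :=
  (-1) ^+ x (inord (absz (m + N%:Z))).

Lemma pattern_sign_ord (R : realType) N (x : pattern N) (i : 'I_(2 * N).+1) :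
  pattern_sign R x (i%:Z - N%:Z) = (-1) ^+ x i.
Proof. by rewrite /pattern_sign subrK absz_nat inord_val. Qed.

Section JointLaw.
Context (R : realType) (d : measure_display) (T : measurableType d).
Variables (P : probability T R) (X : int -> {RV P >-> R}) (theta : {RV P >-> R}).
Hypotheses (X_rademacher : forall m, rademacher (X m))
    (X_independent : mutually_independent X)
    (theta_uniform : uniform01 theta)
    (theta_independent : independent_of_family theta X).

Lemma measurable_RV (Y : {RV P >-> R}) (B : set R) : measurable B -> measurable (Y @^-1` B).
Proof. by move=> mB; rewrite -[X in measurable X]setTI; exact: measurable_funP. Qed.

Lemma pr_theta B : measurable B -> pr P (theta @^-1` B) = pr (unif R) B.
Proof. by move=> mB; congr fine; exact: theta_uniform mB. Qed.

(** The laws of [theta] and of the signs constrain their values only almost surely;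
    outside this null event the constraints hold pointwise. *)
Definition degenerate : set T :=
  (theta @^-1` (~` `[0, 1])) `|` \bigcup_n
    ((X n%:Z @^-1` (~` ([set 1] `|` [set -1]))) `|` (X (- n%:Z) @^-1` (~` ([set 1] `|` [set -1])))).

Lemma measurable_pm1 : measurable ([set 1] `|` [set -1] : set R).
Proof. exact: measurableU. Qed.

Lemma measurable_degenerate : measurable degenerate.
Proof.
apply: measurableU; first by apply: measurable_RV; exact: measurableC.
apply: bigcup_measurable => n _.
by apply: measurableU; apply: measurable_RV; apply: measurableC; exact: measurable_pm1.
Qed.

Lemma not_degenerate_theta w : ~ degenerate w -> 0 <= theta w <= 1.
Proof.
move=> h; have : `[0, 1]%classic (theta w) by apply: contrapT => h2; apply: h; left.
by rewrite /= in_itv.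
Qed.

Lemma not_degenerate_sign w m : ~ degenerate w -> X m w = 1 \/ X m w = -1.
Proof.
move=> h; apply: contrapT => h2; apply: h; right.
case: m h2 => n h2; first by exists n => //; left.
by exists n.+1 => //; right; rewrite -NegzE.
Qed.

Lemma pr_sign m : pr P (X m @^-1` [set 1]) = 2^-1 /\ pr P (X m @^-1` [set -1]) = 2^-1.
Proof. by rewrite /pr; have [-> ->] := X_rademacher m. Qed.

Lemma pr_not_sign m : pr P (X m @^-1` (~` ([set 1] `|` [set -1]))) = 0.
Proof.
have mX (B : set R) : measurable B -> measurable (X m @^-1` B) by exact: measurable_RV.
rewrite -preimage_setC pr_setC; last by apply: mX; exact: measurable_pm1.
rewrite preimage_setU; apply/eqP; rewrite subr_eq0 eq_sym; apply/eqP.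
have -> : pr P (X m @^-1` [set 1] `|` X m @^-1` [set -1]) =
    pr P (X m @^-1` [set 1]) + pr P (X m @^-1` [set -1]).
  rewrite /pr -fineD ?fin_num_measure//; try exact: mX.
  congr fine; apply: measureU; [exact: mX|exact: mX|].
  rewrite -preimage_setI (_ : [set 1] `&` [set -1] = set0) ?preimage_set0//.
  by apply/seteqP; split => // r [/= -> h]; have := ltrN10 R; rewrite -h ltr10.
by have [-> ->] := pr_sign m; lra.
Qed.

Lemma pr_degenerate : pr P degenerate = 0.
Proof.
apply/eqP; rewrite eq_le pr_ge0 andbT.
have m1 : measurable (theta @^-1` (~` `[0, 1])) by apply: measurable_RV; exact: measurableC.
have m2 n : measurable ((X n%:Z @^-1` (~` ([set 1] `|` [set -1]))) `|`
    (X (- n%:Z) @^-1` (~` ([set 1] `|` [set -1])))).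
  by apply: measurableU; apply: measurable_RV; apply: measurableC; exact: measurable_pm1.
apply: le_trans (pr_setU _ m1 _) _; first exact: bigcup_measurable.
rewrite pr_theta; last exact: measurableC.
rewrite [X in X + _](_ : _ = 0); last first.
  rewrite /pr unifE ?setICl ?measure0//; exact: measurableC.
rewrite add0r; apply: pr_bigcup => // n; rewrite big1// => k _.
apply/eqP; rewrite eq_le pr_ge0 andbT.
apply: le_trans (pr_setU _ _ _) _; rewrite ?pr_not_sign ?addr0//.
all: by apply: measurable_RV; apply: measurableC; exact: measurable_pm1.
Qed.

(** The event that the signs follow the pattern [x] on the window [|m| <= N], as an
    intersection over a list of integers to match the definition of mutual
    independence. *)
Definition cylinder N (x : pattern N) : set T :=
  \bigcap_(m in [set` [seq (nat_of_ord i)%:Z - N%:Z | i <- enum 'I_(2 * N).+1]])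
    X m @^-1` [set pattern_sign R x m].

Lemma measurable_cylinder N (x : pattern N) : measurable (cylinder x).
Proof.
by apply: fin_bigcap_measurable => // m _; exact: measurable_RV.
Qed.

Lemma sigma_family_cylinder N (x : pattern N) : sigma_family X (cylinder x).
Proof.
pose GG := \bigcup_m preimage_set_system setT (X m) measurable.
have : @measurable _ (g_sigma_algebraType GG) (cylinder x).
  apply: fin_bigcap_measurable => // m _; apply: sub_sigma_algebra; exists m => //.
  by exists [set pattern_sign R x m] => //; rewrite setTI.
by [].
Qed.

Lemma pr_cylinder N (x : pattern N) : pr P (cylinder x) = (2 ^+ (2 * N).+1)^-1.
Proof.
rewrite /pr X_independent => [||m]; last exact: measurable_set1.
  rewrite big_map big_enum/= (eq_bigr (fun=> (2^-1)%:E)) => [|i _].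
    by rewrite prodEFin/= prodr_const card_ord exprVn.
  rewrite pattern_sign_ord; have [h1 h2] := X_rademacher (i%:Z - N%:Z).
  by case: (x i); rewrite ?expr0 ?expr1.
by rewrite map_inj_uniq ?enum_uniq// => i j /(addIr _) [] /val_inj.
Qed.

Lemma pr_cylinder_theta N (x : pattern N) (B : set R) : measurable B ->
  pr P (cylinder x `&` theta @^-1` B) = (2 ^+ (2 * N).+1)^-1 * pr (unif R) B.
Proof.
move=> mB; rewrite /pr theta_independent//; last exact: sigma_family_cylinder.
rewrite fineM ?fin_num_measure//; first last.
- exact: measurable_RV.
- exact: measurable_cylinder.
by congr (_ * _); [exact: pr_cylinder | exact: pr_theta].
Qed.

Lemma exists_cylinder N w : ~ degenerate w -> exists x : pattern N,
  forall m : int, (`|m| <= N)%N -> X m w = pattern_sign R x m.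
Proof.
move=> h; exists [ffun i : 'I_(2 * N).+1 => X (i%:Z - N%:Z) w == -1] => m mN.
pose i : 'I_(2 * N).+1 := inord (absz (m + N%:Z)).
have -> : m = i%:Z - N%:Z by rewrite /i inordK; lia.
rewrite pattern_sign_ord ffunE.
have [->|->] := not_degenerate_sign (i%:Z - N%:Z) h.
  by rewrite gt_eqF//; lra.
by rewrite eqxx expr1.
Qed.

(** On each of the [2 ^ (2 N + 1)] equally likely patterns, [theta] is still uniform;
    the event is covered, up to a null set, by the pieces on which [theta] lies in
    [B x]. *)
Lemma pr_joint_le N (E : set T) (B : pattern N -> set R) :
  measurable E -> (forall x, measurable (B x)) ->
  (forall w x, (forall m : int, (`|m| <= N)%N -> X m w = pattern_sign R x m) ->
     0 <= theta w <= 1 -> E w -> B x (theta w)) ->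
  pr P E <= (2 ^+ (2 * N).+1)^-1 * \sum_x pr (unif R) (B x).
Proof.
move=> mE mB EB; rewrite mulr_sumr.
under eq_bigr => x _ do rewrite -(pr_cylinder_theta x (mB x)).
have mC x : measurable (cylinder x `&` theta @^-1` B x).
  by apply: measurableI; [exact: measurable_cylinder | exact: measurable_RV].
have mU : measurable (\big[setU/set0]_x (cylinder x `&` theta @^-1` B x)).
  by apply: bigsetU_measurable.
apply: le_trans (_ : pr P (\big[setU/set0]_x (cylinder x `&` theta @^-1` B x)) <= _).
  rewrite -[leRHS]addr0 -pr_degenerate; apply: pr_le_setU => //; first exact: measurable_degenerate.
  move=> w Ew; have [wd|wd] := pselect (degenerate w); first by right.
  left; have [x xw] := exists_cylinder N wd; rewrite -bigcup_seq.
  exists x; first by rewrite /= mem_index_enum.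
  split; last by apply: EB => //; exact: not_degenerate_theta.
  by move=> m /= /mapP[i _ ->]; apply: xw; have := ltn_ord i; lia.
have H (r : seq (pattern N)) : measurable (\big[setU/set0]_(x <- r) (cylinder x `&` theta @^-1` B x)) /\
    pr P (\big[setU/set0]_(x <- r) (cylinder x `&` theta @^-1` B x)) <=
    \sum_(x <- r) pr P (cylinder x `&` theta @^-1` B x).
  elim: r => [|x r [mA h]]; first by rewrite !big_nil /pr measure0.
  rewrite !big_cons; split; first exact: measurableU.
  by apply: le_trans (pr_setU _ _ _) _ => //; rewrite lerD2l.
by have [] := H (index_enum (pattern N)).
Qed.

(** The previous bound applied to the complements. *)
Lemma pr_joint_ge N (E : set T) (B : pattern N -> set R) :
  measurable E -> (forall x, measurable (B x)) ->
  (forall w x, (forall m : int, (`|m| <= N)%N -> X m w = pattern_sign R x m) ->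
     0 <= theta w <= 1 -> B x (theta w) -> E w) ->
  (2 ^+ (2 * N).+1)^-1 * \sum_x pr (unif R) (B x) <= pr P E.
Proof.
move=> mE mB BE.
have := @pr_joint_le N (~` E) (fun x => ~` B x) (measurableC mE)
  (fun x => measurableC (mB x)).
rewrite (pr_setC P mE); under eq_bigr => x _ do rewrite (pr_setC (unif R) (mB x)).
have E1 : (2 ^+ (2 * N).+1)^-1 * (1 *+ #|pattern N|) = 1 :> R.
  have p0 : (2 ^+ (2 * N).+1 : R) != 0 by rewrite expf_neq0// pnatr_eq0.
  by rewrite card_ffun card_bool card_ord natrX mulVf.
rewrite sumrB sumr_const mulrBr E1.
move=> H; rewrite -lerN2 -(lerD2l 1); apply: H => w x xw th nE Bx.
by apply: nE; exact: BE xw th Bx.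
Qed.

End JointLaw.

(** * Almost sure convergence of the random series *)

(** Telescoping: [r ^ -2 <= (r - 1/2) ^ -1 - (r + 1/2) ^ -1]. *)
Lemma sum_inv_sqr_le (R : realFieldType) (n k : nat) : (0 < n)%N ->
  \sum_(i < k) ((n + i)%N%:R : R) ^- 2 <= 2 / n%:R.
Proof.
move=> n0; have n1 : (1 : R) <= n%:R by rewrite ler1n.
have H : \sum_(i < k) ((n + i)%N%:R : R) ^- 2 <=
    (n%:R - 1 / 2)^-1 - ((n + k)%N%:R - 1 / 2)^-1.
  elim: k => [|k IHk]; first by rewrite big_ord0 addn0 subrr.
  rewrite big_ord_recr/= addnS; apply: le_trans (lerD IHk (lexx _)) _.
  have : (n%:R : R) <= (n + k)%N%:R by rewrite ler_nat leq_addr.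
  rewrite -(natr1 (n + k)); move: ((n + k)%N%:R) => r nr {IHk}.
  have rE : r = (r - 1 / 2) + 1 / 2 by ring.
  have x0 : 0 < r - 1 / 2 by lra.
  move: (r - 1 / 2) x0 rE => x x0 ->.
  have -> : x + 1 / 2 + 1 - 1 / 2 = x + 1 by ring.
  rewrite -addrA lerD2l.
  have -> : - (x + 1)^-1 = - x^-1 + (x * (x + 1))^-1.
    by field; rewrite !gt_eqF//; lra.
  rewrite lerD2l lef_pV2 ?posrE ?mulr_gt0 ?exprn_gt0//; nra.
apply: le_trans H _; apply: le_trans (_ : (n%:R - 1 / 2)^-1 <= _).
  rewrite lerBlDr lerDl invr_ge0 natrD; have : (0 : R) <= k%:R by []; lra.
rewrite -[leLHS]mul1r ler_pdivrMr; last by lra.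
by rewrite mulrAC ler_pdivlMr; lra.
Qed.

Lemma measurable_abs_gt (R : realType) (d : measure_display) (T : measurableType d)
    (g : T -> R) (a : R) : measurable_fun setT g ->
  measurable [set w | a < `|g w|].
Proof.
move=> mg; rewrite (_ : [set w | _] = setT `&` (fun w => `|g w|) @^-1` `]a, +oo[%classic).
  have mn : measurable_fun setT (fun w => `|g w|) by apply: measurableT_comp.
  by apply: mn => //; exact: measurable_itv.
by rewrite setTI; apply/seteqP; split => w /=; rewrite in_itv/= andbT.
Qed.

Lemma measurable_abs_le (R : realType) (d : measure_display) (T : measurableType d)
    (g : T -> R) (a : R) : measurable_fun setT g -> measurable [set w | `|g w| <= a].
Proof.
move=> mg; rewrite (_ : [set w | _] = ~` [set w | a < `|g w|]).
  by apply: measurableC; exact: measurable_abs_gt.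
by apply/seteqP; split => w /=; rewrite leNgt => /negP.
Qed.

Section RandomSeries.
Context (R : realType) (d : measure_display) (T : measurableType d).
Variables (P : probability T R) (X : int -> {RV P >-> R}) (theta : {RV P >-> R}).
Hypotheses (X_rademacher : forall m, rademacher (X m))
    (X_independent : mutually_independent X)
    (theta_uniform : uniform01 theta)
    (theta_independent : independent_of_family theta X).
(** The series with real coefficients [gamma] stands for the real and for the
    imaginary part of the process. *)
Variable gamma : int -> R -> R.
Hypotheses (mgamma : forall m, measurable_fun setT (gamma m))
  (gamma_le : forall m s, 0 <= s <= 1 -> (2 <= `|m|)%N -> `|gamma m s| <= `|m|%N%:R^-1).

Definition partial (N : nat) (w : T) : R :=
  symsum N (fun m => gamma m (theta w) * X m w).

Lemma measurable_partial N : measurable_fun setT (partial N).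
Proof.
apply: measurable_sum => i; apply: measurable_funM; last exact: measurable_funP.
by apply: measurableT_comp; [exact: mgamma | exact: measurable_funP].
Qed.

Definition jump (M N : nat) (a : R) : set T :=
  [set w | 0 <= theta w <= 1 /\ a < `|partial N w - partial M w|].

Lemma measurable_jump M N a : measurable (jump M N a).
Proof.
rewrite (_ : jump M N a = theta @^-1` `[0, 1]%classic `&` [set w | a < `|partial N w - partial M w|]).
  apply: measurableI; first exact: measurable_RV.
  by apply: measurable_abs_gt; apply: measurable_funB; exact: measurable_partial.
by apply/seteqP; split => w /=; rewrite in_itv/=.
Qed.

(** For each value of [theta], the second moment of the difference is at most the sum
    of [1 / m ^ 2] over [|m| > M]; Chebyshev's inequality does the rest. *)
Lemma pr_jump M N a : (0 < M)%N -> (M <= N)%N -> 0 < a ->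
  pr P (jump M N a) <= 2 / M%:R / a ^+ 2.
Proof.
move=> M0 MN a0.
pose b (i : 'I_(2 * N).+1) s : R :=
  if (M < `|i%:Z - N%:Z|)%N then gamma (i%:Z - N%:Z) s else 0.
pose W := pattern N.
have mb i : measurable_fun setT (b i).
  by rewrite /b; case: (M < _)%N; [exact: mgamma | exact: measurable_cst].
have b2 s : `[0, 1]%classic s -> \sum_i b i s ^+ 2 <= 2 / M%:R.
  rewrite /= in_itv/= => s01; apply: le_trans (symsum_tail R N M0).
  apply: ler_sum => i _; rewrite /b; case: ifP => [Mi|_]; last by rewrite expr0n.
  rewrite -[leLHS]real_normK ?num_real// -exprVn; apply: lerXn2r.
  - by rewrite nnegrE.
  - by rewrite nnegrE invr_ge0.
  - by apply: gamma_le => //; apply: leq_ltn_trans Mi.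
have orth (beta : 'I_(2 * N).+1 -> R) :
    \sum_(x : W) (\sum_i beta i * (-1) ^+ x i) ^+ 2 <= #|W|%:R * \sum_i beta i ^+ 2.
  by have := sign_orthogonal beta; rewrite /signed_sum => ->.
have V0 : (0 : R) <= 2 / M%:R by rewrite divr_ge0.
have H := @pr_chebyshev R _ _ (unif R) W _ (fun i x => (-1) ^+ x i)
   #|W|%:R `[0, 1]%classic b (2 / M%:R) a orth (ler0n _ _) (measurable_itv _) mb V0 a0 b2.
have W2 : (#|W|%:R : R) = 2 ^+ (2 * N).+1.
  by rewrite card_ffun card_bool card_ord natrX.
have p2 : (0 : R) < 2 ^+ (2 * N).+1 by rewrite exprn_gt0.
apply: le_trans (@pr_joint_le _ _ _ P X theta _ _ _ _ N _ (fun x => `[0, 1]%classic `&`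
   [set s | a < `|\sum_i b i s * (-1) ^+ x i|]) _ _ _) _ => //.
- exact: measurable_jump.
- move=> x; apply: measurableI; first exact: measurable_itv.
  apply: measurable_abs_gt; apply: measurable_sum => i.
  by apply: measurable_funM => //; exact: measurable_cst.
- move=> w x xw th [_ aw]; split; first by rewrite /= in_itv.
  move: aw; rewrite /partial (symsum_split _ MN) addrC addKr /symsum.
  congr (a < `|_|); apply: eq_bigr => i _; rewrite /b.
  case: ifP => _; last by rewrite mul0r.
  by rewrite xw ?pattern_sign_ord//; have := ltn_ord i; lia.
rewrite ler_pdivrMl// mulrA; move: H; rewrite -W2 => /le_trans; apply.
by rewrite -!mulrA.
Qed.

Lemma partial_dist w M N : ~ degenerate X theta w -> (1 <= M)%N -> (M <= N)%N ->
  `|partial N w - partial M w| <= 2 * (N%:R - M%:R) / M%:R.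
Proof.
move=> wd M1 MN; apply: symsum_block => // m Mm.
rewrite normrM; have [->|->] := not_degenerate_sign m wd.
all: rewrite ?normrN normr1 mulr1.
all: apply: le_trans (gamma_le _ _) _; first exact: not_degenerate_theta wd.
all: try exact: leq_ltn_trans Mm.
all: by rewrite lef_pV2 ?posrE ?ltr0n ?ler_nat ?(ltnW Mm)// (leq_trans _ Mm).
Qed.

(** Outside this event the partial sums converge along the sixth powers at rate
    [\sum_(k >= n) k ^ -2].  With the exponent [6], [pr_jump] bounds the probability of
    the [k]-th jump by [2 / k ^ 6 / (k ^ -2) ^ 2 = 2 / k ^ 2], which is summable. *)
Definition exceptional n : set T := degenerate X theta `|`
  \bigcup_k jump ((n + k) ^ 6) ((n + k).+1 ^ 6) ((n + k)%N%:R ^- 2).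

Lemma measurable_exceptional n : measurable (exceptional n).
Proof.
apply: measurableU; first exact: measurable_degenerate.
by apply: bigcup_measurable => k _; exact: measurable_jump.
Qed.

Lemma pr_exceptional n : (0 < n)%N -> pr P (exceptional n) <= 4 / n%:R.
Proof.
move=> n0.
have mj k : measurable (jump ((n + k) ^ 6) ((n + k).+1 ^ 6) ((n + k)%N%:R ^- 2)).
  exact: measurable_jump.
apply: le_trans (pr_setU _ (measurable_degenerate _ _) _) _.
  exact: bigcup_measurable.
rewrite pr_degenerate// add0r; apply: pr_bigcup => // K.
apply: le_trans (_ : \sum_(k < K) 2 * ((n + k)%N%:R ^- 2) <= _); last first.
  rewrite -mulr_sumr; have := sum_inv_sqr_le R K n0; lra.
apply: ler_sum => k _.
have nk : (0 < n + k)%N by rewrite ltn_addr.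
have nk' : (0 : R) < (n + k)%N%:R by rewrite ltr0n.
apply: le_trans (pr_jump _ _ _) _; rewrite ?expn_gt0 ?nk// ?leq_exp2r// ?invr_gt0 ?exprn_gt0//.
have nz : ((n + k)%N%:R : R) != 0 by rewrite gt_eqF.
rewrite natrX; move: ((n + k)%N%:R) nz => r r0.
have -> : 2 / r ^+ 6 / r ^- 2 ^+ 2 = 2 / r ^+ 2 by field.
by [].
Qed.

(** [63] is the sum [6 + 15 + 20 + 15 + 6 + 1] of the binomial coefficients that
    survive in [(k + 1) ^ 6 - k ^ 6]. *)
Lemma sixth_power_gap (k : nat) : (0 < k)%N ->
  ((k.+1 ^ 6)%N%:R - (k ^ 6)%N%:R) / (k ^ 6)%N%:R <= 63 / k%:R :> R.
Proof.
move=> k0; have k1 : (1 : R) <= k%:R by rewrite ler1n.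
have kz : (k%:R : R) != 0 by rewrite gt_eqF//; lra.
rewrite !natrX -(natr1 k); move: (k%:R) k1 kz => r r1 r0.
rewrite ler_pdivrMr ?exprn_gt0//; last by lra.
have -> : 63 / r * r ^+ 6 = 63 * r ^+ 5 by field.
have -> : (r + 1) ^+ 6 - r ^+ 6 = 6 * r ^+ 5 + 15 * r ^+ 4 + 20 * r ^+ 3 + 15 * r ^+ 2 + 6 * r + 1 by ring.
have p4 : r ^+ 4 <= r ^+ 5 by apply: ler_weXn2l.
have p3 : r ^+ 3 <= r ^+ 5 by apply: ler_weXn2l.
have p2 : r ^+ 2 <= r ^+ 5 by apply: ler_weXn2l.
have p1 : r <= r ^+ 5 by rewrite -{1}(expr1 r); apply: ler_weXn2l.
have p0 : 1 <= r ^+ 5 by apply: exprn_ege1.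
lra.
Qed.

(** Between consecutive sixth powers the coefficients are bounded term by term, which
    costs [2 * 63 / k] by [sixth_power_gap]; the jumps between sixth powers add up
    to at most [2 / k]. *)
Lemma not_exceptional_cauchy n w : (0 < n)%N -> ~ exceptional n w ->
  forall k N, (n <= k)%N -> (k ^ 6 <= N)%N ->
  `|partial N w - partial (k ^ 6) w| <= 128 / k%:R.
Proof.
move=> n0 wb k N nk kN; have k0 : (0 < k)%N by apply: leq_trans nk.
have wd : ~ degenerate X theta w by move=> h; apply: wb; left.
have step j : (n <= j)%N -> `|partial (j.+1 ^ 6) w - partial (j ^ 6) w| <= j%:R ^- 2.
  move=> nj; rewrite leNgt; apply/negP => h; apply: wb; right.
  exists (j - n)%N => //; rewrite subnKC//; split => //.
  exact: not_degenerate_theta wd.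
have run j : `|partial ((k + j) ^ 6) w - partial (k ^ 6) w| <= 2 / k%:R.
  apply: le_trans (sum_inv_sqr_le R j k0).
  elim: j => [|j IHj]; first by rewrite addn0 subrr normr0 big_ord0.
  rewrite big_ord_recr/= addnS.
  have -> : partial ((k + j).+1 ^ 6) w - partial (k ^ 6) w =
     (partial ((k + j) ^ 6) w - partial (k ^ 6) w) +
     (partial ((k + j).+1 ^ 6) w - partial ((k + j) ^ 6) w) by ring.
  apply: le_trans (ler_normD _ _) _; apply: lerD => //.
  by apply: step; rewrite (leq_trans nk) ?leq_addr.
have [j jN1 jN2] : exists2 j, ((k + j) ^ 6 <= N)%N & (N <= (k + j).+1 ^ 6)%N.
  have ex : exists j, ((k + j) ^ 6 <= N)%N by exists 0%N; rewrite addn0.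
  have bd j : ((k + j) ^ 6 <= N)%N -> (j <= N)%N.
    move=> h; apply: leq_trans h; apply: leq_trans (leq_addl k j) _.
    by rewrite -{1}(expn1 (k + j)) leq_pexp2l// addn_gt0 k0.
  case: (ex_maxnP ex bd) => j jN jmax; exists j => //.
  rewrite -addnS leqNgt; apply/negP => /ltnW /jmax; by rewrite ltnn.
have -> : partial N w - partial (k ^ 6) w =
  (partial N w - partial ((k + j) ^ 6) w) + (partial ((k + j) ^ 6) w - partial (k ^ 6) w).
  by ring.
apply: le_trans (ler_normD _ _) _.
have kj0 : (0 < k + j)%N by rewrite addn_gt0 k0.
have h1 : `|partial N w - partial ((k + j) ^ 6) w| <= 126 / k%:R.
  apply: le_trans (partial_dist wd _ jN1) _; first by rewrite expn_gt0 kj0.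
  apply: le_trans (_ : 2 * (63 / (k + j)%N%:R) <= _).
    rewrite -mulrA ler_pM2l//; apply: le_trans (sixth_power_gap kj0).
    rewrite ler_pM2r ?invr_gt0 ?ltr0n ?expn_gt0 ?kj0// lerD2r.
    by rewrite ler_nat.
  have : (k + j)%N%:R^-1 <= k%:R^-1 :> R.
    by rewrite lef_pV2 ?posrE ?ltr0n// ler_nat leq_addr.
  by lra.
have := run j; lra.
Qed.

End RandomSeries.

(** * Measurability of the coefficients and of convergence *)

Section MeasurableCoefficients.
Variable R : realType.
Local Notation normc := (@Normc.normc R).

Lemma measurable_invr : measurable_fun setT (fun x : R => x^-1).
Proof.
have m0 : measurable (~` [set 0] : set R) by apply: measurableC; exact: measurable_set1.
rewrite -(setUv [set (0 : R)]) measurable_funU//; split.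
  exact: measurable_fun_set1.
apply: open_continuous_measurable_fun; first by apply: closed_openC; exact: closed_eq.
by move=> x; rewrite inE => x0; apply: inv_continuous; exact/eqP.
Qed.

Definition reG (m : int) (s : R) : R := complex.Re (Gcoef m s).
Definition imG (m : int) (s : R) : R := complex.Im (Gcoef m s).

Lemma measurable_piecewise (m : int) (c : R) (num : R -> R) : continuous num ->
  measurable_fun setT (fun s : R => if s == m%:~R then c else num s / (2 * pi * (m%:~R - s))).
Proof.
move=> cn; apply: measurable_fun_ifT => //.
  exact: measurable_fun_eqr.
apply: measurable_funM; first exact: continuous_measurable_fun.
apply: (measurableT_comp measurable_invr).
apply: continuous_measurable_fun => x.
apply: cvgM; first exact: cvg_cst.
by apply: cvgB; [exact: cvg_cst | exact: cvg_id].
Qed.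

Lemma continuous_sin2pi : continuous (fun s : R => sin (2 * pi * s)).
Proof.
move=> x; apply: (@continuous_comp _ _ _ (fun s => 2 * pi * s) sin); last exact: continuous_sin.
by apply: cvgM; [exact: cvg_cst | exact: cvg_id].
Qed.

Lemma continuous_cos2pi : continuous (fun s : R => cos (2 * pi * s)).
Proof.
move=> x; apply: (@continuous_comp _ _ _ (fun s => 2 * pi * s) cos); last exact: continuous_cos.
by apply: cvgM; [exact: cvg_cst | exact: cvg_id].
Qed.

Lemma reGE m s : reG m s = if s == m%:~R then -1 else sin (2 * pi * s) / (2 * pi * (m%:~R - s)).
Proof. by rewrite /reG; case: (eqVneq s) => [->|h]; [rewrite /Gcoef eqxx | rewrite GcoefE]. Qed.

Lemma imGE m s : imG m s = if s == m%:~R then 0 else (1 - cos (2 * pi * s)) / (2 * pi * (m%:~R - s)).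
Proof.
by rewrite /imG; case: (eqVneq s) => [->|h]; [rewrite /Gcoef eqxx /= oppr0 | rewrite GcoefE].
Qed.

Lemma measurable_reG m : measurable_fun setT (reG m).
Proof.
rewrite (funext (reGE m)); apply: measurable_piecewise; exact: continuous_sin2pi.
Qed.

Lemma measurable_imG m : measurable_fun setT (imG m).
Proof.
rewrite (funext (imGE m)).
apply: (@measurable_piecewise _ _ (fun s => 1 - cos (2 * pi * s))) => x.
by apply: cvgB; [exact: cvg_cst | exact: continuous_cos2pi].
Qed.

Lemma reG_le m s : 0 <= s <= 1 -> (2 <= `|m|)%N -> `|reG m s| <= `|m|%N%:R^-1.
Proof. by move=> s01 m2; apply: le_trans (normc_ge_Re _) (normc_Gcoef_le s01 m2). Qed.

Lemma imG_le m s : 0 <= s <= 1 -> (2 <= `|m|)%N -> `|imG m s| <= `|m|%N%:R^-1.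
Proof. by move=> s01 m2; apply: le_trans (normc_ge_Im _) (normc_Gcoef_le s01 m2). Qed.

Lemma normc_le_ReIm (z : R[i]) : normc z <= `|complex.Re z| + `|complex.Im z|.
Proof.
case: z => a b /=; rewrite -[leRHS]ger0_norm ?addr_ge0// -sqrtr_sqr ler_sqrt ?sqr_ge0//.
rewrite sqrrD !real_normK ?num_real// -addrA lerD2l addrC lerDl.
by rewrite mulrn_wge0// mulr_ge0.
Qed.

Lemma normC_normc (z : R[i]) : `|z| = (normc z)%:C.
Proof. by rewrite normc_def; case: z. Qed.

(** From right to left this computes [G] where the series converges; from left to
    right it shows that [G] takes its default value where the real or the imaginary
    parts of the partial sums diverge. *)
Lemma cvg_complexP (u : nat -> R[i]^o) (l : R[i]) :
  u @ \oo --> (l : R[i]^o) <->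
  ((fun n => complex.Re (u n)) @ \oo --> complex.Re l /\
   (fun n => complex.Im (u n)) @ \oo --> complex.Im l).
Proof.
split=> [/cvgrPdist_le H|[/cvgrPdist_le Hr /cvgrPdist_le Hi]].
  split; apply/cvgrPdist_le => eps eps0.
    have e0 : 0 < eps%:C :> R[i] by rewrite ltcR.
    apply: filterS (H _ e0) => n; rewrite normC_normc lecR; apply: le_trans.
    by rewrite -raddfB; exact: normc_ge_Re.
  have e0 : 0 < eps%:C :> R[i] by rewrite ltcR.
  apply: filterS (H _ e0) => n; rewrite normC_normc lecR; apply: le_trans.
  by rewrite -raddfB; exact: normc_ge_Im.
apply/cvgrPdist_le => eps; rewrite ltcE => /andP[/eqP e1 e2].
have epsE : eps = (complex.Re eps)%:C by move: e1; case: (eps) => a b /= ->.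
have e20 : 0 < complex.Re eps / 2 by rewrite divr_gt0.
apply: filterS2 (Hr _ e20) (Hi _ e20) => n h1 h2.
rewrite normC_normc epsE lecR; apply: le_trans (normc_le_ReIm _) _.
by rewrite !raddfB/= [leRHS]splitr lerD.
Qed.

End MeasurableCoefficients.

Section ConvergenceSet.
Context (R : realType) (d : measure_display) (T : measurableType d).

(** The set is described by the Cauchy criterion, a countable combination. *)
Lemma measurable_cvg_set (S : nat -> T -> R) : (forall n, measurable_fun setT (S n)) ->
  measurable [set w | cvg (S ^~ w @ \oo)].
Proof.
move=> mS.
have -> : [set w | cvg (S ^~ w @ \oo)] =
   \bigcap_k \bigcup_N \bigcap_n ~` [set w | k.+1%:R^-1 < `|S (N + n)%N w - S N w|].
  apply/seteqP; split => w /=.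
    move=> /cvg_ex[l /cvgrPdist_le Sl] k _.
    have k0 : (0 : R) < k.+1%:R^-1 / 2 by rewrite divr_gt0// invr_gt0.
    have [N _ HN] := Sl _ k0; exists N => // n _ /=; apply/negP; rewrite -leNgt.
    have h1 := HN N (leqnn N); have h2 := HN (N + n)%N (leq_addr n N).
    have -> : S (N + n)%N w - S N w = (l - S N w) - (l - S (N + n)%N w) by ring.
    by apply: le_trans (ler_normB _ _) _; rewrite [leRHS]splitr lerD.
  move=> H; apply: cauchy_cvg; apply: cauchy_exP => eps eps0.
  pose k := Num.bound eps^-1.
  have [N _ HN] := H k I; exists (S N w); exists N => // n /= Nn.
  have := HN (n - N)%N I; rewrite /= subnKC// => /negP; rewrite -leNgt => h.
  rewrite /ball/= distrC; apply: le_lt_trans h _.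
  rewrite invf_plt ?posrE//; apply: lt_le_trans (archi_boundP _) _.
    by rewrite invr_ge0 ltW.
  by rewrite ler_nat.
apply: bigcap_measurable => [|k _]; first by exists 0%N.
apply: bigcup_measurable => N _; apply: bigcap_measurable => [|n _]; first by exists 0%N.
by apply: measurableC; apply: measurable_abs_gt; apply: measurable_funB.
Qed.

End ConvergenceSet.

(** * The limit process *)

Lemma cauchy_rate_cvg (R : realType) (S : nat -> R) (n : nat) (K : R) (phi : nat -> nat) :
  0 <= K ->
  (forall k N, (n <= k)%N -> (phi k <= N)%N -> `|S N - S (phi k)| <= K / k%:R) ->
  cvg (S @ \oo) /\ forall k, (n <= k)%N -> `|lim (S @ \oo) - S (phi k)| <= K / k%:R.
Proof.
move=> K0 H.
have cS : cvg (S @ \oo).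
  apply: cauchy_cvg; apply: cauchy_exP => eps eps0.
  pose k := maxn n (Num.bound (K / eps)).+1.
  have k0 : (0 : R) < k%:R by rewrite ltr0n leq_max orbT.
  exists (S (phi k)); exists (phi k) => // N /= kN.
  rewrite /ball/= distrC; apply: le_lt_trans (H k N _ kN) _; first exact: leq_maxl.
  rewrite ltr_pdivrMr// mulrC -ltr_pdivrMr//.
  apply: lt_le_trans (archi_boundP _) _; first by rewrite divr_ge0// ltW.
  by rewrite ler_nat leq_max leqnSn orbT.
split=> // k nk; apply/ler_addgt0Pr => eps eps0.
have [N _ HN] := (cvgrPdist_le _ _).1 cS _ eps0.
have := HN (maxn N (phi k)) (leq_maxl _ _).
have := H k (maxn N (phi k)) nk (leq_maxr _ _).
set SN := S (maxn _ _) => h1 h2.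
have -> : lim (S @ \oo) - S (phi k) = (lim (S @ \oo) - SN) + (SN - S (phi k)) by ring.
by apply: le_trans (ler_normD _ _) _; rewrite addrC lerD.
Qed.

Section LimitProcess.
Context (R : realType) (d : measure_display) (T : measurableType d).
Variables (P : probability T R) (X : int -> {RV P >-> R}) (theta : {RV P >-> R}).
Hypotheses (X_rademacher : forall m, rademacher (X m))
    (X_independent : mutually_independent X)
    (theta_uniform : uniform01 theta)
    (theta_independent : independent_of_family theta X).

(** The random variable whose law is the limit, including its default value at the
    points where the series diverges. *)
Definition GX (w : T) : R[i] := G (fun m => X m w) (theta w).

Local Notation Gp w := (Gpartial (fun m => X m w) (theta w)).
Local Notation reS := (partial X theta (@reG R)).
Local Notation imS := (partial X theta (@imG R)).

Lemma Re_Gpartial w N : complex.Re (Gp w N) = reS N w.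
Proof.
rewrite /Gpartial /partial /symsum raddf_sum; apply: eq_bigr => i _ /=.
by rewrite /reG; case: (Gcoef _ _) => a b /=; rewrite mulr0 subr0.
Qed.

Lemma Im_Gpartial w N : complex.Im (Gp w N) = imS N w.
Proof.
rewrite /Gpartial /partial /symsum raddf_sum; apply: eq_bigr => i _ /=.
by rewrite /imG; case: (Gcoef _ _) => a b /=; rewrite mulr0 add0r.
Qed.

Definition cvg_set : set T :=
  [set w | cvg (reS ^~ w @ \oo)] `&` [set w | cvg (imS ^~ w @ \oo)].

Lemma measurable_cvg_set_G : measurable cvg_set.
Proof.
apply: measurableI; apply: measurable_cvg_set => n; apply: measurable_partial.
  exact: measurable_reG.
exact: measurable_imG.
Qed.

Lemma GX_cvg w : cvg_set w ->
  GX w = lim (reS ^~ w @ \oo) +i* lim (imS ^~ w @ \oo).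
Proof.
move=> [h1 h2]; rewrite /GX /G.
apply: (@cvg_lim (R[i]^o)); first exact: (@norm_hausdorff R[i] (R[i]^o)).
apply/cvg_complexP => /=; split.
  by rewrite (_ : (fun n => _) = reS ^~ w)//; apply/funext => n; rewrite Re_Gpartial.
by rewrite (_ : (fun n => _) = imS ^~ w)//; apply/funext => n; rewrite Im_Gpartial.
Qed.

Lemma GX_dvg w : ~ cvg_set w -> GX w = (point : R[i]^o).
Proof.
move=> h; rewrite /GX /G; apply: (@dvgP (R[i]^o)) => /cvg_ex[l /cvg_complexP[h1 h2]].
apply: h; split => /=.
  apply/cvg_ex; exists (complex.Re l).
  by rewrite (_ : reS ^~ w = fun n => complex.Re (Gp w n))//; apply/funext => n; rewrite Re_Gpartial.
apply/cvg_ex; exists (complex.Im l).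
by rewrite (_ : imS ^~ w = fun n => complex.Im (Gp w n))//; apply/funext => n; rewrite Im_Gpartial.
Qed.

(** Replacing each [S n] by the constant [c] outside [C] makes [g] a limit of
    measurable functions at every point. *)
Lemma measurable_lim_default (C : set T) (S : nat -> T -> R) (g : T -> R) (c : R) :
  measurable C -> (forall n, measurable_fun setT (S n)) ->
  (forall w, C w -> S ^~ w @ \oo --> g w) -> (forall w, ~ C w -> g w = c) ->
  measurable_fun setT g.
Proof.
move=> mC mS Sg gc.
apply: (@measurable_fun_cvg _ _ _ setT (fun n w => \1_C w * S n w + (1 - \1_C w) * c)).
  move=> n; have m1 : measurable_fun setT (\1_C : T -> R) by exact: measurable_indic.
  apply: measurable_funD; first exact: measurable_funM.
  apply: measurable_funM; last exact: measurable_cst.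
  by apply: measurable_funB.
move=> w _; have [Cw|nCw] := pselect (C w).
  rewrite indicE mem_set//= subrr mul0r.
  under eq_fun do rewrite mul1r addr0.
  exact: Sg.
rewrite gc// indicE memNset//= subr0 mul1r.
under eq_fun do rewrite mul0r add0r.
exact: cvg_cst.
Qed.

Lemma measurable_Re_GX : measurable_fun setT (fun w => complex.Re (GX w)).
Proof.
apply: (measurable_lim_default (S := reS) (c := complex.Re (point : R[i]^o)) measurable_cvg_set_G).
- by move=> n; apply: measurable_partial; exact: measurable_reG.
- by move=> w Cw; rewrite GX_cvg//=; case: Cw.
- by move=> w Cw; rewrite GX_dvg.
Qed.

Lemma measurable_Im_GX : measurable_fun setT (fun w => complex.Im (GX w)).
Proof.
apply: (measurable_lim_default (S := imS) (c := complex.Im (point : R[i]^o)) measurable_cvg_set_G).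
- by move=> n; apply: measurable_partial; exact: measurable_imG.
- by move=> w Cw; rewrite GX_cvg//=; case: Cw.
- by move=> w Cw; rewrite GX_dvg.
Qed.

Definition exceptionalG n : set T := exceptional X theta (@reG R) n `|` exceptional X theta (@imG R) n.

Lemma measurable_exceptionalG n : measurable (exceptionalG n).
Proof.
apply: measurableU; apply: measurable_exceptional; [exact: measurable_reG|exact: measurable_imG].
Qed.

Lemma pr_exceptionalG n : (0 < n)%N -> pr P (exceptionalG n) <= 8 / n%:R.
Proof.
move=> n0; apply: le_trans (pr_setU _ _ _) _.
- by apply: measurable_exceptional; exact: measurable_reG.
- by apply: measurable_exceptional; exact: measurable_imG.
have := pr_exceptional X_rademacher X_independent theta_uniform theta_independent
  (@measurable_reG R) (@reG_le R) n0.
have := pr_exceptional X_rademacher X_independent theta_uniform theta_independent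
  (@measurable_imG R) (@imG_le R) n0.
lra.
Qed.

(** Outside [exceptionalG n], the partial sums satisfy the Cauchy estimate of
    [not_exceptional_cauchy]; hence they converge at [w], and the limit inherits the
    estimate. *)
Lemma GX_approx n w : (0 < n)%N -> ~ exceptionalG n w ->
  `|complex.Re (GX w) - reS (n ^ 6) w| <= 128 / n%:R /\
  `|complex.Im (GX w) - imS (n ^ 6) w| <= 128 / n%:R.
Proof.
move=> n0 wb.
have b1 : ~ exceptional X theta (@reG R) n w by move=> h; apply: wb; left.
have b2 : ~ exceptional X theta (@imG R) n w by move=> h; apply: wb; right.
have [c1 l1] := @cauchy_rate_cvg R (reS ^~ w) n 128 (fun k => k ^ 6)%N (ler0n _ _)
  (not_exceptional_cauchy (@reG_le R) n0 b1).
have [c2 l2] := @cauchy_rate_cvg R (imS ^~ w) n 128 (fun k => k ^ 6)%N (ler0n _ _)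
  (not_exceptional_cauchy (@imG_le R) n0 b2).
by rewrite GX_cvg; [split => /=; [exact: l1|exact: l2] | split].
Qed.

End LimitProcess.

(** * Anti-concentration of the partial sums *)

Section SmallNumerator.
Variable R : realType.

Lemma unif_sin_zero : pr (unif R) [set s | sin (2 * pi * s) = 0] = 0.
Proof.
have mZ : measurable [set s : R | sin (2 * pi * s) = 0].
  rewrite (_ : [set s | _] = setT `&` (fun s => sin (2 * pi * s)) @^-1` [set 0]).
    by apply: (continuous_measurable_fun (@continuous_sin2pi R)) => //; exact: measurable_set1.
  by rewrite setTI.
apply/eqP; rewrite eq_le pr_ge0 andbT.
apply: le_trans (_ : pr (unif R) ([set 0] `|` [set 2^-1] `|` [set 1]) <= _).
  apply: unif_le => //; first by apply: measurableU => //; exact: measurableU.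
  move=> s /andP[s0 s1] /= sn.
  have [->|s0'] := eqVneq s 0; first by left; left.
  have [->|s2] := eqVneq s 2^-1; first by left; right.
  have [->|s1'] := eqVneq s 1; first by right.
  exfalso; have v0 : 2 * s - 1 != 0.
    by apply: contra_neq s2 => h; lra.
  have s0'' : 0 < s by rewrite lt_neqAle eq_sym s0'.
  have s1'' : s < 1 by rewrite lt_neqAle s1'.
  have v1 : `|2 * s - 1| < 1 by rewrite ltr_norml; lra.
  have := sin_pi_neq0 v0 v1; rewrite mulrBr mulr1 sinB sinpi mulr0 subr0 cospi.
  by rewrite mulrCA mulrA sn mul0r eqxx.
have u1 (r : R) : pr (unif R) [set r] = 0.
  rewrite /pr unifE// countable_lebesgue_measure0//.
  apply: sub_countable (countable1 r); apply: subset_card_le; exact: subIsetl.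
apply: le_trans (pr_setU _ _ _) _ => //; first exact: measurableU.
rewrite u1 addr0; apply: le_trans (pr_setU _ _ _) _ => //.
by rewrite !u1 addr0.
Qed.

(** The sets where [|num| <= 1 / (n + 1)] decrease to the zero set of [num], which is
    null. *)
Lemma unif_small_values (num : R -> R) (eps : R) : measurable_fun setT num ->
  (forall s, num s = 0 -> sin (2 * pi * s) = 0) -> 0 < eps ->
  exists2 z : R, 0 < z & pr (unif R) [set s | `|num s| <= z] <= eps.
Proof.
move=> mnum num0 eps0.
pose F (n : nat) := [set s : R | `|num s| <= n.+1%:R^-1].
have mF n : measurable (F n) by exact: measurable_abs_le.
have niF : nonincreasing_seq F.
  apply/nonincreasing_seqP => n; rewrite subsetEset => s /= h; apply: le_trans h _.
  by rewrite lef_pV2 ?posrE ?ltr0n// ler_nat.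
have mZ : measurable (\bigcap_n F n) by apply: bigcap_measurable => //; exists 0%N.
have := nonincreasing_cvg_mu (mu := unif R) _ mF mZ niF.
have F0 : (unif R (F 0%N) < +oo)%E.
  exact: le_lt_trans (probability_le1 (unif R) (mF 0%N)) (ltry 1).
move=> /(_ F0) C.
have E0 : unif R (\bigcap_n F n) = 0%:E.
  rewrite -EFin_pr//; congr EFin; apply/eqP; rewrite eq_le pr_ge0 andbT -unif_sin_zero.
  apply: unif_le => //.
    rewrite (_ : [set s | _] = setT `&` (fun s => sin (2 * pi * s)) @^-1` [set 0]).
      by apply: (continuous_measurable_fun (@continuous_sin2pi R)) => //; exact: measurable_set1.
    by rewrite setTI.
  move=> s _ h; apply: num0; apply/eqP; rewrite -normr_eq0 eq_le normr_ge0 andbT.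
  apply/ler_addgt0Pr => e0 e00; rewrite add0r.
  have := h (Num.bound e0^-1) I; rewrite /F/= => h1; apply: le_trans h1 _.
  rewrite invf_ple ?posrE//; apply: ltW; apply: lt_le_trans (archi_boundP _) _.
    by rewrite invr_ge0 ltW.
  by rewrite ler_nat.
have {C} : (fun n => unif R (F n)) @ \oo --> 0%:E by rewrite -E0; exact: C.
move=> /fine_cvgP[_ /cvgrPdist_le H].
have [n _ Hn] := H _ eps0; exists n.+1%:R^-1 => //.
by have := Hn n (leqnn n); rewrite /= sub0r normrN ger0_norm// fine_ge0.
Qed.

End SmallNumerator.

Section AntiConcentration.
Context (R : realType) (d : measure_display) (T : measurableType d).
Variables (P : probability T R) (X : int -> {RV P >-> R}) (theta : {RV P >-> R}).
Hypotheses (X_rademacher : forall m, rademacher (X m))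
    (X_independent : mutually_independent X)
    (theta_uniform : uniform01 theta)
    (theta_independent : independent_of_family theta X).

Section Component.
Variables (gamma : int -> R -> R) (num : R -> R).
Hypotheses (mgamma : forall m, measurable_fun setT (gamma m))
  (mnum : measurable_fun setT num)
  (num0 : forall s, num s = 0 -> sin (2 * pi * s) = 0)
  (gammaE : forall (m : nat) s, 0 <= s <= 1 -> (2 <= m)%N ->
     gamma m%:Z s = num s / (2 * pi * (m%:R - s))).

(** The gap between the coefficients of indices [m1 < m2 <= K] is
    [|num s| * (m2 - m1) / (2 pi (m1 - s) (m2 - s))], at least
    [|num s| / (2 pi K ^ 2)]. *)
Lemma gamma_separated (K m1 m2 : nat) (s eta : R) : 0 <= s <= 1 ->
  (2 <= m1 <= K)%N -> (2 <= m2 <= K)%N -> (m1 < m2)%N ->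
  2 * pi * K%:R ^+ 2 * eta < `|num s| ->
  eta < `| `|gamma m1%:Z s| - `|gamma m2%:Z s| |.
Proof.
move=> s01 /andP[m12 m1K] /andP[m22 m2K] m12lt h.
have p0 := pi_gt0 R; rewrite !gammaE//.
move: s01 => /andP[s0 s1].
have k1 : (2 : R) <= m1%:R by rewrite ler_nat.
have k2 : (m1%:R : R) + 1 <= m2%:R by rewrite natr1 ler_nat.
have k3 : (m2%:R : R) <= K%:R by rewrite ler_nat.
have a0 : 0 < (m1%:R : R) - s by lra.
have b0 : 0 < (m2%:R : R) - s by lra.
rewrite !normrM !normfV (@gtr0_norm _ (2 * pi * (m1%:R - s))) ?mulr_gt0//.
rewrite (@gtr0_norm _ (2 * pi * (m2%:R - s))) ?mulr_gt0//.
apply: lt_le_trans (ler_norm _).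
have -> : `|num s| / (2 * pi * (m1%:R - s)) - `|num s| / (2 * pi * (m2%:R - s)) =
   `|num s| * (m2%:R - m1%:R) / (2 * pi * ((m1%:R - s) * (m2%:R - s))).
  have -> : m2%:R - m1%:R = (m2%:R - s) - (m1%:R - s) by ring.
  move: (pi : R) (m1%:R - s) (m2%:R - s) p0 a0 b0 => q u v q0 u0 v0.
  by field; rewrite !gt_eqF.
rewrite ltr_pdivlMr ?mulr_gt0//.
have [eta0|eta0] := ltP eta 0.
  apply: lt_le_trans (_ : 0 <= _); last by rewrite mulr_ge0//; lra.
  by rewrite nmulr_rlt0// !mulr_gt0.
apply: lt_le_trans (_ : `|num s| <= _); last by rewrite ler_peMr//; lra.
apply: le_lt_trans h; rewrite mulrC ler_wpM2r// -!mulrA ler_pM2l// ler_pM2l// expr2.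
by apply: ler_pM; lra.
Qed.

(** Except for a set of small measure of values of [theta], the [K] coefficients of
    indices [2, ..., K + 1] are separated by [eta], hence [sign_anticoncentration]
    bounds the proportion of sign patterns by [1 / K].  Neither [eta] nor [K] depends
    on [N]. *)
Lemma partial_anticoncentration (a eps : R) : 0 < eps ->
  exists2 eta : R, 0 < eta & exists N0 : nat, forall N, (N0 <= N)%N ->
    pr P [set w | `|partial X theta gamma N w - a| <= eta] <= eps.
Proof.
move=> eps0; have e20 : 0 < eps / 2 by rewrite divr_gt0.
have [z z0 hz] := unif_small_values mnum num0 e20.
have [K [K0 hK]] : exists K : nat, (0 : R) < K%:R /\ (K%:R^-1 : R) <= eps / 2.
  exists (Num.bound (2 / eps)).+1; split; first by rewrite ltr0n.
  rewrite invf_ple ?posrE ?ltr0n// invf_div; apply: ltW.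
  apply: lt_le_trans (archi_boundP _) _; first by rewrite divr_ge0// ltW.
  by rewrite ler_nat.
have C0 : 0 < 2 * pi * K.+1%:R ^+ 2 :> R by rewrite !mulr_gt0 ?pi_gt0// exprn_gt0.
exists (z / (2 * pi * K.+1%:R ^+ 2)); first by rewrite divr_gt0.
set eta := z / _; have etaz : 2 * pi * K.+1%:R ^+ 2 * eta = z by rewrite mulrC divfK// gt_eqF.
exists K.+2 => N NK.
pose E : set T := [set w | `|partial X theta gamma N w - a| <= eta].
have mE : measurable E.
  by apply: measurable_abs_le; apply: measurable_funB => //; exact: measurable_partial.
pose b (i : 'I_(2 * N).+1) s := gamma (i%:Z - N%:Z) s.
pose B (x : pattern N) : set R := [set s | `|signed_sum (b ^~ s) x - a| <= eta].
have mB x : measurable (B x).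
  apply: measurable_abs_le; apply: measurable_funB => //; apply: measurable_sum => i.
  by apply: measurable_funM; [exact: mgamma | exact: measurable_cst].
have H := @pr_joint_le _ _ _ P X theta X_rademacher X_independent theta_uniform
  theta_independent N E B mE mB.
apply: le_trans (H _) _.
  move=> w x xw _; rewrite /E /B/= /partial /symsum /signed_sum.
  congr (`|_ - a| <= eta); apply: eq_bigr => i _.
  by rewrite xw ?pattern_sign_ord//; have := ltn_ord i; lia.
pose big : set R := `[0, 1]%classic `&` [set s | z < `|num s|].
have mbig : measurable big.
  by apply: measurableI; [exact: measurable_itv | exact: measurable_abs_gt].
have mBb x : measurable (B x `&` big) by apply: measurableI; [exact: mB|exact: mbig].
pose small : set R := [set s | `|num s| <= z].
have msmall : measurable small by exact: measurable_abs_le.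
have W2 : (#|pattern N|%:R : R) = 2 ^+ (2 * N).+1.
  by rewrite card_ffun card_bool card_ord natrX.
have p2 : (0 : R) < 2 ^+ (2 * N).+1 by rewrite exprn_gt0.
have H1 : \sum_(x : pattern N) pr (unif R) (B x `&` big) <= 2 ^+ (2 * N).+1 / K%:R.
  apply: pr_double_counting => [x|s]; first exact: mBb.
  have [[s01 ns]|nb] := pselect (big s); last first.
    rewrite big1 ?divr_ge0 ?exprn_ge0// => x _.
    by rewrite indicE memNset// => -[].
  rewrite /= in_itv/= in s01.
  (* The position of the integer [k + 2] in the window [|m| <= N]. *)
  pose f (k : 'I_K) : 'I_(2 * N).+1 := inord (N + 2 + k).
  have fE k : (f k : nat) = (N + 2 + k)%N.
    rewrite /f inordK//; have kK : (k < K)%N by exact: ltn_ord.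
    have kN : (k.+2 < N)%N by apply: leq_trans NK; rewrite !ltnS.
    by move: kN; clear; lia.
  have finj : injective f.
    by move=> k1 k2 /(congr1 val)/=; rewrite !fE => /addnI/val_inj.
  pose J : {set 'I_(2 * N).+1} := [set f k | k : 'I_K].
  have cJ : #|J| = K by rewrite card_imset// card_ord.
  have sepf k1 k2 : k1 != k2 -> eta < `| `|b (f k1) s| - `|b (f k2) s| |.
    wlog lt12 : k1 k2 / (k1 < k2)%N.
      move=> W; case: (ltngtP k1 k2) => [lt12|lt21|/val_inj->]; last by rewrite eqxx.
        exact: W.
      by move=> _; rewrite distrC; apply: W => //; rewrite neq_ltn lt21.
    move=> _; rewrite /b !fE.
    have shiftE k : (N + 2 + k)%N%:Z - N%:Z = (2 + k)%N%:Z by clear; lia.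
    rewrite !shiftE.
    apply: (gamma_separated (K := K.+1)) => //.
    - by rewrite leq_addr add2n !ltnS ltn_ord.
    - by rewrite leq_addr add2n !ltnS ltn_ord.
    - by rewrite etaz.
  have := @sign_anticoncentration R _ (b ^~ s) J a eta.
  rewrite cJ W2 => h; rewrite ler_pdivlMr// mulrC; apply: le_trans (h _).
    apply: ler_wpM2l => //; apply: ler_sum => x _; rewrite indicE.
    case: (boolP (s \in _)) => [|_]; last by [].
    by rewrite inE => -[/= -> _].
  move=> i j /imsetP[k1 _ ->] /imsetP[k2 _ ->] k12; apply: sepf.
  by apply: contra_neq k12 => ->.
rewrite ler_pdivrMl//.
apply: le_trans (_ : \sum_(x : pattern N) (pr (unif R) (B x `&` big) + pr (unif R) small) <= _).
  apply: ler_sum => x _.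
  apply: le_trans (_ : pr (unif R) ((B x `&` big) `|` small) <= _).
    apply: unif_le; [exact: mB | by apply: measurableU; [exact: mBb|exact: msmall] | ].
    move=> s s01 Bs; have [sz|zs] := leP `|num s| z; first by right.
    by left; split => //; split => //; rewrite /= in_itv.
  by apply: pr_setU; [exact: mBb|exact: msmall].
rewrite big_split/= sumr_const -(mulr_natl (pr (unif R) small)) W2.
rewrite (splitr eps) mulrDr; apply: lerD; last by rewrite ler_pM2l.
by apply: le_trans H1 _; rewrite ler_pM2l.
Qed.

End Component.

End AntiConcentration.

(** * Anti-concentration of the limit, measurability of the Fekete quotient *)

Lemma exists_large (R : archiRealFieldType) (C eps : R) (N0 : nat) : 0 <= C -> 0 < eps ->
  exists n : nat, [/\ (0 < n)%N, (N0 <= n)%N & C / n%:R <= eps].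
Proof.
move=> C0 eps0; exists (N0 + Num.bound (C / eps)).+1; split => //.
  by rewrite leqW// leq_addr.
rewrite ler_pdivrMr ?ltr0n// mulrC -ler_pdivrMr//; apply: ltW.
apply: lt_le_trans (archi_boundP _) _; first by rewrite divr_ge0// ltW.
by rewrite ler_nat leqW// leq_addl.
Qed.

Section AntiConcentrationG.
Context (R : realType) (d : measure_display) (T : measurableType d).
Variables (P : probability T R) (X : int -> {RV P >-> R}) (theta : {RV P >-> R}).
Hypotheses (X_rademacher : forall m, rademacher (X m))
    (X_independent : mutually_independent X)
    (theta_uniform : uniform01 theta)
    (theta_independent : independent_of_family theta X).

(** If [f] is within [eta / 2] of [a], then a partial sum close to [f] is within
    [eta] of [a]. *)
Lemma anticoncentration_transfer (f : T -> R) (S : nat -> T -> R) (a : R) :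
  measurable_fun setT f -> (forall N, measurable_fun setT (S N)) ->
  (forall eps, 0 < eps -> exists2 eta : R, 0 < eta & exists N0 : nat, forall N, (N0 <= N)%N ->
    pr P [set w | `|S N w - a| <= eta] <= eps) ->
  (forall n w, (0 < n)%N -> ~ exceptionalG X theta n w -> `|f w - S (n ^ 6)%N w| <= 128 / n%:R) ->
  forall eps : R, 0 < eps -> exists2 eta : R, 0 < eta & pr P [set w | `|f w - a| <= eta] <= eps.
Proof.
move=> mf mS H fS eps eps0.
have e20 : 0 < eps / 2 by rewrite divr_gt0.
have [eta eta0 [N0 HN]] := H _ e20.
have eta20 : 0 < eta / 2 by rewrite divr_gt0.
have [n1 [n10 _ h1]] := exists_large N0 (ler0n R 128) eta20.
have [n [n0 n1n h2]] := exists_large (maxn N0 n1) (ler0n R 8) e20.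
move: n1n; rewrite geq_max => /andP[N0n n1n].
exists (eta / 2) => //.
have nn : (n <= n ^ 6)%N by rewrite -{1}(expn1 n) leq_pexp2l.
apply: le_trans (_ : pr P [set w | `|S (n ^ 6)%N w - a| <= eta] + pr P (exceptionalG X theta n) <= _).
  apply: pr_le_setU.
  - by apply: measurable_abs_le; exact: measurable_funB.
  - by apply: measurable_abs_le; exact: measurable_funB.
  - exact: measurable_exceptionalG.
  move=> w /= h; have [wb|wb] := pselect (exceptionalG X theta n w); [by right|left].
  have := fS n w n0 wb => h3.
  have h4 : 128 / n%:R <= eta / 2.
    apply: le_trans h1.
    by rewrite ler_pM2l// lef_pV2 ?posrE ?ltr0n// ler_nat.
  have -> : S (n ^ 6)%N w - a = (f w - a) - (f w - S (n ^ 6)%N w) by ring.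
  by apply: le_trans (ler_normB _ _) _; rewrite /= in h; lra.
rewrite [leRHS]splitr; apply: lerD; first by apply: HN; apply: leq_trans nn.
by apply: le_trans (pr_exceptionalG X_rademacher X_independent theta_uniform theta_independent n0) h2.
Qed.

Lemma GX_anticoncentration (a eps : R) : 0 < eps ->
  (exists2 eta : R, 0 < eta & pr P [set w | `|complex.Re (GX X theta w) - a| <= eta] <= eps) /\
  (exists2 eta : R, 0 < eta & pr P [set w | `|complex.Im (GX X theta w) - a| <= eta] <= eps).
Proof.
move=> eps0; split.
  apply: (anticoncentration_transfer (S := partial X theta (@reG R))) eps0.
  - exact: measurable_Re_GX.
  - by move=> N; apply: measurable_partial; exact: measurable_reG.
  - move=> e e0; apply: (partial_anticoncentration X_rademacher X_independent
      theta_uniform theta_independent (num := fun s => sin (2 * pi * s))) => //.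
    + exact: measurable_reG.
    + apply: continuous_measurable_fun; exact: continuous_sin2pi.
    + move=> m s /andP[s0 s1] m2; rewrite reGE ifF//; apply/negbTE; rewrite lt_eqF//.
      by apply: le_lt_trans s1 _; rewrite -pmulrn ltr1n.
  - by move=> n w n0 /(GX_approx n0)[].
apply: (anticoncentration_transfer (S := partial X theta (@imG R))) eps0.
- exact: measurable_Im_GX.
- by move=> N; apply: measurable_partial; exact: measurable_imG.
- move=> e e0; apply: (partial_anticoncentration X_rademacher X_independent
    theta_uniform theta_independent (num := fun s => 1 - cos (2 * pi * s))) => //.
  + exact: measurable_imG.
  + apply: continuous_measurable_fun => x.
    by apply: cvgB; [exact: cvg_cst | exact: continuous_cos2pi].
  + move=> s h; apply/eqP; rewrite -sqrf_eq0 sin2cos2.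
    have -> : cos (2 * pi * s) = 1 by lra.
    by rewrite expr1n subrr.
  + move=> m s /andP[s0 s1] m2; rewrite imGE ifF//; apply/negbTE; rewrite lt_eqF//.
    by apply: le_lt_trans s1 _; rewrite -pmulrn ltr1n.
- by move=> n w n0 /(GX_approx n0)[].
Qed.

End AntiConcentrationG.

Section ComplexMeasurability.
Context (R : realType) (d : measure_display) (T : measurableType d).
Implicit Types f g : T -> R[i].

Definition measurable_cplx f : Prop :=
  measurable_fun setT (fun t => complex.Re (f t)) /\
  measurable_fun setT (fun t => complex.Im (f t)).

Lemma measurable_cplx_cst (c : R[i]) : measurable_cplx (fun=> c).
Proof. by split; exact: measurable_cst. Qed.

Lemma measurable_cplx_mul f g : measurable_cplx f -> measurable_cplx g -> measurable_cplx (fun t => f t * g t).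
Proof.
move=> [f1 f2] [g1 g2]; split.
  rewrite (_ : (fun t => _) = fun t => complex.Re (f t) * complex.Re (g t) -
    complex.Im (f t) * complex.Im (g t)); last first.
    by apply/funext => t; case: (f t) => a b; case: (g t).
  by apply: measurable_funB; exact: measurable_funM.
rewrite (_ : (fun t => _) = fun t => complex.Re (f t) * complex.Im (g t) +
    complex.Im (f t) * complex.Re (g t)); last first.
  by apply/funext => t; case: (f t) => a b; case: (g t).
by apply: measurable_funD; exact: measurable_funM.
Qed.

Lemma measurable_cplx_sum (I : finType) (F : I -> T -> R[i]) :
  (forall i, measurable_cplx (F i)) -> measurable_cplx (fun t => \sum_i F i t).
Proof.
move=> mF; split.
  under eq_fun do rewrite raddf_sum.
  by apply: measurable_sum => i; case: (mF i).
under eq_fun do rewrite raddf_sum.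
by apply: measurable_sum => i; case: (mF i).
Qed.

Lemma measurable_cplx_exp f n : measurable_cplx f -> measurable_cplx (fun t => f t ^+ n).
Proof.
move=> mf; elim: n => [|n IHn]; first exact: measurable_cplx_cst.
under eq_fun do rewrite exprS.
exact: measurable_cplx_mul.
Qed.

Lemma measurable_cplx_e (u : T -> R) : measurable_fun setT u -> measurable_cplx (fun t => e (u t)).
Proof.
move=> mu; split => /=.
  exact: (measurableT_comp (continuous_measurable_fun (@continuous_cos2pi R)) mu).
exact: (measurableT_comp (continuous_measurable_fun (@continuous_sin2pi R)) mu).
Qed.

End ComplexMeasurability.

Lemma measurable_cplx_rotcoef (R : realType) (p : nat) (m : int) :
  measurable_cplx (fun s : R => rotcoef p m s).
Proof.
apply: measurable_cplx_mul; first exact: measurable_cplx_cst.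
apply: measurable_cplx_sum => l; apply: measurable_cplx_exp; apply: measurable_cplx_e.
apply: measurable_funM; last exact: measurable_cst.
by apply: measurable_funB.
Qed.

Lemma measurable_cplx_feketeratio (R : realType) (p : nat) :
  measurable_cplx (fun t : R => feketeratio p t).
Proof.
apply: measurable_cplx_mul; last exact: measurable_cplx_cst.
have -> : (fun t : R => (fekete R p).[e t]) =
    (fun t => \sum_(i < size (fekete R p)) (fekete R p)`_i * e t ^+ i).
  by apply/funext => t; rewrite horner_coef.
apply: measurable_cplx_sum => i; apply: measurable_cplx_mul; first exact: measurable_cplx_cst.
by apply: measurable_cplx_exp; apply: measurable_cplx_e.
Qed.

(** * Head and tail of the Fekete quotient *)

Section Rotations.
Variables (R : realType) (p : nat).
Hypotheses (p_pr : prime p) (p2 : (2 < p)%N).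
Local Notation normc := (@Normc.normc R).
Let h := p./2.
Let pE : p = (2 * h).+1 := odd_prime_half p_pr p2.

Definition chiR (k : 'F_p) (m : int) : R := (quadchar (k + m%:~R))%:~R.

Section RealPart.
(** [c] is the real or the imaginary part. *)
Variable c : {additive R[i] -> R}.
Hypotheses (c_le : forall z, `|c z| <= normc z)
  (c_int : forall (n : int) z, c (n%:~R * z) = n%:~R * c z)
  (mc : forall m, measurable_fun setT (fun s => c (rotcoef p m s))).

Definition tail_coef (M : nat) (m : int) (s : R) : R :=
  if (M < `|m|)%N then c (rotcoef p m s) else 0.

Definition tail (M : nat) (k : 'F_p) (s : R) : R :=
  symsum h (fun m => chiR k m * tail_coef M m s).

Lemma feketeratio_split M (k : 'F_p) s : (M <= h)%N ->
  c (feketeratio p (((k : nat)%:R + s) / p%:R)) =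
  symsum M (fun m => chiR k m * c (rotcoef p m s)) + tail M k s.
Proof.
move=> Mh; rewrite (feketeratio_window p_pr p2) natr_Zp raddf_sum /=.
have -> : \sum_(i < (2 * p./2).+1) c ((quadchar (k + (i%:Z - (p./2)%:Z)%:~R))%:~R *
     rotcoef p (i%:Z - (p./2)%:Z) s) = symsum h (fun m => chiR k m * c (rotcoef p m s)).
  by apply: eq_bigr => i _; rewrite c_int.
rewrite (symsum_split _ Mh); congr (_ + _); apply: eq_symsum => m _.
by rewrite /tail_coef; case: ifP; rewrite ?mulr0.
Qed.

Lemma measurable_tail_coef M m : measurable_fun setT (tail_coef M m).
Proof.
by rewrite /tail_coef; case: (M < _)%N; [exact: mc | exact: measurable_cst].
Qed.

Definition tail_set M (k : 'F_p) (del : R) : set R :=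
  `[0, 1]%classic `&` [set s | del < `|tail M k s|].

Lemma measurable_tail_set M k del : measurable (tail_set M k del).
Proof.
apply: measurableI; first exact: measurable_itv.
apply: measurable_abs_gt; apply: measurable_sum => i; apply: measurable_funM.
  exact: measurable_cst.
exact: measurable_tail_coef.
Qed.

(** [pr_chebyshev] for the translates of the quadratic character.  The window
    [|m| <= (p - 1) / 2] contains each residue once, so that the shifts are distinct. *)
Lemma sum_tail_set M del : (0 < M)%N -> 0 < del ->
  \sum_(k : 'F_p) pr (unif R) (tail_set M k del) <=
    p%:R * (((sinc_lower R)^-1) ^+ 2 * (2 / M%:R)) / del ^+ 2.
Proof.
move=> M0 del0.
have k0 := sinc_lower_gt0 R.
pose b (i : 'I_(2 * h).+1) s := tail_coef M (i%:Z - h%:Z) s.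
pose xi (i : 'I_(2 * h).+1) (k : 'F_p) : R := chiR k (i%:Z - h%:Z).
have mb i : measurable_fun setT (b i) by exact: measurable_tail_coef.
have b2 s : `[0, 1]%classic s -> \sum_i b i s ^+ 2 <= ((sinc_lower R)^-1) ^+ 2 * (2 / M%:R).
  rewrite /= in_itv/= => s01.
  apply: le_trans (_ : ((sinc_lower R)^-1) ^+ 2 * symsum h (fun m => if (M < `|m|)%N then (`|m|%N%:R : R) ^- 2 else 0) <= _); last first.
    by apply: ler_wpM2l; [exact: sqr_ge0 | exact: symsum_tail].
  rewrite mulr_sumr; apply: ler_sum => i _; rewrite /b /tail_coef.
  case: ifP => [Mi|_]; last by rewrite expr0n mulr0.
  rewrite -[leLHS]real_normK ?num_real// -(exprVn (_%:R)) -exprMn; apply: lerXn2r.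
  - by rewrite nnegrE.
  - by rewrite nnegrE mulr_ge0// invr_ge0// ltW.
  apply: le_trans (c_le _) _; apply: normc_rotcoef_le => //.
    have := ltn_ord i; rewrite pE; lia.
  exact: leq_ltn_trans Mi.
have orth (beta : 'I_(2 * h).+1 -> R) :
    \sum_(k : 'F_p) (\sum_i beta i * xi i k) ^+ 2 <= p%:R * \sum_i beta i ^+ 2.
  apply: (@quadchar_quasi_orthogonal R p p_pr p2 _ (fun i : 'I_(2 * h).+1 => (i%:Z - h%:Z)%:~R : 'F_p)).
  move=> i j; rewrite !rmorphB/= => /addIr; rewrite -!pmulrn => /(congr1 val) /=.
  rewrite !val_Fp_nat// !modn_small => [||].
  - exact: val_inj.
  - by rewrite [X in (_ < X)%N]pE.
  - by rewrite [X in (_ < X)%N]pE.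
have V0 : (0 : R) <= ((sinc_lower R)^-1) ^+ 2 * (2 / M%:R).
  by rewrite mulr_ge0 ?sqr_ge0// divr_ge0.
have := @pr_chebyshev R _ _ (unif R) _ _ xi p%:R `[0, 1]%classic b _ del orth (ler0n _ _)
  (measurable_itv _) mb V0 del0 b2.
apply: le_trans; apply: ler_sum => k _; rewrite le_eqVlt; apply/orP; left; apply/eqP.
congr (pr _ (_ `&` _)); apply/seteqP; split => s /=.
  by rewrite /tail /symsum; under eq_bigr do rewrite mulrC.
by rewrite /tail /symsum; under [in X in _ -> X]eq_bigr do rewrite mulrC.
Qed.

(** The signs are opposite to the character because [rotcoef] tends to the opposite
    of [Gcoef]. *)
Lemma main_term_close M (x : pattern M) (k : 'F_p) (s del : R) :
  (forall m : int, (`|m| <= M)%N -> chiR k m = - pattern_sign R x m) ->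
  (forall m : int, (`|m| <= M)%N -> normc (rotcoef p m s + Gcoef m s) <= del) ->
  `|symsum M (fun m => chiR k m * c (rotcoef p m s)) -
    symsum M (fun m => c (Gcoef m s) * pattern_sign R x m)| <= (2 * M).+1%:R * del.
Proof.
move=> kx rG; rewrite /symsum -sumrB; apply: le_trans (ler_norm_sum _ _ _) _.
rewrite mulr_natl -[X in _ *+ X]card_ord -sumr_const; apply: ler_sum => i _.
have iM : (`|i%:Z - M%:Z| <= M)%N by have := ltn_ord i; lia.
rewrite kx//; move: (i%:Z - M%:Z) iM => m mM.
have -> : - pattern_sign R x m * c (rotcoef p m s) - c (Gcoef m s) * pattern_sign R x m =
   - (pattern_sign R x m * c (rotcoef p m s + Gcoef m s)) by rewrite raddfD; ring.
rewrite normrN normrM /pattern_sign normr_sign mul1r.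
by apply: le_trans (c_le _) (rG _ mM).
Qed.

End RealPart.
End Rotations.

(** * One-sided comparison of distributions *)

Lemma dist_addl (R : realFieldType) (u v a del : R) :
  `|u - v| <= del -> `|a| <= del -> `|v - (u + a)| <= 2 * del.
Proof.
move=> uv ua; rewrite opprD addrA; apply: le_trans (ler_normB _ _) _.
by rewrite distrC in uv; lra.
Qed.

Section ReIm.
Variable R : realType.
Lemma Re_int (n : int) (z : R[i]) : complex.Re (n%:~R * z) = n%:~R * complex.Re z.
Proof.
have -> : n%:~R = (n%:~R : R)%:C :> R[i] by rewrite rmorph_int.
by case: z => a b /=; rewrite mul0r subr0.
Qed.

Lemma Im_int (n : int) (z : R[i]) : complex.Im (n%:~R * z) = n%:~R * complex.Im z.
Proof.
have -> : n%:~R = (n%:~R : R)%:C :> R[i] by rewrite rmorph_int.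
by case: z => a b /=; rewrite mul0r addr0.
Qed.
End ReIm.

Section Comparison.
Context (R : realType) (d : measure_display) (T : measurableType d).
Variables (P : probability T R) (X : int -> {RV P >-> R}) (theta : {RV P >-> R}).
Hypotheses (X_rademacher : forall m, rademacher (X m))
    (X_independent : mutually_independent X)
    (theta_uniform : uniform01 theta)
    (theta_independent : independent_of_family theta X).
(** A real function on the plane, 1-Lipschitz for the sup distance. *)
Variable rho : R -> R -> R.
Hypothesis rho_lip : forall x y x' y' del : R,
  `|x - x'| <= del -> `|y - y'| <= del -> rho x y <= rho x' y' + del.
Hypothesis rho_meas : forall (d' : measure_display) (T' : measurableType d') (f g : T' -> R) (a : R),
  measurable_fun setT f -> measurable_fun setT g -> measurable [set t | rho (f t) (g t) <= a].

Local Notation cRe := (@complex.Re R : {additive R[i] -> R}).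
Local Notation cIm := (@complex.Im R : {additive R[i] -> R}).

Definition Hre M (x : pattern M) s := symsum M (fun m => complex.Re (Gcoef m s) * pattern_sign R x m).
Definition Him M (x : pattern M) s := symsum M (fun m => complex.Im (Gcoef m s) * pattern_sign R x m).
Definition sublevel M (del : R) (x : pattern M) : set R :=
  [set s | rho (Hre x s) (Him x s) <= 2 * del].

Lemma measurable_sublevel M del (x : pattern M) : measurable (sublevel del x).
Proof.
apply: rho_meas; apply: measurable_sum => i; apply: measurable_funM.
- exact: measurable_reG.
- exact: measurable_cst.
- exact: measurable_imG.
- exact: measurable_cst.
Qed.

(** The average over patterns is the probability of the event for the partial sum at
    [n ^ 6] ([pr_joint_ge]), which is close to the limit ([GX_approx]). *)
Lemma pattern_average_le (n : nat) (del : R) : (0 < n)%N -> 128 / n%:R <= del ->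
  (2 ^+ (2 * n ^ 6).+1)^-1 * \sum_(x : pattern (n ^ 6)) pr (unif R) (sublevel del x) <=
  pr P [set w | rho (complex.Re (GX X theta w)) (complex.Im (GX X theta w)) <= 3 * del] + 8 / n%:R.
Proof.
move=> n0 ndel.
pose S : set T := [set w | rho (partial X theta (@reG R) (n ^ 6) w)
   (partial X theta (@imG R) (n ^ 6) w) <= 2 * del].
have mS : measurable S.
  by apply: rho_meas; apply: measurable_partial; [exact: measurable_reG|exact: measurable_imG].
apply: le_trans (_ : pr P S <= _).
  apply: (pr_joint_ge X_rademacher X_independent theta_uniform theta_independent) => //.
    by move=> x; exact: measurable_sublevel.
  move=> w x xw _; rewrite /sublevel/= /S/=; congr (rho _ _ <= _).
    apply: eq_symsum => m mN; by rewrite xw.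
  by apply: eq_symsum => m mN; rewrite xw.
apply: le_trans (_ : pr P [set w | rho (complex.Re (GX X theta w)) (complex.Im (GX X theta w)) <= 3 * del]
    + pr P (exceptionalG X theta n) <= _); last first.
  by rewrite lerD2l (pr_exceptionalG X_rademacher X_independent theta_uniform theta_independent n0).
apply: pr_le_setU => //.
- by apply: rho_meas; [exact: measurable_Re_GX|exact: measurable_Im_GX].
- exact: measurable_exceptionalG.
move=> w Sw; have [wb|wb] := pselect (exceptionalG X theta n w); [by right|left => /=].
have [h1 h2] := GX_approx n0 wb.
have := rho_lip (le_trans h1 ndel) (le_trans h2 ndel); rewrite /S/= in Sw; lra.
Qed.

Section FixedPrime.
Variables (p M : nat) (del : R).
Hypotheses (p_pr : prime p) (p2 : (2 < p)%N) (Mp : (M <= p./2)%N).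
Hypothesis rot_close : forall (m : int) (s : R), (`|m| <= M)%N -> 0 <= s <= 1 ->
  Normc.normc (rotcoef p m s + Gcoef m s) <= del / (2 * M).+1%:R.

(** The bits are negated because the process sees the signs [- quadchar], see
    [main_term_close]. *)
Definition window_pattern (x : pattern M) : {set 'F_p} :=
  [set k : 'F_p | [forall i : 'I_(2 * M).+1,
     quadchar (k + (- M%:R) + (i : nat)%:R) == (-1) ^+ (~~ x i)]]%SET.

(** The residues [k] at distance at most [M] from [0], where the character vanishes
    at some point of the window and follows no sign pattern. *)
Definition window_zero : {set 'F_p} :=
  [set k : 'F_p | [exists i : 'I_(2 * M).+1, k + (- M%:R) + (i : nat)%:R == 0]]%SET.

Definition rescaled (k : 'F_p) : set R :=
  [set s | rho (complex.Re (feketeratio p (((k : nat)%:R + s) / p%:R)))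
               (complex.Im (feketeratio p (((k : nat)%:R + s) / p%:R))) <= 0].

Lemma card_window_zero : (#|window_zero| <= (2 * M).+1)%N.
Proof.
pose f (i : 'I_(2 * M).+1) : 'F_p := M%:R - (i : nat)%:R.
apply: (@leq_trans #|codom f|); last by rewrite (leq_trans (leq_image_card _ _))// card_ord.
apply: subset_leq_card; apply/fintype.subsetP => k; rewrite inE => /existsP[i /eqP h].
by apply/codomP; exists i; apply/eqP; rewrite -subr_eq0 -h /f; apply/eqP; ring.
Qed.

Lemma exists_window_pattern (k : 'F_p) : k \notin window_zero ->
  exists2 x, k \in window_pattern x &
    forall m : int, (`|m| <= M)%N -> chiR R k m = - pattern_sign R x m.
Proof.
rewrite inE negb_exists => /forallP h.
pose x : pattern M := [ffun i : 'I_(2 * M).+1 => quadchar (k + (- M%:R) + (i : nat)%:R) == 1].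
have xP (i : 'I_(2 * M).+1) : quadchar (k + (- M%:R) + (i : nat)%:R) = (-1) ^+ (~~ x i).
  by rewrite ffunE; case/orP: (quadchar_val p_pr (h i)) => /eqP ->.
exists x; first by rewrite inE; apply/forallP => i; rewrite xP.
move=> m mM; pose i : 'I_(2 * M).+1 := inord (absz (m + M%:Z)).
have mE : m = i%:Z - M%:Z by rewrite /i inordK; lia.
rewrite [in RHS]mE pattern_sign_ord /chiR (_ : k + m%:~R = k + (- M%:R) + (i : nat)%:R).
  by rewrite xP; case: (x i); rewrite /= ?expr0 ?expr1 ?rmorphN ?rmorph1 ?mulrN1z ?opprK.
by rewrite mE rmorphB/=; ring.
Qed.

Lemma measurable_rescaled k : measurable (rescaled k).
Proof.
have [mr mi] := measurable_cplx_feketeratio R p.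
have ma : measurable_fun setT (fun s : R => ((k : nat)%:R + s) / p%:R).
  apply: measurable_funM; last exact: measurable_cst.
  by apply: measurable_funD.
apply: rho_meas.
  exact: (measurableT_comp mr ma).
exact: (measurableT_comp mi ma).
Qed.

Let tailRe (k : 'F_p) := tail_set cRe M k del.
Let tailIm (k : 'F_p) := tail_set cIm M k del.

Let mRe m : measurable_fun setT (fun s => complex.Re (@rotcoef R p m s)).
Proof. by case: (measurable_cplx_rotcoef R p m). Qed.

Let mIm m : measurable_fun setT (fun s => complex.Im (@rotcoef R p m s)).
Proof. by case: (measurable_cplx_rotcoef R p m). Qed.

(** A residue outside [window_zero] has exactly one pattern, and the head of the
    quotient is then close to the partial sum of the process for this pattern, unless
    the tail is large. *)
Lemma pr_rescaled_le (k : 'F_p) :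
  pr (unif R) (rescaled k) <=
  \sum_x (k \in window_pattern x)%:R * pr (unif R) (sublevel del x) +
  (k \in window_zero)%:R + (pr (unif R) (tailRe k) + pr (unif R) (tailIm k)).
Proof.
have mtR : measurable (tailRe k) by apply: measurable_tail_set; exact: mRe.
have mtI : measurable (tailIm k) by apply: measurable_tail_set; exact: mIm.
have sum0 : 0 <= \sum_x (k \in window_pattern x)%:R * pr (unif R) (sublevel del x).
  by apply: sumr_ge0 => x _; rewrite mulr_ge0// pr_ge0.
have [kz|kz] := boolP (k \in window_zero).
  apply: (le_trans (@pr_le1 _ _ _ (unif R) _ (measurable_rescaled k))).
  by rewrite addrAC lerDr addr_ge0// addr_ge0// pr_ge0.
have [x kx sx] := exists_window_pattern kz.
apply: le_trans (_ : pr (unif R) (sublevel del x) + (pr (unif R) (tailRe k) + pr (unif R) (tailIm k)) <= _); last first.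
  rewrite addr0 lerD2r (bigD1 x)//= kx mul1r lerDl; apply: sumr_ge0 => y _.
  by rewrite mulr_ge0// pr_ge0.
apply: le_trans (_ : pr (unif R) (sublevel del x `|` (tailRe k `|` tailIm k)) <= _).
  apply: unif_le; first exact: measurable_rescaled.
    by apply: measurableU; [exact: measurable_sublevel | exact: measurableU].
  move=> s s01; rewrite /rescaled/= => hr.
  have [tR|tR] := pselect (tailRe k s); first by right; left.
  have [tI|tI] := pselect (tailIm k s); first by right; right.
  left; rewrite /sublevel/=.
  have is01 : `[0, 1]%classic s by rewrite /= in_itv.
  have aR : `|tail cRe M k s| <= del.
    by rewrite leNgt; apply/negP => h; apply: tR; split.
  have aI : `|tail cIm M k s| <= del.
    by rewrite leNgt; apply/negP => h; apply: tI; split.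
  have M0 : (0 : R) < (2 * M).+1%:R by rewrite ltr0n.
  have bR := @main_term_close R p p_pr p2 cRe (@normc_ge_Re R) M x k s _ sx (fun m mM => rot_close mM s01).
  have bI := @main_term_close R p p_pr p2 cIm (@normc_ge_Im R) M x k s _ sx (fun m mM => rot_close mM s01).
  rewrite mulrC divfK ?gt_eqF// in bR; rewrite mulrC divfK ?gt_eqF// in bI.
  have sR := @feketeratio_split R p p_pr p2 cRe (@Re_int R) M k s Mp.
  have sI := @feketeratio_split R p p_pr p2 cIm (@Im_int R) M k s Mp.
  rewrite /= in sR sI bR bI; rewrite sR sI in hr.
  have := rho_lip (dist_addl bR aR) (dist_addl bI aI); rewrite /Hre /Him => L.
  by apply: le_trans L _; rewrite gerDr.
apply: (le_trans (@pr_setU _ _ _ (unif R) _ _ (measurable_sublevel _ _) (measurableU _ _ mtR mtI))).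
by rewrite lerD2l; exact: (@pr_setU _ _ _ (unif R)).
Qed.

Lemma sum_pr_rescaled_le (eps1 : R) : (0 < M)%N -> 0 < del ->
  (forall x : pattern M, #|window_pattern x|%:R <= ((2 ^+ (2 * M).+1)^-1 + eps1) * p%:R) ->
  p%:R^-1 * \sum_(k < p) pr (unif R) [set s | rho (complex.Re (feketeratio p ((k%:R + s) / p%:R)))
               (complex.Im (feketeratio p ((k%:R + s) / p%:R))) <= 0] <=
  (2 ^+ (2 * M).+1)^-1 * \sum_(x : pattern M) pr (unif R) (sublevel del x) +
  (2 ^+ (2 * M).+1 * `|eps1| + (2 * M).+1%:R / p%:R +
    4 * ((sinc_lower R)^-1) ^+ 2 / M%:R / del ^+ 2).
Proof.
move=> M0 del0 eqd.
have p0 : (0 : R) < p%:R by rewrite ltr0n prime_gt0.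
rewrite (sum_nat_Fp p_pr (fun k => pr (unif R) [set s | rho (complex.Re (feketeratio p ((k%:R + s) / p%:R)))
               (complex.Im (feketeratio p ((k%:R + s) / p%:R))) <= 0])).
rewrite ler_pdivrMl//.
apply: le_trans (ler_sum _ (fun k _ => pr_rescaled_le k)) _.
rewrite !big_split/= exchange_big/=.
have tR := @sum_tail_set R p p_pr p2 cRe (@normc_ge_Re R) mRe M del M0 del0.
have tI := @sum_tail_set R p p_pr p2 cIm (@normc_ge_Im R) mIm M del M0 del0.
have W2 : (#|pattern M|%:R : R) = 2 ^+ (2 * M).+1.
  by rewrite card_ffun card_bool card_ord natrX.
have p20 : (0 : R) < 2 ^+ (2 * M).+1 by rewrite exprn_gt0.
have cardE (S : {set 'F_p}) : \sum_(k : 'F_p) (k \in S)%:R = #|S|%:R :> R.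
  by rewrite -natr_sum -sum1_card [in RHS]big_mkcond/=; congr (_%:R); apply: eq_bigr => k _; case: ifP.
pose A (x : pattern M) := pr (unif R) (sublevel del x).
have A1 (x : pattern M) : A x <= 1 by apply: (@pr_le1 _ _ _ (unif R)); exact: measurable_sublevel.
have h1 : \sum_(x : pattern M) \sum_(k : 'F_p) (k \in window_pattern x)%:R * A x <=
   p%:R * ((2 ^+ (2 * M).+1)^-1 * \sum_(x : pattern M) A x + 2 ^+ (2 * M).+1 * `|eps1|).
  apply: le_trans (_ : \sum_(x : pattern M) (p%:R * ((2 ^+ (2 * M).+1)^-1 * A x) + p%:R * `|eps1|) <= _).
    apply: ler_sum => x _; rewrite -mulr_suml cardE.
    apply: le_trans (ler_wpM2r (pr_ge0 _ _) (eqd x)) _.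
    rewrite mulrDl mulrDl -/(A x) [_ * p%:R]mulrC -mulrA lerD2l -mulrA mulrCA ler_pM2l//.
    apply: le_trans (ler_wpM2r (pr_ge0 _ _) (ler_norm _)) _.
    by rewrite -[leRHS]mulr1; apply: ler_wpM2l => //; exact: A1.
  rewrite big_split/= sumr_const -!mulr_sumr mulrDr lerD2l.
  by rewrite -(mulr_natl (p%:R * `|eps1|)) W2 mulrCA.
have h2 : \sum_(k : 'F_p) (k \in window_zero)%:R <= (2 * M).+1%:R :> R.
  by rewrite cardE ler_nat card_window_zero.
apply: le_trans (lerD (lerD h1 h2) (lerD tR tI)) _.
rewrite (_ : \sum_x pr (unif R) (sublevel del x) = \sum_x A x)//.
have M0' : (M%:R : R) != 0 by rewrite pnatr_eq0 -lt0n.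
have k0 : (sinc_lower R) != 0 by rewrite gt_eqF// sinc_lower_gt0.
have d0 : del != 0 by rewrite gt_eqF.
have pz : (p%:R : R) != 0 by rewrite gt_eqF.
rewrite le_eqVlt; apply/orP; left; apply/eqP.
move: (sinc_lower R) (p%:R : R) (M%:R : R) (\sum_x _) (2 ^+ _ : R) p20 k0 pz M0' => K q m S W W0 K0 q0 m0.
by field; rewrite K0 q0 m0 d0 gt_eqF.
Qed.

End FixedPrime.

(** The window [M = n ^ 6] is fixed first, in terms of [eps], to make the tails and
    the distance from the partial sum to the limit small; then [p] is taken large. *)
Lemma pr_fekete_le (eps : R) : 0 < eps -> exists p0, forall p, prime p -> (p0 <= p)%N ->
  pr (unif R) [set t | rho (complex.Re (feketeratio p t)) (complex.Im (feketeratio p t)) <= 0] <=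
  pr P [set w | rho (complex.Re (GX X theta w)) (complex.Im (GX X theta w)) <= eps] + eps.
Proof.
move=> eps0; pose del := eps / 4; have del0 : 0 < del by rewrite divr_gt0.
have d3 : 3 * del <= eps by rewrite /del; lra.
have d4 : eps = del + del + del + del by rewrite /del; field.
pose C : R := 4 * ((sinc_lower R)^-1) ^+ 2 / del ^+ 2.
have C0 : 0 <= C by rewrite !mulr_ge0 ?sqr_ge0// invr_ge0 sqr_ge0.
have C1 : 0 <= C + 136 by rewrite addr_ge0.
have [n [n0 _ hn]] := exists_large 0 C1 del0.
have n0' : (0 : R) < n%:R by rewrite ltr0n.
have ni0 : (0 : R) < n%:R^-1 by rewrite invr_gt0.
have hC : C / n%:R <= del by apply: le_trans hn; rewrite ler_pM2r//; lra.
have h128 : 128 / n%:R <= del by apply: le_trans hn; rewrite ler_pM2r//; lra.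
have h8 : 8 / n%:R <= del by apply: le_trans hn; rewrite ler_pM2r//; lra.
pose M := (n ^ 6)%N.
have nM : (n <= M)%N by rewrite /M -{1}(expn1 n) leq_pexp2l.
have M0 : (0 < M)%N by exact: leq_trans nM.
have M0' : (0 : R) < (2 * M).+1%:R by rewrite ltr0n.
have W0 : (0 : R) < 2 ^+ (2 * M).+1 by rewrite exprn_gt0.
have dM0 : 0 < del / (2 * M).+1%:R by rewrite divr_gt0.
have [p1 hp1] := rotcoef_cvg M dM0.
pose eps1 := del / 2 / 2 ^+ (2 * M).+1.
have eps10 : 0 < eps1 by rewrite !divr_gt0.
have [p2 hp2] := pattern_equidistribution (2 * M).+1 eps10.
have d20 : 0 < del / 2 by rewrite divr_gt0.
have [p3 [p30 _ hp3]] := exists_large 0 (ltW M0') d20.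
exists (p1 + p2 + p3 + 2 * M + 3)%N => p p_pr pp.
have pgt2 : (2 < p)%N by move: pp; clear; lia.
have pp1 : (p1 <= p)%N by move: pp; clear; lia.
have pp2 : (p2 <= p)%N by move: pp; clear; lia.
have pp3 : (p3 <= p)%N by move: pp; clear; lia.
have Mp : (M <= p./2)%N.
  have := odd_prime_half p_pr pgt2; move: pp; clear; move: (n ^ 6)%N => K; lia.
have p0 : (0 : R) < p%:R by rewrite ltr0n prime_gt0.
have mA : measurable [set t | rho (complex.Re (@feketeratio R p t)) (complex.Im (feketeratio p t)) <= 0].
  by have [mr mi] := measurable_cplx_feketeratio R p; exact: rho_meas.
apply: le_trans (unif_scaling (prime_gt0 p_pr) mA) _.
have rc (m : int) (s : R) : (`|m| <= M)%N -> 0 <= s <= 1 ->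
    Normc.normc (rotcoef p m s + Gcoef m s) <= del / (2 * M).+1%:R.
  by move=> mM s01; exact: hp1.
have eqd (x : pattern M) : #|window_pattern p x|%:R <= ((2 ^+ (2 * M).+1)^-1 + eps1) * p%:R.
  exact: hp2.
apply: le_trans (sum_pr_rescaled_le p_pr pgt2 Mp rc M0 del0 eqd) _.
have avg := pattern_average_le n0 h128.
apply: le_trans (lerD avg (lexx _)) _.
have e1 : 2 ^+ (2 * M).+1 * `|eps1| = del / 2.
  by rewrite gtr0_norm// /eps1 mulrC divfK// gt_eqF.
have e2 : (2 * M).+1%:R / p%:R <= del / 2.
  have pp3' : (p3%:R : R) <= p%:R by rewrite ler_nat; exact: pp3.
  apply: le_trans hp3; rewrite ler_pM2l// lef_pV2 ?posrE//.
  by rewrite ltr0n; exact: p30.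
have e3 : 4 * ((sinc_lower R)^-1) ^+ 2 / M%:R / del ^+ 2 <= del.
  apply: le_trans hC; rewrite mulrAC; apply: ler_wpM2l; first exact: C0.
  by rewrite lef_pV2 ?posrE ?ltr0n ?ler_nat.
have e4 : pr P [set w | rho (complex.Re (GX X theta w)) (complex.Im (GX X theta w)) <= 3 * del] <=
   pr P [set w | rho (complex.Re (GX X theta w)) (complex.Im (GX X theta w)) <= eps].
  apply: pr_le.
  - by apply: rho_meas; [exact: measurable_Re_GX|exact: measurable_Im_GX].
  - by apply: rho_meas; [exact: measurable_Re_GX|exact: measurable_Im_GX].
  by move=> w /= h; exact: le_trans h d3.
apply: le_trans (lerD (lerD e4 h8) (lerD (lerD (lexx _) e2) e3)) _.
rewrite -/M e1 [X in _ <= _ + X]d4 -[del / 2 + del / 2]splitr.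
by rewrite -!addrA !lerD2l lerDl ltW.
Qed.

End Comparison.

(** * Rectangles and conclusion *)

Section BoxDistance.
Variable R : realType.
Variables a b c d : R.

(** A signed distance to the rectangle: negative inside, positive outside.  It is
    Lipschitz, and so is its opposite. *)
Definition box_dist (x y : R) : R :=
  Num.max (Num.max (a - x) (x - b)) (Num.max (c - y) (y - d)).

Lemma box_dist_lip (x y x' y' del : R) :
  `|x - x'| <= del -> `|y - y'| <= del -> box_dist x y <= box_dist x' y' + del.
Proof.
rewrite !ler_norml => /andP[x1 x2] /andP[y1 y2]; rewrite /box_dist.
have m1 : a - x' <= box_dist x' y' by rewrite /box_dist !le_max lexx.
have m2 : x' - b <= box_dist x' y' by rewrite /box_dist !le_max lexx !orbT.
have m3 : c - y' <= box_dist x' y' by rewrite /box_dist !le_max lexx !orbT.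
have m4 : y' - d <= box_dist x' y' by rewrite /box_dist !le_max lexx !orbT.
by rewrite !ge_max; apply/andP; split; apply/andP; split; rewrite -/(box_dist x' y'); lra.
Qed.

Lemma measurable_box_dist (d' : measure_display) (T' : measurableType d') (f g : T' -> R) :
  measurable_fun setT f -> measurable_fun setT g ->
  measurable_fun setT (fun t => box_dist (f t) (g t)).
Proof.
move=> mf mg; rewrite /box_dist.
by apply: measurable_maxr; apply: measurable_maxr; apply: measurable_funB.
Qed.

Lemma measurable_le_cst (d' : measure_display) (T' : measurableType d') (f : T' -> R) (r : R) :
  measurable_fun setT f -> measurable [set t | f t <= r].
Proof.
move=> mf; rewrite (_ : [set t | _] = setT `&` f @^-1` `]-oo, r]%classic).
  by apply: mf => //; exact: measurable_itv.
by rewrite setTI; apply/seteqP; split => t /=; rewrite in_itv.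
Qed.

Definition box (la lb lc ld : bool) : set R[i] :=
  [set z | (complex.Re z \in Interval (BSide la a) (BSide lb b)) /\
           (complex.Im z \in Interval (BSide lc c) (BSide ld d))].

Lemma box_dist_lt0 la lb lc ld (z : R[i]) :
  box_dist (complex.Re z) (complex.Im z) < 0 -> box la lb lc ld z.
Proof.
rewrite /box_dist !gt_max !subr_lt0 => /andP[/andP[h1 h2] /andP[h3 h4]].
by split; rewrite in_itv /=; apply/andP; split; apply: lteifS.
Qed.

Lemma box_dist_le0 la lb lc ld (z : R[i]) :
  box la lb lc ld z -> box_dist (complex.Re z) (complex.Im z) <= 0.
Proof.
rewrite /box/= !in_itv/= => -[/andP[h1 h2] /andP[h3 h4]].
rewrite /box_dist !ge_max !subr_le0.
by rewrite (lteifW h1) (lteifW h2) (lteifW h3) (lteifW h4).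
Qed.

Lemma box_dist_near0 (x y eta : R) : `|box_dist x y| <= eta ->
  [\/ `|x - a| <= eta, `|x - b| <= eta, `|y - c| <= eta | `|y - d| <= eta].
Proof.
rewrite /box_dist; case: (leP (Num.max (a - x) (x - b))) => _.
  by case: (leP (c - y)) => _ h; [apply: Or44 | apply: Or43; rewrite distrC].
by case: (leP (a - x)) => _ h; [apply: Or42 | apply: Or41; rewrite distrC].
Qed.

Lemma measurable_box (d' : measure_display) (T' : measurableType d') (f : T' -> R[i])
    la lb lc ld : measurable_cplx f -> measurable [set t | box la lb lc ld (f t)].
Proof.
move=> [mr mi]; rewrite (_ : [set t | _] =
  (setT `&` (fun t => complex.Re (f t)) @^-1` [set` Interval (BSide la a) (BSide lb b)]) `&`
  (setT `&` (fun t => complex.Im (f t)) @^-1` [set` Interval (BSide lc c) (BSide ld d)])).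
  by apply: measurableI; [apply: mr | apply: mi] => //; exact: measurable_itv.
by rewrite !setTI.
Qed.

End BoxDistance.

Section Squeeze.
Context (R : realType) (d : measure_display) (T : measurableType d).
Variables (P : probability T R) (X : int -> {RV P >-> R}) (theta : {RV P >-> R}).
Hypotheses (X_rademacher : forall m, rademacher (X m))
    (X_independent : mutually_independent X)
    (theta_uniform : uniform01 theta)
    (theta_independent : independent_of_family theta X).
Variables (a b c e : R) (la lb lc ld : bool).

Local Notation GR w := (complex.Re (GX X theta w)).
Local Notation GI w := (complex.Im (GX X theta w)).
Local Notation bd := (box_dist a b c e).
Local Notation U := (box a b c e la lb lc ld).

(** Near the boundary, the real or the imaginary part is close to one of the four
    constants that define the sides. *)
Lemma boundary_small (eps : R) : 0 < eps -> exists2 eta : R, 0 < eta &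
  pr P [set w | `|bd (GR w) (GI w)| <= eta] <= eps.
Proof.
move=> eps0; have e40 : 0 < eps / 4 by rewrite divr_gt0.
have ac r := GX_anticoncentration X_rademacher X_independent theta_uniform
  theta_independent r e40.
have [[e1 e10 h1] _] := ac a; have [[e2 e20 h2] _] := ac b.
have [_ [e3 e30 h3]] := ac c; have [_ [e4 e40' h4]] := ac e.
exists (Num.min (Num.min e1 e2) (Num.min e3 e4)); first by rewrite !lt_min e10 e20 e30 e40'.
set eta := Num.min _ _.
have l1 : eta <= e1 by rewrite /eta !ge_min lexx.
have l2 : eta <= e2 by rewrite /eta !ge_min lexx !orbT.
have l3 : eta <= e3 by rewrite /eta !ge_min lexx !orbT.
have l4 : eta <= e4 by rewrite /eta !ge_min lexx !orbT.
have mR := @measurable_Re_GX _ _ _ P X theta; have mI := @measurable_Im_GX _ _ _ P X theta.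
have mRa r s : measurable [set w | `|GR w - r| <= s].
  by apply: measurable_abs_le; exact: measurable_funB.
have mIa r s : measurable [set w | `|GI w - r| <= s].
  by apply: measurable_abs_le; exact: measurable_funB.
have mb : measurable [set w | `|bd (GR w) (GI w)| <= eta].
  by apply: measurable_abs_le; exact: measurable_box_dist.
have m12 := measurableU _ _ (mRa a e1) (mRa b e2).
have m34 := measurableU _ _ (mIa c e3) (mIa e e4).
apply: (@le_trans _ _ (pr P _ + pr P _)); first apply: (@pr_le_setU _ _ _ P _ _ _ mb m12 m34).
  move=> w /= /box_dist_near0[h|h|h|h].
  - by left; left; exact: le_trans h l1.
  - by left; right; exact: le_trans h l2.
  - by right; left; exact: le_trans h l3.
  - by right; right; exact: le_trans h l4.
apply: le_trans (lerD (pr_setU P (mRa a e1) (mRa b e2)) (pr_setU P (mIa c e3) (mIa e e4))) _.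
by apply: le_trans (lerD (lerD h1 h2) (lerD h3 h4)) _; lra.
Qed.

(** [pr_fekete_le] for the signed distance bounds the measure of the rectangle from
    above, and for its opposite the measure of the complement; in both cases the loss
    is the probability that the process is close to the boundary. *)
Lemma fekete_box_cvg (eps : R) : 0 < eps -> exists p0, forall p, prime p -> (p0 <= p)%N ->
  `|pr P [set w | U (GX X theta w)] - pr (unif R) [set t | U (feketeratio p t)]| <= eps.
Proof.
move=> eps0; have e20 : 0 < eps / 2 by rewrite divr_gt0.
have [eta eta0 hb] := boundary_small e20.
pose e1 := Num.min eta (eps / 2).
have e10 : 0 < e1 by rewrite lt_min eta0.
have e1eta : e1 <= eta by rewrite ge_min lexx.
have e1eps : e1 <= eps / 2 by rewrite ge_min lexx orbT.
have meas1 (d' : measure_display) (T' : measurableType d') (f g : T' -> R) (r : R) :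
  measurable_fun setT f -> measurable_fun setT g -> measurable [set t | bd (f t) (g t) <= r].
  by move=> mf mg; apply: measurable_le_cst; exact: measurable_box_dist.
have meas2 (d' : measure_display) (T' : measurableType d') (f g : T' -> R) (r : R) :
  measurable_fun setT f -> measurable_fun setT g -> measurable [set t | - bd (f t) (g t) <= r].
  move=> mf mg; apply: (@measurable_le_cst _ _ _ (fun t => - bd (f t) (g t))).
  by apply: measurableT_comp => //; exact: measurable_box_dist.
have lip2 (x y x' y' del : R) : `|x - x'| <= del -> `|y - y'| <= del ->
    - bd x y <= - bd x' y' + del.
  rewrite distrC [`|y - y'|]distrC => h1 h2.
  by have := box_dist_lip a b c e h1 h2; lra.
have [p1 h1] := pr_fekete_le X_rademacher X_independent theta_uniform theta_independent
  (@box_dist_lip R a b c e) meas1 e10.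
have [p2 h2] := pr_fekete_le X_rademacher X_independent theta_uniform theta_independent
  lip2 meas2 e10.
exists (p1 + p2)%N => p p_pr pp.
have {}h1 := h1 p p_pr (leq_trans (leq_addr _ _) pp).
have {}h2 := h2 p p_pr (leq_trans (leq_addl _ _) pp).
have mGX : measurable_cplx (GX X theta).
  by split; [exact: measurable_Re_GX | exact: measurable_Im_GX].
have mF := measurable_cplx_feketeratio R p.
have mUG : measurable [set w | U (GX X theta w)] by exact: measurable_box.
have mUF : measurable [set t | U (feketeratio p t)] by exact: measurable_box.
have mb : measurable [set w | `|bd (GR w) (GI w)| <= eta].
  by apply: measurable_abs_le; apply: measurable_box_dist; case: mGX.
have up : pr (unif R) [set t | U (feketeratio p t)] <= pr P [set w | U (GX X theta w)] + eps.
  apply: le_trans (_ : _ <= pr (unif R) [set t | bd (complex.Re (feketeratio p t)) (complex.Im (feketeratio p t)) <= 0]) _.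
    apply: (@pr_le _ _ _ (unif R)) => //; first by apply: meas1; case: mF.
    by move=> t /=; exact: box_dist_le0.
  apply: le_trans h1 _.
  have : pr P [set w | bd (GR w) (GI w) <= e1] <= pr P [set w | U (GX X theta w)] +
     pr P [set w | `|bd (GR w) (GI w)| <= eta].
    apply: pr_le_setU => //; first by apply: meas1; case: mGX.
    move=> w /= hw; have [h|h] := ltP (bd (GR w) (GI w)) 0.
      by left; exact: box_dist_lt0 h.
    by right; rewrite ger0_norm// (le_trans hw).
  by move: hb e1eps; lra.
have low : 1 - pr (unif R) [set t | U (feketeratio p t)] <= 1 - pr P [set w | U (GX X theta w)] + eps.
  rewrite -(pr_setC (unif R) mUF) -(pr_setC P mUG).
  apply: le_trans (_ : _ <= pr (unif R) [set t | - bd (complex.Re (feketeratio p t)) (complex.Im (feketeratio p t)) <= 0]) _.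
    apply: (@pr_le _ _ _ (unif R)); [exact: measurableC|by apply: meas2; case: mF|].
    move=> t /= nU; rewrite oppr_le0 leNgt; apply/negP => h; apply: nU.
    exact: box_dist_lt0 h.
  apply: le_trans h2 _.
  have : pr P [set w | - bd (GR w) (GI w) <= e1] <= pr P (~` [set w | U (GX X theta w)]) +
     pr P [set w | `|bd (GR w) (GI w)| <= eta].
    apply: pr_le_setU => //; [by apply: meas2; case: mGX|exact: measurableC|].
    move=> w /= hw; have [h|h] := ltP 0 (bd (GR w) (GI w)).
      by left => Uw; have := box_dist_le0 Uw; rewrite leNgt h.
    by right; rewrite ler0_norm// (le_trans hw).
  by move: hb e1eps; lra.
by rewrite ler_norml; apply/andP; split; lra.
Qed.

End Squeeze.

Theorem theorem1p5 (R : realType) (d : measure_display) (T : measurableType d)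
    (P : probability T R) (X : int -> {RV P >-> R}) (theta : {RV P >-> R})
    (X_rademacher : forall m, rademacher (X m))
    (X_independent : mutually_independent X)
    (theta_uniform : uniform01 theta)
    (theta_independent : independent_of_family theta X)
    (U : set R[i]) (U_rectangle : is_rectangle U) :
  (fun p : nat => lebesgue_measure
     [set t : R | (0 <= t <= 1) /\
                  U ((fekete R p).[e t] / (fekete R p).[zeta R p])])
    @ within [set p : nat | prime p] \oo
  --> P [set w : T | U (G (fun m => X m w) (theta w))].
Proof.
have [a [b [c [f [la [lb [lc [ld [_ _ UE]]]]]]]]] := U_rectangle.
have {}UE : U = box a b c f la lb lc ld by [].
subst U.
have mG : measurable [set w | box a b c f la lb lc ld (GX X theta w)].
  apply: measurable_box; split; [exact: measurable_Re_GX | exact: measurable_Im_GX].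
have lebE p : lebesgue_measure [set t : R | (0 <= t <= 1) /\
      box a b c f la lb lc ld ((fekete R p).[e t] / (fekete R p).[zeta R p])] =
    (pr (unif R) [set t | box a b c f la lb lc ld (feketeratio p t)])%:E.
  have mU : measurable [set t : R | box a b c f la lb lc ld (feketeratio p t)].
    by apply: measurable_box; exact: measurable_cplx_feketeratio.
  rewrite (EFin_pr (unif R) mU) unifE//; congr lebesgue_measure.
  by apply/seteqP; split => t /=; rewrite in_itv/= => -[].
rewrite (funext lebE) -(EFin_pr P mG).
apply/fine_cvgP; split; first by apply: nearW.
apply/cvgrPdist_le => eps eps0.
have [p0 hp] := fekete_box_cvg X_rademacher X_independent theta_uniform
  theta_independent a b c f la lb lc ld eps0.
by exists p0 => // p /= p0p p_pr; exact: hp.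
Qed.
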